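(* Assume $|a|<\frac12$, and let $A$ and $B$ be the integral operators on $\mathbb{R}_+$ with kernels $$A(x,y)=\frac{\sigma}{\pi}\left(\frac{x}{y}\right)^{a}\frac{e^{-\frac{x+y}{2}}}{x+y},\qquad B(x,y)=A(y,x)=\frac{\sigma}{\pi}\left(\frac{x}{y}\right)^{-a}\frac{e^{-\frac{x+y}{2}}}{x+y}.$$ For real $b$ and $m>0$ let $f_{b,m}(x)=\frac1x W_{b,im}(x)$, $x>0$. Then for every $m>0$ $$Af_{-a,m}=\frac{\sigma}{\pi}\,\Gamma(\tfrac12-a+im)\,\Gamma(\tfrac12-a-im)\,f_{a,m},$$ $$Bf_{a,m}=\frac{\sigma}{\pi}\,\Gamma(\tfrac12+a+im)\,\Gamma(\tfrac12+a-im)\,f_{-a,m}.$$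
   Context: $\mathbb{R}_+=(0,+\infty)$. An integral operator with kernel $k(x,y)$ acts by $(kf)(x)=\int_0^\infty k(x,y)f(y)\,dy$; here it is applied to the functions $f_{\pm a,m}$, which are elements of a continual basis (generalized eigenfunctions) and do not themselves belong to $L^2(\mathbb{R}_+)$. Parameters: either $z,z'\in\mathbb{C}\setminus\mathbb{Z}$ and $z'=\bar z$, or $z,z'\in\mathbb{R}\setminus\mathbb{Z}$ and $n<z,z'<n+1$ for some $n\in\mathbb{Z}$. Put $a=\frac{z+z'}2$ and $\sigma=\sqrt{\sin(\pi z)\sin(\pi z')}>0$. $W_{\kappa,\mu}(x)$, $x>0$, is the Whittaker function: for $\mu\neq 0$, $$x^{-1/2}e^{x/2}W_{\kappa,\mu}(x)=\frac{\Gamma(-2\mu)x^{\mu}}{\Gamma(\frac12-\kappa-\mu)}\,{}_1F_1(\tfrac12-\kappa+\mu;2\mu+1;x)+\frac{\Gamma(2\mu)x^{-\mu}}{\Gamma(\frac12-\kappa+\mu)}\,{}_1F_1(\tfrac12-\kappa-\mu;-2\mu+1;x).$$ *)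

(* Defs.v *)
From mathcomp Require Import all_boot all_order all_algebra.
From mathcomp Require Import all_classical all_reals all_analysis.
From mathcomp Require Import complex.
From mathcomp Require Import ring lra.

Set Implicit Arguments.
Unset Strict Implicit.
Unset Printing Implicit Defensive.
Import Order.TTheory GRing.Theory Num.Theory.
Import numFieldNormedType.Exports.
Local Open Scope classical_set_scope.
Local Open Scope ring_scope.
Local Open Scope complex_scope.

Local Notation Re := complex.Re.
Local Notation Im := complex.Im.

Section ComplexFunctions.
Context {R : realType}.
Implicit Types (z w : R[i]) (x : R) (f : R -> R[i]).

Definition cexp z : R[i] := (expR (Re z))%:C * (cos (Im z) +i* sin (Im z)).

Definition csin z : R[i] :=
  (cexp ('i * z) - cexp (- ('i * z))) / (2%:R * 'i).

(* x ^ w with the principal branch; only meaningful for 0 < x *)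
Definition cpow x w : R[i] := cexp (w * (ln x)%:C).

Definition cintegrable (D : set R) f : Prop :=
  lebesgue_measure.-integrable D (fun t => (Re (f t))%:E) /\
  lebesgue_measure.-integrable D (fun t => (Im (f t))%:E).

Definition cintegral (D : set R) f : R[i] :=
  (\int[lebesgue_measure]_(t in D) Re (f t)) +i*
  (\int[lebesgue_measure]_(t in D) Im (f t)).

Definition halfline : set R := [set x | 0 < x].

(* Euler's integral, convergent for 0 < Re z *)
Definition Gamma_euler z : R[i] :=
  cintegral halfline (fun t => cpow t (z - 1) * (expR (- t))%:C).

(* least n such that 0 < Re z + n *)
Definition Gamma_shift z : nat :=
  if 0 < Re z then 0%N else (Num.truncn (- Re z)).+1.

(* Analytic continuation of Euler's integral through Gamma (z + 1) = z Gamma z.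
   At the poles 0, -1, -2, ... the division by zero gives the value 0, so that
   (Gamma z)^-1 is the entire function 1 / Gamma everywhere. *)
Definition Gamma z : R[i] :=
  Gamma_euler (z + (Gamma_shift z)%:R) / \prod_(k < Gamma_shift z) (z + k%:R).

Definition pochhammer z (n : nat) : R[i] := \prod_(k < n) (z + k%:R).

(* Kummer's function 1F1(alpha; gamma; x); ^o selects the norm topology *)
Definition hyp1F1 (alpha gamma : R[i]) x : R[i] :=
  limn (series (fun n : nat =>
    pochhammer alpha n / pochhammer gamma n * x%:C ^+ n / (n`!)%:R : R[i]^o)).

(* The Whittaker function W_{kappa,mu}(x) for 0 < x and 2 mu not an integer *)
Definition whittakerW (kappa mu : R[i]) x : R[i] :=
  (Num.sqrt x * expR (- (x / 2)))%:C *
  (Gamma (- (2%:R * mu)) * cpow x mu / Gamma (2%:R^-1 - kappa - mu) *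
     hyp1F1 (2%:R^-1 - kappa + mu) (2%:R * mu + 1) x +
   Gamma (2%:R * mu) * cpow x (- mu) / Gamma (2%:R^-1 - kappa + mu) *
     hyp1F1 (2%:R^-1 - kappa - mu) (- (2%:R * mu) + 1) x).

End ComplexFunctions.

Section Kernels.
Context {R : realType}.
Implicit Types (a b m s x y : R) (K : R -> R -> R).

Definition admissible (z z' : R[i]) : Prop :=
  (forall n : int, z <> n%:~R /\ z' <> n%:~R) /\
  (z' = z^* \/
   exists r r' : R, [/\ z = r%:C, z' = r'%:C &
     exists n : int, n%:~R < r < (n + 1)%:~R /\ n%:~R < r' < (n + 1)%:~R]).

(* For admissible (z, z') the numbers (z + z') / 2 and
   sin (pi z) sin (pi z') are real, and the latter is positive:
   see param_aE and sin_prod_gt0. *)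
Definition param_a (z z' : R[i]) : R := Re ((z + z') / 2%:R).

Definition sin_prod (z z' : R[i]) : R[i] := csin (pi%:C * z) * csin (pi%:C * z').

Definition sigma (z z' : R[i]) : R := Num.sqrt (Re (sin_prod z z')).

Definition kernelA s a x y : R :=
  s / pi * (x / y) `^ a * (expR (- ((x + y) / 2)) / (x + y)).

Definition kernelB s a x y : R := kernelA s a y x.

Definition intop_defined K (f : R -> R[i]) : Prop :=
  forall x, 0 < x -> cintegrable halfline (fun y => (K x y)%:C * f y).

Definition intop K (f : R -> R[i]) x : R[i] :=
  cintegral halfline (fun y => (K x y)%:C * f y).

Definition fbm b m x : R[i] := whittakerW b%:C ('i * m%:C) x / x%:C.

Lemma kernelBE s a x y : 0 < x -> 0 < y ->
  kernelB s a x y =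
  s / pi * (x / y) `^ (- a) * (expR (- ((x + y) / 2)) / (x + y)).
Proof.
move=> x0 y0; rewrite /kernelB /kernelA (addrC y x); congr (_ * _ * _).
have xy0 : 0 <= x / y by rewrite divr_ge0 ?ltW.
by rewrite -[y / x]invf_div -(powR_inv1 xy0) -powRrM mulN1r.
Qed.

Lemma param_aE (z z' : R[i]) : admissible z z' ->
  (param_a z z')%:C = (z + z') / 2%:R.
Proof.
case=> _ zz'; rewrite /param_a.
have [t ->] : exists t : R, z + z' = t%:C.
  case: zz' => [->|[r [r' [-> -> _]]]]; last first.
    by exists (r + r'); rewrite rmorphD.
  by exists (2%:R * Re z); rewrite addcJ rmorphM /= rmorph_nat.
by rewrite -(rmorph_nat (real_complex R)) -fmorphV -rmorphM.
Qed.

Lemma csinE (x y : R) : csin (x +i* y) =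
  (sin x * (expR y + expR (- y)) / 2) +i* (cos x * (expR y - expR (- y)) / 2).
Proof.
rewrite /csin /cexp; simpc => /=.
by rewrite sinN cosN; congr (_ +i* _); field.
Qed.

Lemma sin_pi_prod_gt0 (n : int) (r r' : R) :
  n%:~R < r < (n + 1)%:~R -> n%:~R < r' < (n + 1)%:~R ->
  0 < sin (pi * r) * sin (pi * r').
Proof.
have shift (t : R) : sin (pi * (t + 1)) = - sin (pi * t).
  by rewrite mulrDr mulr1 sinDpi.
elim: n r r' => [r r'|n IHn r r'|n IHn r r'].
- rewrite add0r => /andP[r0 r1] /andP[r'0 r'1].
  apply: mulr_gt0; apply: sin_gt0_pi.
    by rewrite mulr_gt0 ?pi_gt0 //= gtr_pMr ?pi_gt0.
  by rewrite mulr_gt0 ?pi_gt0 //= gtr_pMr ?pi_gt0.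
- rewrite -[r](subrK 1) -[r'](subrK 1) !shift mulrNN => hr hr'.
  move: hr hr'; rewrite !intrD => hr hr'.
  by apply: IHn; rewrite !intrD; lra.
- move=> hr hr'; rewrite -mulrNN -!shift.
  move: hr hr'; rewrite -addn1 PoszD opprD !intrD => hr hr'.
  by apply: IHn; rewrite !intrD; lra.
Qed.

Lemma sin_prod_gt0 (z z' : R[i]) : admissible z z' -> 0 < sin_prod z z'.
Proof.
have csinr (r : R) : csin (pi%:C * r%:C) = (sin (pi * r))%:C.
  rewrite -rmorphM csinE oppr0 expR0 subrr mulr0 mul0r.
  by congr (_ +i* _); field.
case=> zZ [z'E|[r [r' [-> -> [n [hr hr']]]]]]; last first.
  by rewrite /sin_prod !csinr -rmorphM ltcR (sin_pi_prod_gt0 hr hr').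
case: z => x y in zZ z'E *; have [y0|y0] := eqVneq y 0.
  have xx' : z' = x%:C by rewrite z'E y0 /= oppr0.
  rewrite y0 xx' /sin_prod !csinr -rmorphM ltcR.
  have hx : (Num.floor x)%:~R < x < (Num.floor x + 1)%:~R.
    rewrite floorD1_gt andbT lt_neqAle floor_le andbT; apply/eqP => xE.
    have [+ _] := zZ (Num.floor x); apply.
    by rewrite y0 -(rmorph_int (real_complex R)) /= xE.
  exact: (sin_pi_prod_gt0 hx hx).
have piM (u v : R) : pi%:C * (u +i* v) = (pi * u) +i* (pi * v) by simpc.
rewrite z'E /sin_prod /= !piM !csinE mulrN opprK.
set p := expR _; set q := expR _; set S := sin _; set C := cos _.
have SC : C ^+ 2 + S ^+ 2 = 1 by exact: cos2Dsin2.
have p0 : 0 < p by exact: expR_gt0.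
have q0 : 0 < q by exact: expR_gt0.
have pq : 0 < (p - q) ^+ 2.
  rewrite exprn_even_gt0 //= subr_eq0; apply/eqP => /expR_inj /eqP.
  by rewrite -addr_eq0 -mulr2n mulrn_eq0 mulf_eq0 (negbTE y0) (gt_eqF (pi_gt0 R)).
have pos : 0 < (p - q) ^+ 2 + 4 * p * q * S ^+ 2.
  by apply: ltr_wpDr => //; apply: mulr_ge0; [rewrite !mulr_ge0 ?ltW | exact: sqr_ge0].
rewrite ltcE /=; apply/andP; split; first by apply/eqP; field.
rewrite [ltRHS](_ : _ = ((p - q) ^+ 2 + 4 * p * q * S ^+ 2) / 4) ?divr_gt0 //.
transitivity ((S ^+ 2 * (p + q) ^+ 2 + C ^+ 2 * (p - q) ^+ 2) / 4).
  by field.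
by rewrite (_ : C ^+ 2 = 1 - S ^+ 2); [field | rewrite -SC; ring].
Qed.


End Kernels.

(* Main.v *)
Require Import Defs.
From mathcomp Require Import all_boot all_order all_algebra.
From mathcomp Require Import all_classical all_reals all_analysis.
From mathcomp Require Import measurable_realfun complex.
From mathcomp Require Import ring lra.

(** The kernel e^(-(x+y)/2) / (x+y) maps Laplace integrals to Laplace integrals,
    so both identities are read off an integral representation of the functions
    involved. Put
      tricomi b d x = int_0^oo t^(b-1) (1+t)^(d-1) e^(-xt) dt.
    Up to a Gamma factor and elementary factors, W_{a,im}(x) is
    tricomi (1/2-a-im) (1/2+a-im) x ([fbmE]), so that the change of a into - a
    exchanges b and d. On the other side, when Re b + Re d = 1,
      int_0^oo y^(d-1) e^(-y) / (x+y) tricomi b d y dy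
        = Gamma(b) Gamma(1-b) x^(d-1) tricomi d b x      ([stieltjes_tricomi]):
    substitute y = x s / (1+t) in the inner integral, interchange the integrals,
    and substitute t = (1+s) u; this leaves the Mellin transform of 1/(1+u), which
    is Gamma(b) Gamma(1-b). The representations of the two functions carry the
    factors 1/Gamma(b) and 1/Gamma(d), which turns this product into
    Gamma(1-b) Gamma(d), the constant of the first identity. The identity for B
    is the one for A with - a in place of a.

    The bulk of the work is the integral representation ([whittakerE]), since the
    Whittaker function is given by two series 1F1. With nu = 2im and
    beta = 1/2 - kappa + im, the Laplace-type transform
      int_0^oo p^(beta-1) e^(-p) K(xp) dp,   K(q) = int_0^oo w^(-nu-1) e^(-w-q/w) dw,
    of a Macdonald function is evaluated twice. Interchanging the integrals gives
    Gamma(beta) x^(-nu) tricomi (beta-nu) (1-beta) x ([bessel_laplace_tricomi]);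
    integrating the power series of K term by term gives the two series 1F1
    ([cvg_bessel_laplace]).

    The power series of K ([cvg_bessel]) is obtained from integrals alone. With
    q = r^2, the substitution w = r u and the inversion u -> 1/u fold the integral
    onto u > 1, where e^(-r/u) is expanded. The terms are incomplete Gamma
    functions at the points nu - n and - nu - n, and each of them is a Gamma value
    minus a power series in r, with denominators nu - n + j and - nu - n + j
    respectively ([cvg_lower_sum]). The Gamma values give the two expected series. The remaining
    double sums, truncated to the same square of indices, are opposite to each
    other at nu and - nu, so they cancel exactly before any limit is taken; the
    truncation errors are uniform because these denominators stay at least at the
    distance |Im nu| from 0.

    Division by Gamma factors requires that Gamma has no zero in the right
    half-plane ([Gamma_neq0]): far to the right the Gamma distribution is
    concentrated, so the oscillation of t^(iy) cannot cancel its mass, and the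
    functional equation does the rest. *)

Set Implicit Arguments.
Unset Strict Implicit.
Unset Printing Implicit Defensive.
Import Order.TTheory GRing.Theory Num.Theory.
Import numFieldNormedType.Exports.
Local Open Scope classical_set_scope.
Local Open Scope ring_scope.
Local Open Scope complex_scope.

Local Notation Re := complex.Re.
Local Notation Im := complex.Im.
Local Notation normc := Normc.normc.

(** * Complex powers of positive numbers *)

Section ComplexPowers.
Context {R : realType}.
Implicit Types (z w : R[i]) (x y : R).

Lemma ReD z w : Re (z + w) = Re z + Re w. Proof. by case: z w => [a b] [c d]. Qed.
Lemma ImD z w : Im (z + w) = Im z + Im w. Proof. by case: z w => [a b] [c d]. Qed.
Lemma ReN z : Re (- z) = - Re z. Proof. by case: z. Qed.
Lemma ImN z : Im (- z) = - Im z. Proof. by case: z. Qed.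
Lemma ReM z w : Re (z * w) = Re z * Re w - Im z * Im w.
Proof. by case: z w => [a b] [c d]. Qed.
Lemma ImM z w : Im (z * w) = Re z * Im w + Im z * Re w.
Proof. by case: z w => [a b] [c d]. Qed.

Lemma ReB1 z : Re (z - 1) = Re z - 1.
Proof. by rewrite ReD ReN. Qed.
Lemma Re_nat n : Re (n%:R : R[i]) = n%:R.
Proof. by rewrite -(rmorph_nat (real_complex R)). Qed.
Lemma Im_nat n : Im (n%:R : R[i]) = 0.
Proof. by rewrite -(rmorph_nat (real_complex R)). Qed.
Lemma complex_eq z w : Re z = Re w -> Im z = Im w -> z = w.
Proof. by case: z w => [a b] [c d] /= -> ->. Qed.

Lemma real_complexD x y : (x + y)%:C = x%:C + y%:C :> R[i].
Proof. exact: rmorphD. Qed.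
Lemma real_complexM x y : (x * y)%:C = x%:C * y%:C :> R[i].
Proof. exact: rmorphM. Qed.
Lemma real_complexV x : (x^-1)%:C = (x%:C)^-1 :> R[i].
Proof. exact: fmorphV. Qed.
Lemma real_complexX x n : (x ^+ n)%:C = (x%:C) ^+ n :> R[i].
Proof. exact: rmorphXn. Qed.
Lemma real_complexN x : (- x)%:C = - x%:C :> R[i].
Proof. exact: rmorphN. Qed.
Lemma real_complex_nat n : (n%:R)%:C = n%:R :> R[i].
Proof. exact: rmorph_nat. Qed.

Lemma normc_real x : normc x%:C = `|x|.
Proof. by rewrite /= expr0n /= addr0 sqrtr_sqr. Qed.

Lemma normc_ge0 z : 0 <= normc z.
Proof. by case: z => a b; exact: sqrtr_ge0. Qed.

Lemma Re_le_normc z : `|Re z| <= normc z.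
Proof.
by case: z => a b /=; rewrite -sqrtr_sqr ler_wsqrtr// lerDl sqr_ge0.
Qed.

Lemma Im_le_normc z : `|Im z| <= normc z.
Proof.
by case: z => a b /=; rewrite -sqrtr_sqr ler_wsqrtr// lerDr sqr_ge0.
Qed.

Lemma normcD_le z w : normc (z + w) <= normc z + normc w.
Proof. exact: le_normcD. Qed.

Lemma normc_le_ReIm z : normc z <= `|Re z| + `|Im z|.
Proof.
rewrite {1}(_ : z = (Re z)%:C + (0 +i* Im z)); last by case: z => a b; simpc.
apply: le_trans (normcD_le _ _) _; rewrite normc_real.
by rewrite /= expr0n /= add0r sqrtr_sqr.
Qed.

Lemma normcX z n : normc (z ^+ n) = normc z ^+ n.
Proof.
elim: n => [|n IH]; first by rewrite !expr0 Normc.normc1.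
by rewrite !exprS Normc.normcM IH.
Qed.

Lemma normc_sum (I : Type) (s : seq I) (P : pred I) (F : I -> R[i]) :
  normc (\sum_(i <- s | P i) F i) <= \sum_(i <- s | P i) normc (F i).
Proof.
elim/big_ind2: _ => [|z x w y zx wy|//]; first by rewrite Normc.normc0.
exact: le_trans (normcD_le _ _) (lerD zx wy).
Qed.

Lemma cexpD z w : cexp (z + w) = cexp z * cexp w.
Proof.
rewrite /cexp ReD ImD expRD cosD sinD; apply: complex_eq;
  rewrite !(ReM, ImM) /=; ring.
Qed.

Lemma cexp0 : cexp 0 = 1 :> R[i].
Proof. by rewrite /cexp /= expR0 cos0 sin0 mul1r. Qed.

Lemma normc_cexp z : normc (cexp z) = expR (Re z).
Proof.
rewrite /cexp Normc.normcM normc_real ger0_norm ?expR_ge0//=.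
by rewrite cos2Dsin2 sqrtr1 mulr1.
Qed.

Lemma cpowD x z w : cpow x (z + w) = cpow x z * cpow x w.
Proof. by rewrite /cpow mulrDl cexpD. Qed.

Lemma cpow0 x : cpow x 0 = 1 :> R[i].
Proof. by rewrite /cpow mul0r cexp0. Qed.

Lemma cpow1e z : cpow 1 z = 1 :> R[i].
Proof. by rewrite /cpow ln1 mulr0 cexp0. Qed.

Lemma cpowMl x y z : 0 < x -> 0 < y -> cpow (x * y) z = cpow x z * cpow y z.
Proof. by move=> x0 y0; rewrite /cpow lnM// real_complexD mulrDr cexpD. Qed.

Lemma cpow_neq0 x z : cpow x z != 0.
Proof.
apply/eqP => /(congr1 (@Normc.normc R)); rewrite normc_cexp Normc.normc0.
by apply/eqP; rewrite gt_eqF ?expR_gt0.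
Qed.

Lemma cpowN x z : cpow x (- z) = (cpow x z)^-1.
Proof.
by apply: (mulIf (cpow_neq0 x z)); rewrite -cpowD addNr cpow0 mulVf ?cpow_neq0.
Qed.

Lemma cpowVl x z : 0 < x -> cpow x^-1 z = cpow x (- z).
Proof. by move=> x0; rewrite /cpow lnV// real_complexN mulrN mulNr. Qed.

Lemma cpow_real x a : 0 < x -> cpow x a%:C = (x `^ a)%:C.
Proof.
move=> x0; rewrite /cpow -real_complexM /cexp /= cos0 sin0 mulr1.
by rewrite /powR gt_eqF.
Qed.

Lemma cpow_nat x n : 0 < x -> cpow x n%:R = (x ^+ n)%:C.
Proof.
by move=> x0; rewrite -real_complex_nat cpow_real// powR_mulrn// ltW.
Qed.

Lemma cpow1 x : 0 < x -> cpow x 1 = x%:C.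
Proof. by move=> x0; rewrite -[1]/(1%:R) cpow_nat. Qed.

Lemma cpowB1 x z : 0 < x -> cpow x (z - 1) = cpow x z / x%:C.
Proof. by move=> x0; rewrite cpowD (cpowN x 1) cpow1. Qed.

Lemma normc_cpow x z : 0 < x -> normc (cpow x z) = x `^ Re z.
Proof.
by move=> x0; rewrite /cpow normc_cexp ReM /= mulr0 subr0 /powR gt_eqF.
Qed.

Lemma normc_cpowM x z w : 0 < x -> normc (cpow x z * w) = x `^ Re z * normc w.
Proof. by move=> x0; rewrite Normc.normcM normc_cpow. Qed.

Lemma normc_realM x z : 0 <= x -> normc (x%:C * z) = x * normc z.
Proof. by move=> x0; rewrite Normc.normcM normc_real ger0_norm. Qed.

Lemma normc_real_ge0 x : 0 <= x -> normc x%:C = x.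
Proof. by move=> x0; rewrite normc_real ger0_norm. Qed.

Lemma Re_cpow x z : Re (cpow x z) = expR (Re z * ln x) * cos (Im z * ln x).
Proof. by rewrite /cpow /cexp !(ReM,ImM) /= !mulr0 !mul0r !subr0 add0r. Qed.

Lemma Im_cpow x z : Im (cpow x z) = expR (Re z * ln x) * sin (Im z * ln x).
Proof. by rewrite /cpow /cexp !(ReM,ImM) /= !mulr0 !mul0r addr0 add0r subr0. Qed.

End ComplexPowers.

(** * Measurability of complex functions *)

Section ComplexMeasurable.
Context {R : realType} d {T : measurableType d}.
Implicit Types (D : set T) (f g : T -> R[i]).

Definition cmeasurable_fun D f :=
  measurable_fun D (fun t => Re (f t)) /\ measurable_fun D (fun t => Im (f t)).

Lemma cmeasurable_cst D z : cmeasurable_fun D (fun=> z).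
Proof. by split; exact: measurable_cst. Qed.

Lemma cmeasurable_real D (h : T -> R) :
  measurable_fun D h -> cmeasurable_fun D (fun t => (h t)%:C).
Proof. by move=> mh; split => //=; exact: measurable_cst. Qed.

Lemma cmeasurableD D f g : cmeasurable_fun D f -> cmeasurable_fun D g ->
  cmeasurable_fun D (fun t => f t + g t).
Proof.
move=> [f1 f2] [g1 g2]; split.
- by under eq_fun do rewrite ReD; exact: measurable_funD.
- by under eq_fun do rewrite ImD; exact: measurable_funD.
Qed.

Lemma cmeasurableM D f g : cmeasurable_fun D f -> cmeasurable_fun D g ->
  cmeasurable_fun D (fun t => f t * g t).
Proof.
move=> [f1 f2] [g1 g2]; split.
- under eq_fun do rewrite ReM.
  by apply: measurable_funB; exact: measurable_funM.
- under eq_fun do rewrite ImM.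
  by apply: measurable_funD; exact: measurable_funM.
Qed.

Lemma cmeasurable_sum D (h : nat -> T -> R[i]) n :
  (forall k, cmeasurable_fun D (h k)) ->
  cmeasurable_fun D (fun t => \sum_(k < n) h k t).
Proof.
move=> mh; elim: n => [|n IH].
  by under eq_fun do rewrite big_ord0; exact: cmeasurable_cst.
by under eq_fun do rewrite big_ord_recr /=; exact: cmeasurableD.
Qed.

Lemma cmeasurable_cpow D (h : T -> R) z :
  measurable_fun D h -> cmeasurable_fun D (fun t => cpow (h t) z).
Proof.
move=> mh; have ml : measurable_fun D (fun t => ln (h t)).
  by apply: measurableT_comp mh; exact: measurable_ln.
split.
- under eq_fun do rewrite Re_cpow.
  apply: measurable_funM; apply: measurableT_comp.
  + exact: measurable_expR.
  + exact: measurable_funM.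
  + by apply: continuous_measurable_fun; exact: continuous_cos.
  + exact: measurable_funM.
- under eq_fun do rewrite Im_cpow.
  apply: measurable_funM; apply: measurableT_comp.
  + exact: measurable_expR.
  + exact: measurable_funM.
  + by apply: continuous_measurable_fun; exact: continuous_sin.
  + exact: measurable_funM.
Qed.

Lemma measurable_funV D (h : T -> R) :
  measurable_fun D h -> measurable_fun D (fun t => (h t)^-1).
Proof.
move=> mh.
(* t^-1 = t (t^2)^(-1) holds at t = 0 as well, and real powers are measurable *)
have -> : (fun t => (h t)^-1) = (fun t => h t * (h t ^+ 2) `^ (-1)).
  apply/funext => t; have [->|h0] := eqVneq (h t) 0; first by rewrite invr0 mul0r.
  by rewrite powR_inv1 ?sqr_ge0// expr2 invfM mulrA divff// mul1r.
apply: measurable_funM => //.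
apply: (@measurableT_comp _ _ _ _ _ _ (fun x : R => x `^ (-1))).
  exact: measurable_powR.
exact: measurable_funX.
Qed.

Lemma measurable_fun_expR D (h : T -> R) :
  measurable_fun D h -> measurable_fun D (fun t => expR (h t)).
Proof. by move=> mh; apply: measurableT_comp mh; exact: measurable_expR. Qed.

End ComplexMeasurable.

(** * Limits of complex sequences *)

Section ComplexLimits.
Context {R : realType}.
Implicit Types (u v : nat -> R[i]) (l k : R[i]).

Definition ccvg u l :=
  (fun n => Re (u n)) @ \oo --> Re l /\ (fun n => Im (u n)) @ \oo --> Im l.

Lemma ccvg_cst l : ccvg (fun=> l) l. Proof. by split; exact: cvg_cst. Qed.

Lemma ccvg_real (h : nat -> R) (x : R) :
  h @ \oo --> x -> ccvg (fun n => (h n)%:C) x%:C.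
Proof. by move=> hx; split => //=; exact: cvg_cst. Qed.

Lemma ccvgD u v l k : ccvg u l -> ccvg v k -> ccvg (fun n => u n + v n) (l + k).
Proof.
move=> [u1 u2] [v1 v2]; split.
- by under eq_fun do rewrite ReD; rewrite ReD; exact: cvgD.
- by under eq_fun do rewrite ImD; rewrite ImD; exact: cvgD.
Qed.

Lemma ccvgM u v l k : ccvg u l -> ccvg v k -> ccvg (fun n => u n * v n) (l * k).
Proof.
move=> [u1 u2] [v1 v2]; split.
- by under eq_fun do rewrite ReM; rewrite ReM; apply: cvgB; exact: cvgM.
- by under eq_fun do rewrite ImM; rewrite ImM; apply: cvgD; exact: cvgM.
Qed.

Lemma ccvgZ u l k : ccvg u l -> ccvg (fun n => k * u n) (k * l).
Proof. by move=> ul; apply: ccvgM => //; exact: ccvg_cst. Qed.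

Lemma ccvgN u l : ccvg u l -> ccvg (fun n => - u n) (- l).
Proof.
move=> [u1 u2]; split.
- by under eq_fun do rewrite ReN; rewrite ReN; exact: cvgN.
- by under eq_fun do rewrite ImN; rewrite ImN; exact: cvgN.
Qed.

Lemma ccvgB u v l k : ccvg u l -> ccvg v k -> ccvg (fun n => u n - v n) (l - k).
Proof. by move=> ul vk; apply: ccvgD => //; exact: ccvgN. Qed.

Lemma ccvg_unique u l k : ccvg u l -> ccvg u k -> l = k.
Proof.
move=> [u1 u2] [v1 v2]; apply: complex_eq.
- exact: (cvg_unique _ u1 v1).
- exact: (cvg_unique _ u2 v2).
Qed.

Lemma ccvgS u l : ccvg (fun n => u n.+1) l <-> ccvg u l.
Proof.
split=> -[u1 u2]; split.
- by rewrite -(cvg_shiftS (fun n => Re (u n))).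
- by rewrite -(cvg_shiftS (fun n => Im (u n))).
- by rewrite (cvg_shiftS (fun n => Re (u n))).
- by rewrite (cvg_shiftS (fun n => Im (u n))).
Qed.

Lemma ccvg0_le (h : nat -> R) u : (forall n, normc (u n) <= h n) ->
  h @ \oo --> (0 : R) -> ccvg u 0.
Proof.
move=> uh h0.
have aux (v : nat -> R) : (forall n, `|v n| <= normc (u n)) -> v @ \oo --> (0 : R).
  move=> vu; apply/norm_cvg0P.
  apply: (squeeze_cvgr _ (cvg_cst 0) h0); near=> n.
  by rewrite normr_ge0 (le_trans (vu n)).
split => /=; apply: aux => n; [exact: Re_le_normc | exact: Im_le_normc].
Unshelve. all: by end_near. Qed.

(** The norm topology of the complex numbers is the product topology, so that
    limits may be taken componentwise. *)
Lemma ccvg_lim u l : ccvg u l -> limn (u : nat -> R[i]^o) = l.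
Proof.
move=> [u1 u2].
suff ul : (u : nat -> R[i]^o) @ \oo --> (l : R[i]^o) by apply/cvg_lim.
apply/cvgrPdist_lt => e e0.
have eE : e = (Re e)%:C by rewrite RRe_real// gtr0_real.
have e'0 : 0 < Re e by move: e0; rewrite ltcE => /andP[].
have e20 : 0 < Re e / 2 by rewrite divr_gt0.
move/cvgrPdist_lt : u1 => /(_ _ e20) u1.
move/cvgrPdist_lt : u2 => /(_ _ e20) u2.
near=> n.
rewrite eE -[ltLHS]/((normc (l - u n))%:C) ltcR.
apply: le_lt_trans (normc_le_ReIm _) _.
rewrite ReD ImD ReN ImN (splitr (Re e)) ltrD//.
- by near: n.
- by near: n.
Unshelve. all: by end_near. Qed.

End ComplexLimits.

(** * Integrals of complex functions *)

Section ComplexIntegral.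
Context {R : realType}.
Notation mu := (@lebesgue_measure R).
Implicit Types (D : set R) (f g : R -> R[i]).

Lemma cintegrable_cmeasurable D f : cintegrable D f -> cmeasurable_fun D f.
Proof.
move=> [/measurable_int/measurable_EFinP f1 /measurable_int/measurable_EFinP f2].
by split.
Qed.

Lemma cintegrable_dom D f (h : R -> R) : measurable D -> cmeasurable_fun D f ->
  mu.-integrable D (EFin \o h) -> (forall t, D t -> normc (f t) <= h t) ->
  cintegrable D f.
Proof.
move=> mD [f1 f2] ih fh; split.
- apply: le_integrable ih => //; first exact/measurable_EFinP.
  move=> t Dt /=; rewrite lee_fin; apply: le_trans (Re_le_normc _) _.
  by apply: le_trans (fh _ Dt) _; exact: ler_norm.
- apply: le_integrable ih => //; first exact/measurable_EFinP.
  move=> t Dt /=; rewrite lee_fin; apply: le_trans (Im_le_normc _) _.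
  by apply: le_trans (fh _ Dt) _; exact: ler_norm.
Qed.

Lemma cintegrable_real D (h : R -> R) : measurable D ->
  mu.-integrable D (EFin \o h) -> cintegrable D (fun t => (h t)%:C).
Proof. by move=> mD ih; split => //=; exact: integrable0. Qed.

Lemma eq_cintegrable D f g : measurable D -> (forall t, D t -> f t = g t) ->
  cintegrable D f -> cintegrable D g.
Proof.
move=> mD fg [f1 f2]; split.
- apply: (@eq_integrable _ _ _ mu D mD (fun t => (Re (f t))%:E)) => // t.
  by rewrite inE => Dt; rewrite fg.
- apply: (@eq_integrable _ _ _ mu D mD (fun t => (Im (f t))%:E)) => // t.
  by rewrite inE => Dt; rewrite fg.
Qed.

Lemma cintegrableS D E f : measurable D -> measurable E -> D `<=` E ->
  cintegrable E f -> cintegrable D f.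
Proof.
by move=> mD mE DE [f1 f2]; split; [apply: integrableS f1|apply: integrableS f2].
Qed.

Lemma cintegrableD D f g : measurable D -> cintegrable D f -> cintegrable D g ->
  cintegrable D (fun t => f t + g t).
Proof.
move=> mD [f1 f2] [g1 g2]; split.
- by under eq_fun do rewrite ReD EFinD; exact: integrableD.
- by under eq_fun do rewrite ImD EFinD; exact: integrableD.
Qed.

Lemma cintegrableZ D f z : measurable D -> cintegrable D f ->
  cintegrable D (fun t => z * f t).
Proof.
move=> mD [f1 f2]; split.
- under eq_fun do rewrite ReM EFinB !EFinM.
  by apply: integrableB => //; exact: integrableZl.
- under eq_fun do rewrite ImM EFinD !EFinM.
  by apply: integrableD => //; exact: integrableZl.
Qed.

Lemma cintegrable0 D : cintegrable D (fun=> 0).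
Proof. by split; exact: integrable0. Qed.

Lemma cintegrable_sum D (h : nat -> R -> R[i]) n : measurable D ->
  (forall k, cintegrable D (h k)) ->
  cintegrable D (fun t => \sum_(k < n) h k t).
Proof.
move=> mD mh; elim: n => [|n IH].
  by under eq_fun do rewrite big_ord0; exact: cintegrable0.
by under eq_fun do rewrite big_ord_recr /=; exact: cintegrableD.
Qed.

Lemma eq_cintegral D f g : (forall t, D t -> f t = g t) ->
  cintegral D f = cintegral D g.
Proof.
move=> fg; rewrite /cintegral; congr (_ +i* _); apply: eq_Rintegral => t;
  by rewrite inE => /fg ->.
Qed.

Lemma cintegralD D f g : measurable D -> cintegrable D f -> cintegrable D g ->
  cintegral D (fun t => f t + g t) = cintegral D f + cintegral D g.
Proof.
move=> mD [f1 f2] [g1 g2]; rewrite /cintegral; apply: complex_eq => /=.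
- by under eq_Rintegral do rewrite ReD; rewrite RintegralD.
- by under eq_Rintegral do rewrite ImD; rewrite RintegralD.
Qed.

Let Rintegral_lin D (u v : R -> R) a b : measurable D ->
  mu.-integrable D (fun t => (u t)%:E) -> mu.-integrable D (fun t => (v t)%:E) ->
  \int[mu]_(t in D) (a * u t + b * v t) =
  a * (\int[mu]_(t in D) u t) + b * (\int[mu]_(t in D) v t).
Proof.
move=> mD iu iv.
have i1 : mu.-integrable D (fun t => (a * u t)%:E).
  by under eq_fun do rewrite EFinM; exact: integrableZl.
have i2 : mu.-integrable D (fun t => (b * v t)%:E).
  by under eq_fun do rewrite EFinM; exact: integrableZl.
rewrite (@RintegralD _ _ _ mu D (fun t => a * u t) (fun t => b * v t))//.
by rewrite (@RintegralZl _ _ _ mu D u)// (@RintegralZl _ _ _ mu D v).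
Qed.

Lemma cintegralZ D f z : measurable D -> cintegrable D f ->
  cintegral D (fun t => z * f t) = z * cintegral D f.
Proof.
move=> mD [f1 f2]; rewrite /cintegral; apply: complex_eq.
- rewrite ReM /= -mulNr -Rintegral_lin//; apply: eq_Rintegral => t _.
  by rewrite ReM mulNr.
- rewrite ImM /= -Rintegral_lin//; apply: eq_Rintegral => t _.
  by rewrite ImM.
Qed.

Lemma cintegral0 D : cintegral D (fun=> 0) = 0.
Proof.
by rewrite /cintegral /= /Rintegral integral0.
Qed.

Lemma cintegral_sum D (h : nat -> R -> R[i]) n : measurable D ->
  (forall k, cintegrable D (h k)) ->
  cintegral D (fun t => \sum_(k < n) h k t) = \sum_(k < n) cintegral D (h k).
Proof.
move=> mD mh; elim: n => [|n IH].
  rewrite big_ord0 -[RHS](cintegral0 D).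
  by apply: eq_cintegral => t _; rewrite big_ord0.
rewrite big_ord_recr /= -IH -cintegralD//; last exact: cintegrable_sum.
by apply: eq_cintegral => t _; rewrite big_ord_recr.
Qed.

Lemma cintegral_setU D E f : measurable D -> measurable E -> [disjoint D & E] ->
  cintegrable (D `|` E) f ->
  cintegral (D `|` E) f = cintegral D f + cintegral E f.
Proof.
move=> mD mE DE [f1 f2]; apply: complex_eq; rewrite /cintegral /=.
- by rewrite Rintegral_setU.
- by rewrite Rintegral_setU.
Qed.

Lemma cintegral_mkcond D E f : measurable D -> measurable E ->
  cintegral (D `&` E) f = cintegral D (fun t => (\1_E t)%:C * f t).
Proof.
move=> mD mE; rewrite /cintegral; congr (_ +i* _).
- rewrite Rintegral_mkcondr; apply: eq_Rintegral => t _.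
  by rewrite ReM /= mul0r subr0 patchE indicE; case: ifP; rewrite ?mul1r ?mul0r.
- rewrite Rintegral_mkcondr; apply: eq_Rintegral => t _.
  by rewrite ImM /= mul0r addr0 patchE indicE; case: ifP; rewrite ?mul1r ?mul0r.
Qed.

Lemma cdominated_convergence D (f_ : nat -> R -> R[i]) f (h : R -> R) :
  measurable D -> (forall n, cmeasurable_fun D (f_ n)) -> cmeasurable_fun D f ->
  mu.-integrable D (EFin \o h) ->
  (forall n t, D t -> normc (f_ n t) <= h t) ->
  (forall t, D t -> ccvg (f_ ^~ t) (f t)) ->
  ccvg (fun n => cintegral D (f_ n)) (cintegral D f).
Proof.
move=> mD mf_ mf ih f_h f_f.
have real_dom (u_ : nat -> R -> R) (u : R -> R) :
    (forall n, measurable_fun D (u_ n)) -> measurable_fun D u ->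
    (forall n t, D t -> `|u_ n t| <= h t) ->
    (forall t, D t -> u_ ^~ t @ \oo --> u t) ->
    (fun n => \int[mu]_(t in D) u_ n t) @ \oo --> \int[mu]_(t in D) u t.
  move=> mu_ mu_u u_h u_u.
  have [|||||iu _ cvg] := @dominated_convergence _ _ _ mu D mD
    (fun n => EFin \o u_ n) (EFin \o u) (EFin \o h).
  - by move=> n; apply/measurable_EFinP; exact: mu_.
  - by apply/measurable_EFinP; exact: mu_u.
  - by apply: aeW => t Dt; apply: cvg_EFin; [exact: nearW|exact: u_u].
  - exact: ih.
  - by apply: aeW => t n Dt; rewrite /= lee_fin u_h.
  apply: fine_cvg; rewrite fineK//; exact: integrable_fin_num.
split => /=.
- apply: real_dom => [n|||t Dt].
  + by case: (mf_ n).
  + by case: mf.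
  + by move=> n t Dt; apply: le_trans (Re_le_normc _) (f_h _ _ Dt).
  + by case: (f_f t Dt).
- apply: real_dom => [n|||t Dt].
  + by case: (mf_ n).
  + by case: mf.
  + by move=> n t Dt; apply: le_trans (Im_le_normc _) (f_h _ _ Dt).
  + by case: (f_f t Dt).
Qed.

End ComplexIntegral.

(** * Fubini's theorem on the quadrant *)

Section Fubini.
Context {R : realType}.
Notation mu := (@lebesgue_measure R).
Notation T := (measurableTypeR R).
Notation H := (@halfline R).

Lemma measurable_halfline : measurable (H : set R).
Proof. by rewrite (_ : H = `]0, +oo[%classic)// set_itvoy. Qed.
Hint Resolve measurable_halfline : core.

Let real_Fubini_dom (F : T * T -> R) (g h : R -> R) :
  measurable_fun setT F ->
  mu.-integrable H (EFin \o g) -> mu.-integrable H (EFin \o h) ->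
  (forall x y, 0 < x -> 0 < y -> `|F (x, y)| <= g x * h y) ->
  mu.-integrable H (fun x => (\int[mu]_(y in H) F (x, y))%:E) /\
  \int[mu]_(x in H) \int[mu]_(y in H) F (x, y) =
  \int[mu]_(y in H) \int[mu]_(x in H) F (x, y).
Proof.
move=> mF ig ih Fgh.
have iFy x : 0 < x -> mu.-integrable H (fun y => (F (x, y))%:E).
  move=> x0.
  have igh : mu.-integrable H (fun y => (g x)%:E * (EFin \o h) y)%E.
    exact: integrableZl.
  apply: le_integrable igh => //.
    apply: measurable_funTS; apply/measurable_EFinP.
    by apply: measurableT_comp => //; exact: pair1_measurable.
  move=> y y0; change (`|(F (x, y))%:E| <= `|(g x * h y)%:E|)%E.
  by rewrite lee_fin (le_trans (Fgh _ _ x0 y0))// ler_norm.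
have iFx y : 0 < y -> mu.-integrable H (fun x => (F (x, y))%:E).
  move=> y0.
  have igh : mu.-integrable H (fun x => (h y)%:E * (EFin \o g) x)%E.
    exact: integrableZl.
  apply: le_integrable igh => //.
    apply: measurable_funTS; apply/measurable_EFinP.
    by apply: measurableT_comp => //; exact: pair2_measurable.
  move=> x x0; change (`|(F (x, y))%:E| <= `|(h y * g x)%:E|)%E.
  by rewrite lee_fin (le_trans (Fgh _ _ x0 y0))// mulrC ler_norm.
pose F' (z : T * T) : \bar R := (\1_H z.1 * \1_H z.2 * F z)%:E.
have m1 : measurable_fun setT (fun z : T * T => \1_H z.1 : R).
  by apply: measurableT_comp => //; apply: measurable_indic.
have m2 : measurable_fun setT (fun z : T * T => \1_H z.2 : R).
  by apply: measurableT_comp => //; apply: measurable_indic.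
have mF' : measurable_fun setT F'.
  by apply/measurable_EFinP; apply: measurable_funM => //; exact: measurable_funM.
have FE x : (\int[mu]_y F' (x, y) = (\1_H x * \int[mu]_(y in H) F (x, y))%:E)%E.
  rewrite indicE; case: (boolP (x \in H)) => [xH|xH] /=; last first.
    rewrite mul0r; rewrite integral0_eq// => y _.
    by rewrite /F' /= indicE (negbTE xH) !mul0r.
  rewrite mul1r /Rintegral fineK; last first.
    by apply: integrable_fin_num => //; apply: iFy; rewrite inE in xH.
  rewrite [RHS]integral_mkcond; apply: eq_integral => y _.
  by rewrite /F' patchE /= !indicE xH mul1r; case: ifP => _; rewrite ?mul1r ?mul0r.
have GE y : (\int[mu]_x F' (x, y) = (\1_H y * \int[mu]_(x in H) F (x, y))%:E)%E.
  rewrite indicE; case: (boolP (y \in H)) => [yH|yH] /=; last first.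
    rewrite mul0r; rewrite integral0_eq// => x _.
    by rewrite /F' /= !indicE (negbTE yH) mulr0 !mul0r.
  rewrite mul1r /Rintegral fineK; last first.
    by apply: integrable_fin_num => //; apply: iFx; rewrite inE in yH.
  rewrite [RHS]integral_mkcond; apply: eq_integral => x _.
  by rewrite /F' patchE /= !indicE yH mulr1; case: ifP => _; rewrite ?mul1r ?mul0r.
have iF' : (mu \x mu)%E.-integrable setT F'.
  apply/integrable12ltyP => //.
  pose C := (\int[mu]_(y in H) `|h y|)%R.
  apply: (@le_lt_trans _ _ (\int[mu]_(x in H) (C * `|g x|)%:E)%E); last first.
    under eq_integral do rewrite EFinM.
    have ign : mu.-integrable H (fun x => C%:E * (`|g x|)%:E)%E.
      by apply: integrableZl => //; exact: (integrable_norm ig).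
    exact: (integrable_lty _ ign).
  rewrite [leRHS]integral_mkcond; apply: ge0_le_integral => //.
  - by move=> x _; exact: integral_ge0.
  - apply: (measurable_fun_fubini_tonelli_F (abse \o F')) => //=.
    exact: measurableT_comp.
  - apply/(measurable_restrictT _ _).1 => //; apply/measurable_EFinP.
    apply: measurable_funM => //; apply: measurableT_comp => //.
    by have /integrableP[/measurable_EFinP] := ig.
  - move=> x _; rewrite patchE; case: ifPn => xH; last first.
      rewrite integral0_eq// => y _.
      by rewrite /F' /= indicE (negbTE xH) !mul0r normr0.
    rewrite inE in xH.
    have -> : (\int[mu]_y `|F' (x, y)| = \int[mu]_(y in H) `|(F (x, y))%:E|)%E.
      rewrite [RHS]integral_mkcond; apply: eq_integral => y _.
      rewrite /F' patchE /= !indicE (mem_set xH) mul1r.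
      by case: ifP => _; rewrite ?mul1r// mul0r normr0.
    rewrite mulrC EFinM /C /Rintegral fineK; last first.
      by apply: integrable_fin_num => //; exact: (integrable_norm ih).
    rewrite -ge0_integralZl//; last first.
      by apply/measurable_EFinP; apply: measurableT_comp => //;
         have /integrableP[/measurable_EFinP] := ih.
    apply: ge0_le_integral => //.
    + by have /integrable_abse/measurable_int := iFy _ xH.
    + apply/measurable_EFinP; apply: measurable_funM => //.
      by apply: measurableT_comp => //; have /integrableP[/measurable_EFinP] := ih.
    + move=> y yH; rewrite /= -EFinM lee_fin -normrM.
      by rewrite (le_trans (Fgh _ _ xH yH))// ler_norm.
have EH (u : R -> R) : (\int[mu]_x (\1_H x * u x)%:E = \int[mu]_(x in H) (u x)%:E)%E.
  rewrite [RHS]integral_mkcond; apply: eq_integral => x _.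
  by rewrite patchE indicE; case: ifP => _; rewrite ?mul1r ?mul0r.
split.
  have := integrable_fubini_F iF'; rewrite /fubini_F.
  under eq_fun do rewrite FE.
  rewrite (_ : (fun _ => _) = ((fun x => (\int[mu]_(y in H) F (x, y))%:E) \_ H)).
    by move=> iH; apply/integrable_mkcond.
  apply/funext => x; rewrite patchE indicE.
  by case: ifP => _; rewrite ?mul1r ?mul0r.
rewrite /Rintegral; congr fine; rewrite -!EH.
have := Fubini iF'.
under eq_integral do rewrite FE.
by under [RHS]eq_integral do rewrite GE.
Qed.

(** Domination by a product of integrable functions makes every section
    integrable, and not just almost every one, so that both iterated integrals
    exist without exceptional points. *)
Lemma cFubini_dom (F : T * T -> R[i]) (g h : R -> R) :
  cmeasurable_fun setT F ->
  mu.-integrable H (EFin \o g) -> mu.-integrable H (EFin \o h) ->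
  (forall x y, 0 < x -> 0 < y -> normc (F (x, y)) <= g x * h y) ->
  cintegrable H (fun x => cintegral H (fun y => F (x, y))) /\
  cintegral H (fun x => cintegral H (fun y => F (x, y))) =
  cintegral H (fun y => cintegral H (fun x => F (x, y))).
Proof.
move=> [mF1 mF2] ig ih Fgh.
have [i1 e1] : mu.-integrable H (fun x => (\int[mu]_(y in H) Re (F (x, y)))%:E) /\
  \int[mu]_(x in H) \int[mu]_(y in H) Re (F (x, y)) =
  \int[mu]_(y in H) \int[mu]_(x in H) Re (F (x, y)).
  apply: (real_Fubini_dom (F := fun z => Re (F z))) ig ih _ => // x y x0 y0.
  exact: le_trans (Re_le_normc _) (Fgh _ _ x0 y0).
have [i2 e2] : mu.-integrable H (fun x => (\int[mu]_(y in H) Im (F (x, y)))%:E) /\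
  \int[mu]_(x in H) \int[mu]_(y in H) Im (F (x, y)) =
  \int[mu]_(y in H) \int[mu]_(x in H) Im (F (x, y)).
  apply: (real_Fubini_dom (F := fun z => Im (F z))) ig ih _ => // x y x0 y0.
  exact: le_trans (Im_le_normc _) (Fgh _ _ x0 y0).
by split; [split|rewrite /cintegral /= e1 e2].
Qed.

End Fubini.
#[local] Hint Extern 0 (measurable halfline) => exact: measurable_halfline : core.

(** * Scaling of the half-line *)

Section Scaling.
Context {R : realType}.
Notation mu := (@lebesgue_measure R).
Notation H := (@halfline R).

Let scale_preimage (c : R) (A : set R) : 0 < c -> measurable A ->
  pushforward mu ( *%R c : _ -> measurableTypeR R) A = (c^-1%:E * mu A)%E.
Proof.
move=> c0 mA.
have mc : measurable_fun setT ( *%R c : measurableTypeR R -> measurableTypeR R).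
  exact: mulrl_measurable.
pose m1 := mscale (NngNum (ltW c0)) (pushforward mu ( *%R c : _ -> measurableTypeR R)).
have -> : mu A = (c%:E * pushforward mu ( *%R c : _ -> measurableTypeR R) A)%E.
  rewrite -[RHS]/(m1 mc A).
  apply: lebesgue_measure_unique => //= _ [[a b]] _ <-.
  rewrite /m1 /mscale /= /pushforward.
  have -> : *%R c @^-1` `]a, b]%classic = `]a / c, b / c]%classic.
    apply/seteqP; split => x /=; rewrite !in_itv/= ltr_pdivrMr// ler_pdivlMr//;
      by rewrite mulrC.
  rewrite !lebesgue_measure_itv/= !lte_fin ltr_pM2r ?invr_gt0//.
  case: ifPn => // _; last by rewrite mule0.
  by rewrite -EFinB -!EFinM; congr (_%:E); field; rewrite gt_eqF.
by rewrite muleA -EFinM mulVf ?gt_eqF// mul1e.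
Qed.

Let real_scale (c : R) (u : R -> R) : 0 < c -> mu.-integrable H (fun t => (u t)%:E) ->
  mu.-integrable H (fun t => (u (c * t))%:E) /\
  \int[mu]_(t in H) u (c * t) = c^-1 * \int[mu]_(t in H) u t.
Proof.
move=> c0 iu.
have mc : measurable_fun setT ( *%R c : measurableTypeR R -> measurableTypeR R).
  exact: mulrl_measurable.
have cH : *%R c @^-1` H = H.
  by apply/seteqP; split => t; rewrite /halfline /= pmulr_rgt0.
have ge0 (v : R -> \bar R) : measurable_fun H v -> (forall t, 0 <= v t)%E ->
    (\int[mu]_(t in H) v (c * t)%R = c^-1%:E * \int[mu]_(t in H) v t)%E.
  move=> mv v0.
  transitivity (\int[pushforward mu ( *%R c : _ -> measurableTypeR R)]_(t in H) v t)%E.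
    by rewrite ge0_integral_pushforward// cH.
  have c'0 : 0 <= c^-1 by rewrite invr_ge0 ltW.
  rewrite -[c^-1]/((NngNum c'0)%:num) -ge0_integral_mscale//.
  by apply: eq_measure_integral => A mA _; exact: scale_preimage.
have mu_ : measurable_fun H (fun t => (u t)%:E) by have /measurable_int := iu.
have mp : measurable_fun H (fun t => (u t)%:E)^\+%E by exact: measurable_funepos.
have mn : measurable_fun H (fun t => (u t)%:E)^\-%E by exact: measurable_funeneg.
have E : (\int[mu]_(t in H) (u (c * t)%R)%:E = c^-1%:E * \int[mu]_(t in H) (u t)%:E)%E.
  have fp : (\int[mu]_(t in H) (fun t => (u t)%:E)^\+ t)%E \is a fin_num.
    exact: integrable_pos_fin_num.
  have fn : (\int[mu]_(t in H) (fun t => (u t)%:E)^\- t)%E \is a fin_num.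
    exact: integrable_neg_fin_num.
  have Ep : (\int[mu]_(t in H) (fun t => (u (c * t))%:E)^\+ t =
      c^-1%:E * \int[mu]_(t in H) (fun t => (u t)%:E)^\+ t)%E.
    rewrite -(ge0 _ mp); last by move=> t; exact: funepos_ge0.
    by apply: eq_integral => t _; rewrite !funeposE.
  have En : (\int[mu]_(t in H) (fun t => (u (c * t))%:E)^\- t =
      c^-1%:E * \int[mu]_(t in H) (fun t => (u t)%:E)^\- t)%E.
    rewrite -(ge0 _ mn); last by move=> t; exact: funeneg_ge0.
    by apply: eq_integral => t _; rewrite !funenegE.
  rewrite [in LHS]integralE [in RHS]integralE Ep En [RHS]muleBr//.
  by apply: fin_num_adde_defl; rewrite fin_numN.
have mcH : measurable_fun H (fun t => (u (c * t))%:E).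
  apply/measurable_EFinP; apply: (measurable_comp (F := H)) => //.
  - by move=> _ [t t0 <-]; rewrite /halfline /= mulr_gt0.
  - exact/measurable_EFinP.
split; last by rewrite /Rintegral E fineM// integrable_fin_num.
apply/integrableP; split => //.
rewrite (ge0 (fun t => `|(u t)%:E|%E))//; last exact: measurableT_comp.
by rewrite lte_mul_pinfty ?lee_fin ?invr_ge0 ?ltW// (integrable_lty _ (integrable_abse iu)).
Qed.

Lemma cintegrable_scale (c : R) (f : R -> R[i]) : 0 < c -> cintegrable H f ->
  cintegrable H (fun t => f (c * t)).
Proof.
move=> c0 [f1 f2]; split.
- exact: (real_scale (u := fun t => Re (f t)) c0 f1).1.
- exact: (real_scale (u := fun t => Im (f t)) c0 f2).1.
Qed.

Lemma cintegral_scale (c : R) (f : R -> R[i]) : 0 < c -> cintegrable H f ->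
  cintegral H (fun t => f (c * t)) = (c^-1)%:C * cintegral H f.
Proof.
move=> c0 [f1 f2]; apply: complex_eq; rewrite ?(ReM, ImM) /= mul0r ?subr0 ?addr0.
- exact: (real_scale (u := fun t => Re (f t)) c0 f1).2.
- exact: (real_scale (u := fun t => Im (f t)) c0 f2).2.
Qed.

End Scaling.

(** * Antiderivatives and inversion on the half-line *)

Section FundamentalTheorem.
Context {R : realType}.
Notation mu := (@lebesgue_measure R).
Notation H := (@halfline R).
Implicit Types (f F g G : R -> R[i]) (h : R -> R).

Definition cderive F f := forall x : R, 0 < x ->
  is_derive x 1 (fun t => Re (F t)) (Re (f x)) /\
  is_derive x 1 (fun t => Im (F t)) (Im (f x)).

Definition ccontinuous f := forall x : R, 0 < x ->
  {for x, continuous (fun t => Re (f t))} /\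
  {for x, continuous (fun t => Im (f t))}.

Lemma cderive_ccontinuous F f : cderive F f -> ccontinuous F.
Proof.
move=> Ff x x0; have [[d1 _] [d2 _]] := Ff x x0.
by split; apply: differentiable_continuous; exact/derivable1_diffP.
Qed.

Lemma ccontinuousZ z f : ccontinuous f -> ccontinuous (fun t => z * f t).
Proof.
move=> cf x /cf[c1 c2]; split.
- have -> : (fun t => Re (z * f t)) = (fun t => Re z * Re (f t) - Im z * Im (f t)).
    by apply/funext => t; rewrite ReM.
  by apply: cvgB; apply: cvgM => //; exact: cvg_cst.
- have -> : (fun t => Im (z * f t)) = (fun t => Re z * Im (f t) + Im z * Re (f t)).
    by apply/funext => t; rewrite ImM.
  by apply: cvgD; apply: cvgM => //; exact: cvg_cst.
Qed.

Lemma ccontinuousD f g : ccontinuous f -> ccontinuous g ->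
  ccontinuous (fun t => f t + g t).
Proof.
move=> cf cg x x0; have [f1 f2] := cf x x0; have [g1 g2] := cg x x0; split.
- have -> : (fun t => Re (f t + g t)) = (fun t => Re (f t) + Re (g t)).
    by apply/funext => t; rewrite ReD.
  exact: cvgD.
- have -> : (fun t => Im (f t + g t)) = (fun t => Im (f t) + Im (g t)).
    by apply/funext => t; rewrite ImD.
  exact: cvgD.
Qed.

Lemma cderiveM F f G g : cderive F f -> cderive G g ->
  cderive (fun t => F t * G t) (fun t => F t * g t + f t * G t).
Proof.
move=> Ff Gg x x0; have [F1 F2] := Ff x x0; have [G1 G2] := Gg x x0; split.
- under eq_fun do rewrite ReM.
  apply: is_derive_eq; rewrite !(ReD, ReM) /GRing.scale /=; ring.
- under eq_fun do rewrite ImM.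
  apply: is_derive_eq; rewrite !(ImD, ImM) /GRing.scale /=; ring.
Qed.

Lemma cderive_real h (h' : R -> R) : (forall x : R, 0 < x -> is_derive x 1 h (h' x)) ->
  cderive (fun t => (h t)%:C) (fun t => (h' t)%:C).
Proof. by move=> hh' x x0; split => /=; [exact: hh'|exact: is_derive_cst]. Qed.

Lemma cderive_cpow w : cderive (cpow^~ w) (fun t => w * cpow t (w - 1)).
Proof.
move=> x x0.
have dl := is_derive1_ln x0.
have wE : w * cpow x (w - 1) = w * cpow x w * (x^-1)%:C.
  by rewrite cpowB1// real_complexV mulrA.
pose a := Re w; pose b := Im w.
have dla k : is_derive x 1 (fun t => k * ln t) (k * x^-1).
  by apply: is_derive_eq; rewrite /GRing.scale.
have de : is_derive x 1 (fun t => expR (a * ln t)) (a * x^-1 * expR (a * ln x)).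
  by apply: is_derive_eq; rewrite mulrC.
have dc : is_derive x 1 (fun t => cos (b * ln t)) (- (b * x^-1 * sin (b * ln x))).
  by apply: is_derive_eq; rewrite mulNr mulrC.
have ds : is_derive x 1 (fun t => sin (b * ln t)) (b * x^-1 * cos (b * ln x)).
  by apply: is_derive_eq; rewrite mulrC.
rewrite wE; split.
- under eq_fun do rewrite Re_cpow.
  have := is_deriveM de dc; set k := (X in is_derive _ _ _ X -> _).
  suff -> : Re (w * cpow x w * (x^-1)%:C) = k by [].
  by rewrite /k (ReM (w * cpow x w)) (ReM w) (ImM w) Re_cpow Im_cpow /GRing.scale /= -/a -/b; ring.
- under eq_fun do rewrite Im_cpow.
  have := is_deriveM de ds; set k := (X in is_derive _ _ _ X -> _).
  suff -> : Im (w * cpow x w * (x^-1)%:C) = k by [].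
  by rewrite /k (ImM (w * cpow x w)) (ReM w) (ImM w) Re_cpow Im_cpow /GRing.scale /= -/a -/b; ring.
Qed.

(** An integral over part of the half-line is the limit of the integrals over
    the compact intervals [1/(n+1), n+1], where the calculus of continuous
    functions applies. *)
Lemma cintegral_exhaustion (D : set R) f : measurable D -> D `<=` H -> cintegrable D f ->
  ccvg (fun n => cintegral (D `&` `[n.+1%:R^-1, n.+1%:R]) f) (cintegral D f).
Proof.
move=> mD DH cf.
have [mf1 mf2] := cintegrable_cmeasurable cf.
under eq_fun do rewrite cintegral_mkcond//.
apply: (cdominated_convergence (h := fun t => `|Re (f t)| + `|Im (f t)|)) => //.
- move=> n; apply: cmeasurableM; last by [].
  by apply: cmeasurable_real; apply: measurable_funTS; exact: measurable_indic.
- have [f1 f2] := cf.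
  have i1 : mu.-integrable D (fun t => (`|Re (f t)|)%:E) by exact: integrable_norm.
  have i2 : mu.-integrable D (fun t => (`|Im (f t)|)%:E) by exact: integrable_norm.
  have i12 : mu.-integrable D (fun t => (`|Re (f t)|)%:E + (`|Im (f t)|)%:E)%E.
    exact: integrableD.
  exact: i12.
- move=> n t Dt; rewrite Normc.normcM normc_real ger0_norm//.
  apply: le_trans (normc_le_ReIm _); rewrite indicE.
  by case: (_ \in _); rewrite ?mul1r// mul0r normc_ge0.
- move=> t Dt; have t0 : 0 < t := DH _ Dt.
  rewrite -[X in ccvg _ X]mul1r; apply: ccvgM; last exact: ccvg_cst.
  apply: ccvg_real; apply: cvg_near_cst; near=> n.
  rewrite indicE mem_set//= in_itv/=; apply/andP; split.
  + rewrite invf_ple ?posrE//.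
    rewrite (@le_trans _ _ n%:R) ?ler_nat//; near: n; exact: nbhs_infty_ger.
  + rewrite (@le_trans _ _ n%:R) ?ler_nat//; near: n; exact: nbhs_infty_ger.
Unshelve. all: by end_near. Qed.

Let within_of_continuous (u : R -> R) a b : 0 < a ->
  (forall x : R, 0 < x -> {for x, continuous u}) -> {within `[a, b], continuous u}.
Proof.
move=> a0 cu; apply: continuous_in_subspaceT => x; rewrite inE/= in_itv/= => /andP[ax _].
exact: cu (lt_le_trans a0 ax).
Qed.

Lemma integral_FTC (U u : R -> R) a b : 0 < a -> a <= b ->
  (forall x : R, 0 < x -> is_derive x 1 U (u x)) ->
  (forall x : R, 0 < x -> {for x, continuous u}) ->
  (\int[mu]_(x in `[a, b]) (u x)%:E = (U b - U a)%:E)%E.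
Proof.
move=> a0; rewrite le_eqVlt => /predU1P[<- _ _|ab dU cu].
  by rewrite set_itv1 integral_set1 subrr.
have cU x : 0 < x -> {for x, continuous U}.
  move=> x0; have [d _] := dU _ x0.
  by apply: differentiable_continuous; exact/derivable1_diffP.
rewrite (@continuous_FTC2 _ u U)//.
- exact: within_of_continuous.
- split.
  + move=> x; rewrite in_itv/= => /andP[ax _].
    by have [] := dU _ (lt_trans a0 ax).
  + by apply: cvg_at_right_filter; exact: cU.
  + by apply: cvg_at_left_filter; apply: cU; exact: lt_trans ab.
- move=> x; rewrite in_itv/= => /andP[ax _].
  by rewrite derive1E; have [] := dU _ (lt_trans a0 ax).
Qed.

Lemma cintegral_FTC F f (a b : R) : 0 < a -> a <= b -> cderive F f -> ccontinuous f ->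
  cintegral `[a, b] f = F b - F a.
Proof.
move=> a0 ab Ff cf.
have E1 : (\int[mu]_(x in `[a, b]) (Re (f x))%:E = (Re (F b) - Re (F a))%:E)%E.
  by apply: (@integral_FTC (fun t => Re (F t))) => // x x0; [have [] := Ff _ x0|have [] := cf _ x0].
have E2 : (\int[mu]_(x in `[a, b]) (Im (f x))%:E = (Im (F b) - Im (F a))%:E)%E.
  by apply: (@integral_FTC (fun t => Im (F t))) => // x x0; [have [] := Ff _ x0|have [] := cf _ x0].
rewrite /cintegral /Rintegral E1 E2 /=.
by apply: complex_eq; rewrite ?(ReD, ImD, ReN, ImN).
Qed.

Lemma invn_le1 n : n.+1%:R^-1 <= 1 :> R.
Proof. by rewrite invf_le1// ler1n. Qed.

Lemma cintegral_itv_cc_oc (a b : R) f : cintegrable `]a, b] f ->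
  cintegral `]a, b] f = cintegral `[a, b] f.
Proof.
move=> [f1 f2]; rewrite /cintegral; congr (_ +i* _).
- by rewrite -Rintegral_itv_obnd_cbnd//; exact: f1.
- by rewrite -Rintegral_itv_obnd_cbnd//; exact: f2.
Qed.

Lemma setI_exhaustion_y n :
  `]1, +oo[ `&` `[n.+1%:R^-1, n.+1%:R] = `]1, n.+1%:R]%classic :> set R.
Proof.
apply/seteqP; split => t /=; rewrite !in_itv/= ?andbT.
  by move=> [-> /andP[_ ->]].
move=> /andP[t1 ->]; split => //; rewrite andbT.
exact: le_trans (invn_le1 n) (ltW t1).
Qed.

Lemma setI_exhaustion_0 n :
  `]0, 1] `&` `[n.+1%:R^-1, n.+1%:R] = `[n.+1%:R^-1, 1]%classic :> set R.
Proof.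
apply/seteqP; split => t /=; rewrite !in_itv/=.
  by move=> [/andP[_ ->] /andP[-> _]].
move=> /andP[t1 t2]; rewrite t1 t2 (lt_le_trans _ t1) ?invr_gt0//=; split => //.
by rewrite (le_trans t2)// ler1n.
Qed.

Lemma sub_halfline_y : `]1, +oo[%classic `<=` H.
Proof. by move=> t /=; rewrite in_itv/= andbT; exact: lt_trans. Qed.

Lemma sub_halfline_0 : `]0, 1]%classic `<=` H.
Proof. by move=> t /=; rewrite in_itv/= => /andP[]. Qed.

Lemma cintegral_FTCy F f l : cderive F f -> ccontinuous f ->
  cintegrable `]1, +oo[ f -> ccvg (fun n => F n.+1%:R) l ->
  cintegral `]1, +oo[ f = l - F 1.
Proof.
move=> Ff cf jf Fl.
apply: ccvg_unique (cintegral_exhaustion _ sub_halfline_y jf) _ => //.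
suff -> : (fun n => cintegral (`]1, +oo[ `&` `[n.+1%:R^-1, n.+1%:R]) f) =
    (fun n => F n.+1%:R - F 1) by apply: ccvgB => //; exact: ccvg_cst.
apply/funext => n; rewrite setI_exhaustion_y cintegral_itv_cc_oc; last first.
  apply: cintegrableS jf => //.
  by rewrite -setI_exhaustion_y; exact: subIsetl.
by apply: cintegral_FTC => //; rewrite ler1n.
Qed.

Lemma cintegral_FTC0 F f l : cderive F f -> ccontinuous f ->
  cintegrable `]0, 1] f -> ccvg (fun n => F n.+1%:R^-1) l ->
  cintegral `]0, 1] f = F 1 - l.
Proof.
move=> Ff cf jf Fl.
apply: ccvg_unique (cintegral_exhaustion _ sub_halfline_0 jf) _ => //.
suff -> : (fun n => cintegral (`]0, 1] `&` `[n.+1%:R^-1, n.+1%:R]) f) =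
    (fun n => F 1 - F n.+1%:R^-1) by apply: ccvgB => //; exact: ccvg_cst.
apply/funext => n; rewrite setI_exhaustion_0.
by apply: cintegral_FTC => //; exact: invn_le1.
Qed.

Let is_derive_inv (x : R) : 0 < x -> is_derive x 1 (fun t : R => t^-1) (- x^-2).
Proof.
move=> x0; have xn0 : x != 0 by rewrite gt_eqF.
have := @is_deriveV R id x 1 1 xn0 (is_derive_id x 1).
by rewrite /GRing.scale /= mulr1.
Qed.

Let real_inversion_compact (u : R -> R) (b : R) : 1 <= b ->
  (forall x : R, 0 < x -> {for x, continuous u}) ->
  \int[mu]_(x in `[b^-1, 1]) u x = \int[mu]_(x in `[1, b]) (x^-2 * u x^-1).
Proof.
move=> b1 cu; rewrite /Rintegral; congr fine.
have dE (x : R) : 0 < x -> (fun t : R => t^-1)^`()%classic x = - x^-2.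
  by move=> x0; rewrite derive1E; have [_ ->] := is_derive_inv x0.
have cdE (x : R) : 0 < x -> (fun t : R => t^-1)^`()%classic t @[t --> x] --> - x^-2.
  move=> x0; have cN : (fun t : R => - t^-2) t @[t --> x] --> - x^-2.
    apply: cvgN; apply: cvgV; first by rewrite gt_eqF// exprn_gt0.
    exact: exprn_continuous.
  apply: cvg_trans cN; apply: near_eq_cvg.
  near=> t; rewrite dE//; near: t.
  exact: lt_nbhsr.
have := @integration_by_substitution_decreasing R (fun t : R => t^-1) u 1 b b1.
rewrite invr1 => ->.
- apply: eq_integral => x; rewrite inE/= in_itv/= => /andP[x1 _].
  have x0 : 0 < x := lt_le_trans ltr01 x1.
  change ((u x^-1 * - ((fun t : R => t^-1)^`()%classic x))%:E = (x^-2 * u x^-1)%:E).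
  by rewrite dE// opprK mulrC.
- move=> x y; rewrite !in_itv/= => /andP[x1 _] /andP[y1 _] xy.
  have x0 : 0 < x := lt_le_trans ltr01 x1.
  by rewrite ltf_pV2// posrE (lt_le_trans ltr01 y1).
- move=> x; rewrite in_itv/= => /andP[x1 _].
  have x0 : 0 < x := lt_trans ltr01 x1.
  by rewrite /continuous_at dE//; exact: cdE.
- by apply/cvg_ex; exists (- 1^-2); apply: cvg_at_right_filter; exact: cdE.
- apply/cvg_ex; exists (- b^-2); apply: cvg_at_left_filter; apply: cdE.
  exact: lt_le_trans b1.
- have cV (x : R) : 0 < x -> t^-1 @[t --> x] --> x^-1.
    by move=> x0; apply: cvgV => //; rewrite gt_eqF.
  split.
  + move=> x; rewrite in_itv/= => /andP[x1 _].
    by have [] := is_derive_inv (lt_trans ltr01 x1).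
  + by apply: cvg_at_right_filter; exact: cV.
  + by apply: cvg_at_left_filter; apply: cV; exact: lt_le_trans b1.
- by apply: within_of_continuous => //; rewrite invr_gt0 (lt_le_trans _ b1).
Unshelve. all: by end_near. Qed.

Lemma cintegral_inversion f : ccontinuous f -> cintegrable `]0, 1] f ->
  cintegrable `]1, +oo[ (fun t => (t^-2)%:C * f t^-1) ->
  cintegral `]0, 1] f = cintegral `]1, +oo[ (fun t => (t^-2)%:C * f t^-1).
Proof.
move=> cf j0 j1.
apply: ccvg_unique (cintegral_exhaustion _ sub_halfline_0 j0) _ => //.
suff -> : (fun n => cintegral (`]0, 1] `&` `[n.+1%:R^-1, n.+1%:R]) f) =
    (fun n => cintegral (`]1, +oo[ `&` `[n.+1%:R^-1, n.+1%:R])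
      (fun t => (t^-2)%:C * f t^-1)) by exact: cintegral_exhaustion sub_halfline_y j1.
apply/funext => n; rewrite setI_exhaustion_0 setI_exhaustion_y cintegral_itv_cc_oc; last first.
  apply: cintegrableS j1 => //.
  by rewrite -setI_exhaustion_y; exact: subIsetl.
have n1 : 1 <= n.+1%:R :> R by rewrite ler1n.
apply: complex_eq => /=.
- rewrite (@real_inversion_compact (fun t => Re (f t)))// => [|x /cf[]//].
  by apply: eq_Rintegral => t _; rewrite ReM /= mul0r subr0.
- rewrite (@real_inversion_compact (fun t => Im (f t)))// => [|x /cf[]//].
  by apply: eq_Rintegral => t _; rewrite ImM /= mul0r addr0.
Qed.

End FundamentalTheorem.

(** * Integrability of the dominating functions *)

Section ModelIntegrals.
Context {R : realType}.
Notation mu := (@lebesgue_measure R).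
Notation H := (@halfline R).

Lemma halfline_setU : H = `]0, 1] `|` `]1, +oo[.
Proof.
apply/seteqP; split => t /=; rewrite /halfline /= !in_itv/= ?andbT.
  by move=> t0; case: (leP t 1) => t1; [left; rewrite t0|right].
by move=> [/andP[]//|]; exact: lt_trans.
Qed.

Lemma halfline_disj : [disjoint (`]0, 1] : set R) & `]1, +oo[].
Proof.
apply/disj_setPS => t [] /=; rewrite !in_itv/= andbT => /andP[_ t1] t2.
by have := le_lt_trans t1 t2; rewrite ltxx.
Qed.

Lemma dom_integrable (D : set R) (u v : R -> R) : measurable D -> measurable_fun D u ->
  mu.-integrable D (fun t => (v t)%:E) -> (forall t, D t -> `|u t| <= v t) ->
  mu.-integrable D (fun t => (u t)%:E).
Proof.
move=> mD mu_ iv uv; apply: le_integrable iv => //; first exact/measurable_EFinP.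
by move=> t Dt; rewrite /= lee_fin (le_trans (uv t Dt))// ler_norm.
Qed.

Let ge0_integrable_exhaustion (D : set R) (u : R -> R) (C : R) :
  measurable D -> D `<=` H -> measurable_fun D u -> (forall t, D t -> 0 <= u t) ->
  (forall n, (\int[mu]_(t in (D `&` `[n.+1%:R^-1, n.+1%:R])%R) (u t)%:E <= C%:E)%E) ->
  mu.-integrable D (fun t => (u t)%:E).
Proof.
move=> mD DH mu_ u0 uC.
pose F n := D `&` `[n.+1%:R^-1, n.+1%:R]%classic.
have mF n : measurable (F n) by exact: measurableI.
have muF n : measurable_fun (F n) (fun t => (u t)%:E).
  by apply/measurable_EFinP; apply: measurable_funS mu_ => //; exact: subIsetl.
have ndF : {homo F : n m / (n <= m)%N >-> (n <= m)%O}.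
  move=> n m nm; apply/subsetPset => t [Dt] /=; rewrite in_itv/= => /andP[t1 t2].
  split => //=; rewrite in_itv/=; apply/andP; split.
    by apply: le_trans t1; rewrite lef_pV2 ?posrE// ler_nat.
  by apply: le_trans t2 _; rewrite ler_nat.
have UF : \bigcup_n F n = D.
  apply/seteqP; split => [t [n _ []]//|t Dt]; have t0 := DH _ Dt.
  have [n n1] : exists n : nat, t <= n%:R.
    by exists (Num.bound t); rewrite ltW ?archi_boundP// ltW.
  have [k k1] : exists n : nat, t^-1 <= n%:R.
    by exists (Num.bound t^-1); rewrite ltW ?archi_boundP// invr_ge0 ltW.
  exists (maxn n k) => //; split => //=; rewrite in_itv/=; apply/andP; split.
    rewrite invf_ple ?posrE// (le_trans k1)// ler_nat.
    by rewrite (leq_trans (leq_maxr n k)).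
  by rewrite (le_trans n1)// ler_nat (leq_trans (leq_maxl n k)).
apply/integrableP; split; first exact/measurable_EFinP.
have -> : (\int[mu]_(t in D) `|(u t)%:E| = \int[mu]_(t in \bigcup_n F n) (u t)%:E)%E.
  rewrite UF; apply: eq_integral => t; rewrite inE => Dt.
  by rewrite gee0_abs// lee_fin u0.
have cv := @ge0_nondecreasing_set_cvg_integral _ (measurableTypeR R) R F
  (fun t => (u t)%:E) mu ndF mF muF.
apply: (@le_lt_trans _ _ C%:E); last exact: ltry.
rewrite -(cvg_lim _ (cv _))//; last by move=> n t [Dt _]; rewrite lee_fin u0.
apply: lime_le; last exact: nearW.
by apply/cvg_ex; eexists; apply: cv => n t [Dt _]; rewrite lee_fin u0.
Qed.

Lemma powR_primitive (e a b : R) : 0 < a -> a <= b -> e != 0 ->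
  (\int[mu]_(t in `[a, b]) (t `^ (e - 1))%:E = ((b `^ e - a `^ e) / e)%:E)%E.
Proof.
move=> a0 ab e0.
have D0 := @cderive_cpow R e%:C.
have -> : (b `^ e - a `^ e) / e = e^-1 * Re (cpow b e%:C) - e^-1 * Re (cpow a e%:C).
  rewrite !cpow_real//=; first by rewrite mulrC mulrBr.
  exact: lt_le_trans ab.
pose u t := e^-1 * Re (e%:C * cpow t (e%:C - 1)).
transitivity (\int[mu]_(t in `[a, b]) (u t)%:E)%E.
  apply: eq_integral => t; rewrite inE/= in_itv/= => /andP[ta _].
  have t0 : 0 < t := lt_le_trans a0 ta.
  rewrite /u -[1 : R[i]]/(1%:C) -real_complexN -real_complexD cpow_real//.
  by rewrite -real_complexM /= mulrA mulVf// mul1r.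
apply: (@integral_FTC R (fun t => e^-1 * Re (cpow t e%:C)) u a b a0 ab) => x x0.
  have [d _] := D0 x x0.
  have := is_deriveZ e^-1 d; by [].
have [c _] := ccontinuousZ e%:C (cderive_ccontinuous (@cderive_cpow R (e%:C - 1))) x0.
by apply: cvgM => //; exact: cvg_cst.
Qed.

Let measurable_powRl (D : set R) (e : R) : measurable_fun D (fun t => t `^ e).
Proof. by apply: measurable_funTS; exact: measurable_powR. Qed.

Lemma integrable_powR_y (d : R) : 0 < d ->
  mu.-integrable `]1, +oo[ (fun t => (t `^ (- d - 1))%:E).
Proof.
move=> d0; apply: (@ge0_integrable_exhaustion _ _ d^-1) => //.
- exact: sub_halfline_y.
- by move=> t _; exact: powR_ge0.
- move=> n; rewrite setI_exhaustion_y integral_itv_obnd_cbnd; last first.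
    by apply/measurable_EFinP; exact: measurable_powRl.
  rewrite powR_primitive ?ler1n// ?oppr_eq0 ?gt_eqF// powR1 lee_fin.
  by rewrite invrN mulrN -mulNr opprB ler_piMl ?invr_ge0 ?ltW// gerBl powR_ge0.
Qed.

Lemma integrable_powR_0 (c : R) : 0 < c ->
  mu.-integrable `]0, 1] (fun t => (t `^ (c - 1))%:E).
Proof.
move=> c0; apply: (@ge0_integrable_exhaustion _ _ c^-1) => //.
- exact: sub_halfline_0.
- by move=> t _; exact: powR_ge0.
- move=> n; rewrite setI_exhaustion_0.
  rewrite powR_primitive ?invr_gt0 ?invn_le1 ?gt_eqF// powR1 lee_fin.
  by rewrite ler_piMl ?invr_ge0 ?ltW// gerBl powR_ge0.
Qed.

Let ge0_integrable_halfline (u : R -> R) : measurable_fun H u ->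
  (forall t, 0 < t -> 0 <= u t) ->
  mu.-integrable `]0, 1] (fun t => (u t)%:E) ->
  mu.-integrable `]1, +oo[ (fun t => (u t)%:E) ->
  mu.-integrable H (fun t => (u t)%:E).
Proof.
move=> mu_ u0 i0 iy; apply/integrableP; split; first exact/measurable_EFinP.
rewrite halfline_setU ge0_integral_setU//.
- by rewrite lte_add_pinfty//; [have /integrableP[] := i0|have /integrableP[] := iy].
- rewrite -halfline_setU; apply: measurableT_comp => //; exact/measurable_EFinP.
- exact: halfline_disj.
Qed.

(** The Beta integrand on the half-line: it behaves as t^(c-1) at 0 and as
    t^(-d-1) at infinity. *)
Lemma integrable_beta (c d : R) : 0 < c -> 0 < d ->
  mu.-integrable H (fun t => (t `^ (c - 1) * (1 + t) `^ (- (c + d)))%:E).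
Proof.
move=> c0 d0.
have m1 D : measurable_fun D (fun t : R => (1 + t) `^ (- (c + d))).
  apply: measurable_funTS.
  apply: (@measurableT_comp _ _ _ _ _ _ (fun x : R => x `^ (- (c + d)))).
    exact: measurable_powR.
  exact: measurable_funD.
have m2 D : measurable_fun D (fun t : R => t `^ (c - 1) * (1 + t) `^ (- (c + d))).
  by apply: measurable_funM; [exact: measurable_powRl|exact: m1].
have u0 t : 0 <= t `^ (c - 1) * (1 + t) `^ (- (c + d)).
  by rewrite mulr_ge0 ?powR_ge0.
have cd0 : 0 <= c + d by rewrite addr_ge0 ?ltW.
apply: ge0_integrable_halfline => //.
- apply: dom_integrable (m2 _) (integrable_powR_0 c0) _ => // t.
  rewrite /= in_itv/= => /andP[t0 _]; rewrite ger0_norm//.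
  rewrite ler_piMr ?powR_ge0// powRN invf_le1 ?powR_gt0 ?addr_gt0//.
  apply: (@le_trans _ _ (1 `^ (c + d))); first by rewrite powR1.
  have t0' := ltW t0.
  by apply: ge0_ler_powR => //; rewrite ?nnegrE ?lerDl ?addr_ge0.
- apply: dom_integrable (m2 _) (integrable_powR_y d0) _ => // t.
  rewrite /= in_itv/= andbT => t1; rewrite ger0_norm//.
  have t0 : 0 < t := lt_trans ltr01 t1.
  have -> : - d - 1 = (c - 1) + (- (c + d)) by ring.
  rewrite (@powRD _ t (c - 1) (- (c + d))) ?(gt_eqF t0) ?implybT// ler_wpM2l ?powR_ge0// !powRN.
  rewrite lef_pV2 ?posrE ?powR_gt0 ?addr_gt0//.
  have t0' := ltW t0.
  by apply: ge0_ler_powR => //; rewrite ?nnegrE ?lerDr ?addr_ge0.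
Qed.

Lemma powR_le_expR (p k : R) : 0 < p -> 0 < k ->
  exists2 C, 0 < C & forall t, 0 < t -> (1 + t) `^ p <= C * expR (k * t).
Proof.
move=> p0 k0; exists (expR (k - p + p * ln (p / k))); first exact: expR_gt0.
move=> t t0; have t10 : 0 < 1 + t by rewrite addr_gt0.
rewrite /powR gt_eqF// -expRD ler_expR.
have pk0 : 0 < p / k by rewrite divr_gt0.
have q0 : 0 < (1 + t) / (p / k) by rewrite divr_gt0.
have -> : ln (1 + t) = ln ((1 + t) / (p / k)) + ln (p / k).
  by rewrite -lnM// divfK// gt_eqF.
have lnq : ln ((1 + t) / (p / k)) <= (1 + t) / (p / k) - 1.
  have := @le_ln1Dx R ((1 + t) / (p / k) - 1).
  by rewrite addrCA subrr addr0; apply; rewrite ltrBrDr addNr.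
rewrite mulrDr [leRHS]addrAC lerD2r.
apply: (@le_trans _ _ (p * ((1 + t) / (p / k) - 1))).
  by rewrite ler_wpM2l// ltW.
rewrite (_ : p * _ = k - p + k * t)//; field.
by rewrite !gt_eqF.
Qed.

Lemma integrable_gamma (c k : R) : 0 < c -> 0 < k ->
  mu.-integrable H (fun t => (t `^ (c - 1) * expR (- (k * t)))%:E).
Proof.
move=> c0 k0.
have [C C0 hC] := powR_le_expR (ltr_wpDr ler01 c0) k0.
have ib : mu.-integrable H
    (fun t => (C * (t `^ (c - 1) * (1 + t) `^ (- (c + 1))))%:E).
  under eq_fun do rewrite EFinM.
  by apply: integrableZl => //; exact: integrable_beta c0 ltr01.
apply: dom_integrable ib _ => //.
  apply: measurable_funM; first exact: measurable_powRl.
  apply: measurable_fun_expR; apply: measurable_funN; exact: measurable_funM.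
move=> t t0; rewrite ger0_norm ?mulr_ge0 ?powR_ge0 ?expR_ge0//.
rewrite mulrCA ler_wpM2l ?powR_ge0// powRN expRN.
have t10 : 0 < 1 + t by rewrite addr_gt0.
rewrite ler_pdivlMr ?powR_gt0// mulrC ler_pdivrMr ?expR_gt0//.
exact: hC.
Qed.

End ModelIntegrals.

(** * The Gamma function and its incomplete parts *)

Section GammaTheory.
Context {R : realType}.
Notation mu := (@lebesgue_measure R).
Notation H := (@halfline R).
Implicit Types (s w : R[i]) (k x : R).

Definition expsum x n : R := \sum_(j < n) x ^+ j / j`!%:R.

Lemma expsum_series x n : expsum x n = series (exp_coeff x) n.
Proof. by rewrite /expsum /series /= big_mkord. Qed.

Lemma cvg_expsum x : expsum x n @[n --> \oo] --> expR x.
Proof.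
under eq_fun do rewrite expsum_series.
exact: is_cvg_series_exp_coeff.
Qed.

Lemma expsum_le x n : 0 <= x -> expsum x n <= expR x.
Proof.
move=> x0; rewrite expsum_series.
apply: nondecreasing_cvgn_le; last exact: is_cvg_series_exp_coeff.
by apply: nondecreasing_series => k _ _; exact: exp_coeff_ge0.
Qed.

Lemma norm_expsum_le x n : `|expsum x n| <= expR `|x|.
Proof.
apply: le_trans (expsum_le n (normr_ge0 x)).
apply: le_trans (ler_norm_sum _ _ _) _.
by apply: ler_sum => j _; rewrite normrM normrX normfV [`|_%:R|]ger0_norm.
Qed.

Lemma cmeasurable_gamma (D : set R) w k :
  cmeasurable_fun D (fun t => cpow t w * (expR (- (k * t)))%:C).
Proof.
apply: cmeasurableM.
  by apply: cmeasurable_cpow; exact: measurable_id.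
apply: cmeasurable_real; apply: measurable_fun_expR; apply: measurable_funN.
exact: measurable_funM.
Qed.

Lemma normc_gamma w k t : 0 < t ->
  normc (cpow t w * (expR (- (k * t)))%:C) = t `^ Re w * expR (- (k * t)).
Proof.
by move=> t0; rewrite Normc.normcM normc_cpow// normc_real ger0_norm// expR_ge0.
Qed.

Lemma cintegrable_gamma w k : 0 < Re w -> 0 < k ->
  cintegrable H (fun t => cpow t (w - 1) * (expR (- (k * t)))%:C).
Proof.
move=> w0 k0.
apply: cintegrable_dom (cmeasurable_gamma _ _ _) (integrable_gamma w0 k0) _ => // t t0.
by rewrite normc_gamma// ReD ReN.
Qed.

Lemma cintegral_gamma w k : 0 < Re w -> 0 < k ->
  cintegral H (fun t => cpow t (w - 1) * (expR (- (k * t)))%:C) =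
  Gamma_euler w * cpow k (- w).
Proof.
move=> w0 k0.
have i1 : cintegrable H (fun t => cpow t (w - 1) * (expR (- t))%:C).
  apply: eq_cintegrable (cintegrable_gamma w0 ltr01) => // t _.
  by rewrite mul1r.
have := cintegral_scale k0 i1; rewrite -/(Gamma_euler w).
rewrite (eq_cintegral (g := fun t => cpow k (w - 1) *
    (cpow t (w - 1) * (expR (- (k * t)))%:C))); last first.
  by move=> t t0; rewrite cpowMl// mulrA.
rewrite cintegralZ; [|exact: measurable_halfline|exact: cintegrable_gamma].
rewrite (cpowN k w) (cpowB1 w k0) real_complexV.
move: (Gamma_euler w) (cintegral _ _) => G I E.
have kn0 : k%:C != 0 by apply/eqP => -[] /eqP; rewrite gt_eqF.
have wn0 := cpow_neq0 k w.
apply: (mulfI wn0); rewrite [RHS]mulrCA (mulfV wn0) mulr1.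
by apply: (mulfI (invr_neq0 kn0)); rewrite -E mulrA [_^-1 * _]mulrC.
Qed.

(** The upper incomplete Gamma function normalised to the lower limit 1: in the
    usual notation it is k^(-s) Gamma(s, k). *)
Definition upper_gamma k s : R[i] :=
  cintegral `]1, +oo[ (fun t => cpow t (s - 1) * (expR (- (k * t)))%:C).

Lemma cintegrable_upper_gamma k s : 0 < k ->
  cintegrable `]1, +oo[ (fun t => cpow t (s - 1) * (expR (- (k * t)))%:C).
Proof.
move=> k0; have c0 : 0 < `|Re s| + 1 by rewrite ltr_wpDl.
have ig : mu.-integrable `]1, +oo[
    (fun t => (t `^ (`|Re s| + 1 - 1) * expR (- (k * t)))%:E).
  by apply: integrableS (integrable_gamma c0 k0) => //; exact: sub_halfline_y.
apply: cintegrable_dom (cmeasurable_gamma _ _ _) ig _ => // t t1.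
have t1' : 1 < t by move: t1; rewrite /= in_itv/= andbT.
rewrite normc_gamma ?(sub_halfline_y t1)// ler_wpM2r ?expR_ge0//.
apply: ler_powR; first exact: ltW.
rewrite ReD ReN /= lerD2r; by apply: le_trans (ler_norm _) _; rewrite lerDl.
Qed.

Lemma cvg_invn (d : R) : 0 < d -> n.+1%:R^-1 `^ d @[n --> \oo] --> (0 : R).
Proof.
move=> d0; apply/cvgrPdist_lt => e e0; near=> n.
have n0 : 0 < n.+1%:R^-1 :> R by rewrite invr_gt0.
rewrite sub0r normrN ger0_norm ?powR_ge0//.
have eE : e = (e `^ d^-1) `^ d by rewrite -powRrM mulVf ?powRr1 ?ltW// gt_eqF.
rewrite eE gt0_ltr_powR ?nnegrE ?powR_ge0 ?ltW//.
rewrite invf_plt ?posrE ?powR_gt0// (@lt_le_trans _ _ n%:R) ?ler_nat//.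
by near: n; exact: nbhs_infty_gtr.
Unshelve. all: by end_near. Qed.

Lemma cvg_powR_expR (p k : R) : 0 < k ->
  n.+1%:R `^ p * expR (- (k * n.+1%:R)) @[n --> \oo] --> (0 : R).
Proof.
move=> k0; have p0 : 0 < `|p| + 2 by rewrite ltr_wpDl.
have [C C0 hC] := powR_le_expR p0 k0.
have cv : C * n.+1%:R^-1 `^ 1 @[n --> \oo] --> (0 : R).
  by rewrite -(mulr0 C); apply: cvgM; [exact: cvg_cst|exact: cvg_invn].
apply: squeeze_cvgr (cvg_cst 0) cv; apply: nearW => n /=.
rewrite mulr_ge0 ?powR_ge0 ?expR_ge0//= expRN ler_pdivrMr ?expR_gt0//.
rewrite powRr1 ?invr_ge0// mulrAC ler_pdivlMr//.
apply: le_trans (hC n.+1%:R _) => //.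
have n1 : 1 <= n.+1%:R :> R by rewrite ler1n.
apply: (@le_trans _ _ (n.+1%:R `^ (`|p| + 2))); last first.
  by rewrite ge0_ler_powR ?nnegrE ?lerDr ?addr_ge0.
rewrite -[X in _ * X]powRr1// -powRD; last by rewrite pnatr_eq0 implybT.
by rewrite ler_powR// lerD ?ler_norm ?ler1n.
Qed.

(** Integration by parts. *)
Lemma upper_gammaS k s : 0 < k ->
  k%:C * upper_gamma k (s + 1) = (expR (- k))%:C + s * upper_gamma k s.
Proof.
move=> k0.
have iS := cintegrable_upper_gamma (s + 1) k0; have i0 := cintegrable_upper_gamma s k0.
rewrite /upper_gamma -!cintegralZ//.
pose F t := cpow t s * (expR (- (k * t)))%:C.
pose f t := s * (cpow t (s - 1) * (expR (- (k * t)))%:C) +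
  - k%:C * (cpow t (s + 1 - 1) * (expR (- (k * t)))%:C).
have de (x : R) : 0 < x ->
    is_derive x 1 (fun t => expR (- (k * t))) (- k * expR (- (k * x))).
  move=> x0.
  have d1 : is_derive x 1 (fun t => - (k * t)) (- k).
    by apply: is_derive_eq; rewrite /GRing.scale /= mulr1.
  by apply: is_derive_eq; rewrite mulrC.
have Ff : cderive F f.
  have -> : f = fun t => cpow t s * (- k * expR (- (k * t)))%:C +
      s * cpow t (s - 1) * (expR (- (k * t)))%:C.
    by apply/funext => t; rewrite /f addrK real_complexM real_complexN; ring.
  exact: cderiveM (@cderive_cpow R s) (cderive_real de).
have cf : ccontinuous f.
  have cE w : ccontinuous (fun t => cpow t w * (expR (- (k * t)))%:C).
    exact: cderive_ccontinuous (cderiveM (@cderive_cpow R w) (cderive_real de)).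
  by apply: ccontinuousD; exact: ccontinuousZ.
have jf : cintegrable `]1, +oo[ f.
  by apply: cintegrableD => //; exact: cintegrableZ.
have Fl : ccvg (fun n => F n.+1%:R) 0.
  apply: ccvg0_le (cvg_powR_expR (Re s) k0) => n.
  by rewrite /F normc_gamma.
have := cintegral_FTCy Ff cf jf Fl.
rewrite /f cintegralD//; [|exact: cintegrableZ|exact: cintegrableZ].
rewrite [in X in _ + X]cintegralZ// /F cpow1e mul1r mulr1 sub0r => E.
rewrite [LHS]cintegralZ// -[(expR (- k))%:C]opprK -E; ring.
Qed.

(** Partial sums of the expansion of the lower incomplete Gamma function, with
    the same normalisation. *)
Definition lower_sum k s n : R[i] :=
  \sum_(j < n) ((- k) ^+ j / j`!%:R)%:C / (s + j%:R).

Lemma cintegral_power01 w : 0 < Re w ->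
  cintegrable `]0, 1] (fun t => cpow t (w - 1)) /\
  cintegral `]0, 1] (fun t => cpow t (w - 1)) = w^-1.
Proof.
move=> w0; have wn0 : w != 0 by apply/eqP => w0'; rewrite w0' ltxx in w0.
have mc : cmeasurable_fun (`]0, 1]%classic : set R) (fun t => cpow t (w - 1)).
  by apply: cmeasurable_cpow; exact: measurable_id.
have i1 : cintegrable `]0, 1] (fun t => cpow t (w - 1)).
  apply: cintegrable_dom mc (integrable_powR_0 w0) _ => // t t1.
  by rewrite normc_cpow ?(sub_halfline_0 t1)// ReD ReN.
split => //; apply: (mulfI wn0); rewrite divff// -cintegralZ//.
have Fl : ccvg (fun n => cpow n.+1%:R^-1 w) 0.
  by apply: ccvg0_le (cvg_invn w0) => n; rewrite normc_cpow.
rewrite (cintegral_FTC0 (@cderive_cpow R w) _ _ Fl) ?cpow1e ?subr0//.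
- exact: ccontinuousZ (cderive_ccontinuous (@cderive_cpow R (w - 1))).
- exact: cintegrableZ.
Qed.

Let lower_gamma_base k s : 0 < k -> 0 < Re s ->
  ccvg (lower_sum k s) (Gamma_euler s * cpow k (- s) - upper_gamma k s).
Proof.
move=> k0 s0.
have ig := cintegrable_gamma s0 k0.
have ig0 : cintegrable `]0, 1] (fun t => cpow t (s - 1) * (expR (- (k * t)))%:C).
  by apply: cintegrableS ig => //; exact: sub_halfline_0.
have -> : Gamma_euler s * cpow k (- s) - upper_gamma k s =
    cintegral `]0, 1] (fun t => cpow t (s - 1) * (expR (- (k * t)))%:C).
  rewrite -cintegral_gamma// halfline_setU cintegral_setU//.
  - by rewrite addrK.
  - exact: halfline_disj.
  - by rewrite -halfline_setU.
pose f_ n t := \sum_(j < n) ((- k) ^+ j / j`!%:R)%:C * cpow t (s + j%:R - 1).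
have sj0 j : 0 < Re (s + j%:R) by rewrite ReD Re_nat ltr_wpDr.
have if_ j : cintegrable `]0, 1] (fun t => ((- k) ^+ j / j`!%:R)%:C * cpow t (s + j%:R - 1)).
  by apply: cintegrableZ => //; case: (cintegral_power01 (sj0 j)).
have -> : lower_sum k s = fun n => cintegral `]0, 1] (f_ n).
  apply/funext => n; rewrite /f_.
  rewrite (cintegral_sum (h := fun j t => ((- k) ^+ j / j`!%:R)%:C *
    cpow t (s + j%:R - 1)))//; apply: eq_bigr => j _.
  by have [i1 i2] := cintegral_power01 (sj0 j); rewrite cintegralZ// i2.
have f_E n t : 0 < t -> f_ n t = cpow t (s - 1) * (expsum (- (k * t)) n)%:C.
  move=> t0; rewrite /f_ /expsum -[(\sum_(_ < _) _)%:C]/(real_complex _ _) rmorph_sum mulr_sumr.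
  apply: eq_bigr => j _ /=.
  rewrite addrAC (cpowD t (s - 1) j%:R) cpow_nat// -mulNr exprMn !real_complexM; ring.
apply: (cdominated_convergence (h := fun t => t `^ (Re s - 1) * expR k)) => //.
- move=> n; apply: (cmeasurable_sum (h := fun j t => ((- k) ^+ j / j`!%:R)%:C *
    cpow t (s + j%:R - 1))) => j; apply: cmeasurableM.
    exact: cmeasurable_cst.
  by apply: cmeasurable_cpow; exact: measurable_id.
- exact: cintegrable_cmeasurable.
- have : mu.-integrable `]0, 1] (fun t => ((expR k)%:E * (t `^ (Re s - 1))%:E)%E).
    by apply: integrableZl => //; exact: integrable_powR_0.
  by apply: eq_integrable => // t _; rewrite /= muleC.
- move=> n t t1; have t0 := sub_halfline_0 t1.
  have t1' : t <= 1 by move: t1; rewrite /= in_itv/= => /andP[].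
  rewrite f_E// Normc.normcM normc_cpow// normc_real ReD ReN.
  rewrite ler_wpM2l ?powR_ge0// (le_trans (norm_expsum_le _ _))// ler_expR.
  rewrite normrN ger0_norm; last by rewrite mulr_ge0 ?ltW.
  by rewrite ler_piMr// ltW.
- move=> t t1; have t0 := sub_halfline_0 t1.
  under eq_fun do rewrite f_E//.
  by apply: ccvgZ; apply: ccvg_real; exact: cvg_expsum.
Qed.

(** The partial sums satisfy, up to an exponential sum, the same recursion as
    the incomplete Gamma function. *)
Let lower_sumS k s n : (forall j : nat, s + j%:R != 0) ->
  s * lower_sum k s n.+1 = k%:C * lower_sum k (s + 1) n + (expsum (- k) n.+1)%:C.
Proof.
move=> sj.
pose a j : R[i] := ((- k) ^+ j / j`!%:R)%:C.
have aS j : a j.+1 * j.+1%:R = - k%:C * a j.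
  rewrite /a -real_complex_nat -real_complexN -!real_complexM; congr (_ %:C).
  rewrite exprS factS natrM; field.
  by rewrite pnatr_eq0 -lt0n fact_gt0 nat1r pnatr_eq0.
have -> : (expsum (- k) n.+1)%:C = \sum_(j < n.+1) a j.
  by rewrite /expsum -[LHS]/(real_complex _ _) rmorph_sum.
have -> : s * lower_sum k s n.+1 =
    \sum_(j < n.+1) a j - \sum_(j < n.+1) a j * j%:R / (s + j%:R).
  rewrite -sumrB mulr_sumr; apply: eq_bigr => j _.
  rewrite /a; have := sj j; move: ((- k) ^+ j / j`!%:R)%:C (j%:R : R[i]) => x y xy.
  by field.
rewrite [X in _ - X]big_ord_recl mulr0 mul0r add0r addrC; congr (_ + _).
rewrite /lower_sum mulr_sumr -sumrN; apply: eq_bigr => j _.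
rewrite lift0 aS -/(a j) -natr1.
by rewrite !mulNr opprK mulrA [s + 1 + _]addrAC addrA.
Qed.

(** Euler's integral splits at 1 into the upper incomplete Gamma function and
    a power series integrated term by term. *)
Lemma Gamma_eulerS s : 0 < Re s -> Gamma_euler (s + 1) = s * Gamma_euler s.
Proof.
move=> s0.
have sj (j : nat) : s + j%:R != 0.
  apply/eqP => /(congr1 (@complex.Re R)); rewrite ReD Re_nat /=.
  by apply/eqP; rewrite gt_eqF// ltr_wpDr.
have s10 : 0 < Re (s + 1) by rewrite ReD addr_gt0.
have h1 := lower_gamma_base ltr01 s0.
have h2 := lower_gamma_base ltr01 s10.
rewrite !cpow1e !mulr1 in h1 h2.
have h3 := (ccvgS (fun n => s * lower_sum 1 s n) _).2 (ccvgZ s h1).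
have h4 : ccvg (fun n => s * lower_sum 1 s n.+1)
    (1 * (Gamma_euler (s + 1) - upper_gamma 1 (s + 1)) + (expR (- 1))%:C).
  under eq_fun do rewrite lower_sumS//.
  apply: ccvgD; first exact: ccvgZ.
  by apply: ccvg_real; rewrite (cvg_shiftS (expsum (- 1))); exact: cvg_expsum.
have := ccvg_unique h3 h4; have := upper_gammaS s (@ltr01 R).
rewrite !mul1r => -> E; apply/eqP; rewrite -subr_eq0; apply/eqP.
move/eqP: E; rewrite eq_sym -subr_eq0 => /eqP E; rewrite -[RHS]E; ring.
Qed.

Let Gamma_shiftS s : Re s <= 0 -> Gamma_shift s = (Gamma_shift (s + 1)).+1.
Proof.
move=> s0; rewrite /Gamma_shift ltNge s0 /= ReD /=.
case: ifPn => [s1|]; last rewrite -leNgt => s1.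
  congr _.+1; apply: truncn_def; rewrite oppr_ge0 s0 /=.
  by rewrite ltrNl -subr_gt0 opprK.
congr _.+1; set x := - (Re s + 1).
have x0 : 0 <= x by rewrite /x oppr_ge0.
have -> : - Re s = x + 1 by rewrite /x; ring.
apply: truncn_def; have /andP[t1 t2] := truncn_itv x0.
by rewrite -!natr1 !lerD2r ltrD2r t1 natr1.
Qed.

Lemma GammaE s : 0 < Re s -> Gamma s = Gamma_euler s.
Proof. by move=> s0; rewrite /Gamma /Gamma_shift s0 big_ord0 divr1 addr0. Qed.

Lemma GammaS s : s != 0 -> Gamma (s + 1) = s * Gamma s.
Proof.
move=> sn0; case: (ltP 0 (Re s)) => [s0|s0].
  by rewrite !GammaE ?Gamma_eulerS// ReD addr_gt0.
rewrite /Gamma (Gamma_shiftS s0); set n := Gamma_shift _.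
have E j : s + j.+1%:R = s + 1 + j%:R by rewrite -nat1r addrA.
have -> : \prod_(k < n.+1) (s + k%:R) = s * \prod_(k < n) (s + 1 + k%:R).
  by rewrite big_ord_recl addr0; congr (_ * _); apply: eq_bigr => j _; rewrite lift0 E.
by rewrite E invfM [RHS]mulrCA [X in _ = _ * X]mulrA (mulfV sn0) mul1r.
Qed.

(** The expansion of the Gamma function at an arbitrary point off the poles,
    carried leftwards from Euler's half-plane by the functional equations of
    both sides. *)
Lemma cvg_lower_sum k s : 0 < k -> (forall j : nat, s + j%:R != 0) ->
  ccvg (lower_sum k s) (Gamma s * cpow k (- s) - upper_gamma k s).
Proof.
move=> k0; have [n] : exists n : nat, 0 < Re s + n%:R.
  exists (Num.bound (- Re s)); rewrite -ltrBlDl sub0r.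
  case: (leP 0 (- Re s)) => [/archi_boundP//|/lt_le_trans]; exact.
elim: n s => [|n IH] s sn sj.
  by rewrite addr0 in sn; rewrite GammaE//; exact: lower_gamma_base.
have s0 : s != 0 by have := sj 0%N; rewrite addr0.
have E (j : nat) : s + 1 + j%:R = s + j.+1%:R by rewrite -nat1r addrA.
have h : ccvg (lower_sum k (s + 1))
    (Gamma (s + 1) * cpow k (- (s + 1)) - upper_gamma k (s + 1)).
  by apply: IH => [|j]; rewrite ?E// ReD /= -addrA nat1r.
apply/ccvgS.
have -> : (fun m => lower_sum k s m.+1) = fun m => s^-1 *
    (k%:C * lower_sum k (s + 1) m + (expsum (- k) m.+1)%:C).
  by apply/funext => m; rewrite -lower_sumS// mulKf.
have -> : Gamma s * cpow k (- s) - upper_gamma k s = s^-1 *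
    (k%:C * (Gamma (s + 1) * cpow k (- (s + 1)) - upper_gamma k (s + 1)) + (expR (- k))%:C).
  have U := upper_gammaS s k0.
  rewrite mulrBr U GammaS//.
  have -> : k%:C * (s * Gamma s * cpow k (- (s + 1))) = s * (Gamma s * cpow k (- s)).
    rewrite opprD cpowB1// !mulrA [_ * k%:C^-1]mulrC !mulrA mulVf ?mul1r//.
    by apply/eqP => -[] /eqP; rewrite gt_eqF.
  by rewrite opprD addrA addrAC addrNK -mulrBr mulKf.
apply: ccvgZ; apply: ccvgD; first exact: ccvgZ.
by apply: ccvg_real; rewrite (cvg_shiftS (expsum (- k))); exact: cvg_expsum.
Qed.

End GammaTheory.

(** * Absence of zeros of the Gamma function *)

Section GammaNonzero.
Context {R : realType}.
Notation mu := (@lebesgue_measure R).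
Notation H := (@halfline R).

Lemma sqr_ln_le (u : R) : 0 < u -> ln u ^+ 2 <= (u - 1) ^+ 2 * (1 + u ^- 2).
Proof.
move=> u0.
have l1 : ln u <= u - 1.
  have := @le_ln1Dx R (u - 1); rewrite addrCA subrr addr0; apply.
  by rewrite ltrBrDr addNr.
have l2 : 1 - u^-1 <= ln u.
  have := @le_ln1Dx R (u^-1 - 1); rewrite addrCA subrr addr0 lnV// lerNl opprB.
  by apply; rewrite ltrBrDr addNr invr_gt0.
have -> : (u - 1) ^+ 2 * (1 + u ^- 2) = (u - 1) ^+ 2 + (1 - u^-1) ^+ 2.
  by field; rewrite gt_eqF.
case: (leP 0 (ln u)) => lu.
- apply: (@le_trans _ _ ((u - 1) ^+ 2)); last by rewrite lerDl sqr_ge0.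
  by rewrite ler_pXn2r ?nnegrE// (le_trans lu l1).
- apply: (@le_trans _ _ ((1 - u^-1) ^+ 2)); last by rewrite lerDr sqr_ge0.
  rewrite -[ln u ^+ 2]sqrrN -[leRHS]sqrrN ler_pXn2r ?nnegrE ?lerN2//.
    by rewrite oppr_ge0 ltW.
  by rewrite oppr_ge0 (le_trans l2)// ltW.
Qed.

Lemma ler_abs_sin (x : R) : `|sin x| <= `|x|.
Proof.
wlog x0 : x / 0 <= x => [h|].
  case: (leP 0 x) => [/h//|x0].
  by rewrite -normrN -sinN -[leRHS]normrN h// oppr_ge0 ltW.
have ds (y : R) : is_derive y 1 sin (cos y) by exact: is_derive_sin.
have cs : {within `[0, x], continuous (@sin R)}.
  by apply: continuous_subspaceT; exact: continuous_sin.
have [c _] := MVT_segment x0 (fun y _ => ds y) cs.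
rewrite sin0 !subr0 => ->; rewrite normrM ler_piMl//.
by rewrite ler_norml cos_geN1 cos_le1.
Qed.

Lemma cos_ge (x : R) : 1 - x ^+ 2 / 2 <= cos x.
Proof.
have -> : cos x = 1 - 2 * sin (x / 2) ^+ 2.
  by rewrite [in LHS](splitr x) cosD -!expr2 cos2sin2; ring.
rewrite lerB// (_ : x ^+ 2 / 2 = 2 * `|x / 2| ^+ 2); last first.
  by rewrite real_normK ?num_real//; field.
rewrite ler_wpM2l// -[sin _ ^+ 2]real_normK ?num_real//.
by rewrite ler_pXn2r ?nnegrE// ler_abs_sin.
Qed.

Let rgamma (c : R) : R := Re (Gamma_euler c%:C).

Let gint (c : R) (t : R) : R := t `^ (c - 1) * expR (- t).

Let Gamma_euler_real (c : R) : cintegral H (fun t => (gint c t)%:C) = Gamma_euler c%:C.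
Proof.
apply: eq_cintegral => t t0.
by rewrite /gint real_complexM -cpow_real// real_complexD real_complexN.
Qed.

Let integrable_gint (c : R) : 0 < c -> mu.-integrable H (fun t => (gint c t)%:E).
Proof.
move=> c0; have := integrable_gamma c0 (@ltr01 R).
by under eq_fun do rewrite mul1r.
Qed.

Let rgammaE (c : R) : rgamma c = \int[mu]_(t in H) gint c t.
Proof. by rewrite /rgamma -Gamma_euler_real. Qed.

Let rgammaS (c : R) : 0 < c -> rgamma (c + 1) = c * rgamma c.
Proof.
move=> c0; rewrite /rgamma real_complexD Gamma_eulerS// ReM /= mul0r subr0.
by [].
Qed.

Let rgamma_gt0 (c : R) : 1 <= c -> 0 < rgamma c.
Proof.
move=> c1; have c0 : 0 < c := lt_le_trans ltr01 c1.
have ig := integrable_gint c0.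
rewrite rgammaE /Rintegral fine_gt0//; apply/andP; split; last first.
  by rewrite ltey_eq integrable_fin_num.
have mg (D : set R) : measurable_fun D (fun t => (gint c t)%:E).
  apply: measurable_funTS; apply/measurable_EFinP; apply: measurable_funM.
    exact: measurable_powR.
  by apply: measurable_fun_expR; exact: measurable_funN.
have sub : `[1, 2]%classic `<=` H.
  by move=> t /=; rewrite in_itv/= => /andP[t1 _]; exact: lt_le_trans t1.
apply: (@lt_le_trans _ (\bar R) (\int[mu]_(t in `[1%R, 2%R]) (expR (- 2))%:E)%E).
  rewrite integral_cst//= lebesgue_measure_itv/= lte_fin ltr1n/= -EFinB.
  by rewrite -EFinM lte_fin mulr_gt0 ?expR_gt0// subr_gt0 ltr1n.
apply: (@le_trans _ (\bar R) (\int[mu]_(t in `[1%R, 2%R]) (gint c t)%:E)%E).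
  apply: ge0_le_integral => //.
  - exact: mg.
  - move=> t; rewrite /= in_itv/= => /andP[t1 t2]; rewrite lee_fin /gint.
    rewrite -[leLHS]mul1r ler_pM ?expR_ge0 ?ler_expR ?lerN2//.
    rewrite -[leLHS](powRr0 t); apply: ler_powR => //.
    by rewrite subr_ge0.
apply: ge0_subset_integral => //; first exact: mg.
by move=> t _; rewrite lee_fin mulr_ge0 ?powR_ge0 ?expR_ge0.
Qed.

(** The Gamma distribution of large mean X concentrates near X, so the
    oscillating factor t^(iy), rotated to be 1 at t = X, has positive average:
    the loss is at most y^2/2 times the mean of (ln (t/X))^2, which is estimated
    through the bound of (ln u)^2 by a Laurent polynomial. *)
Let Gamma_euler_neq0_large (X y : R) : 4 <= X -> 2 * y ^+ 2 < X - 1 ->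
  Gamma_euler (X +i* y) != 0.
Proof.
move=> X4 yX; have X0 : 0 < X by apply: lt_le_trans X4.
have X1 : 0 < X - 1 by lra.
have X2 : 0 < X - 2 by lra.
have iX := integrable_gint X0.
apply/eqP => G0.
pose p t := gint X t * cos (y * ln (t / X)).
have pE t : 0 < t -> p t =
    Re (cpow X (0 -i* y) * (cpow t (X +i* y - 1) * (expR (- (1 * t)))%:C)).
  move=> t0; rewrite mul1r.
  have -> : X +i* y - 1 = (X - 1)%:C + (0 +i* y) by simpc.
  have -> : cpow X (0 -i* y) * (cpow t ((X - 1)%:C + (0 +i* y)) * (expR (- t))%:C) =
     (gint X t)%:C * cpow (t / X) (0 +i* y).
    rewrite cpowD cpow_real// cpowMl ?invr_gt0// cpowVl//.
    have -> : 0 -i* y = - (0 +i* y) by simpc.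
    by rewrite /gint real_complexM; ring.
  by rewrite (ReM (gint X t)%:C) Re_cpow /= !mul0r expR0 mul1r subr0.
have s0 : 0 < Re (X +i* y) by [].
have ip0 := cintegrableZ (cpow X (0 -i* y)) (@measurable_halfline R)
  (cintegrable_gamma s0 (@ltr01 R)).
have p0 : \int[mu]_(t in H) p t = 0.
  have := cintegralZ (cpow X (0 -i* y)) (@measurable_halfline R)
    (cintegrable_gamma s0 (@ltr01 R)).
  rewrite cintegral_gamma// G0 mul0r mulr0 => /(congr1 (@complex.Re R)) /= E.
  rewrite -[RHS]E; apply: eq_Rintegral => t; rewrite inE => t0.
  by rewrite pE.
have ip : mu.-integrable H (fun t => (p t)%:E).
  have [ip1 _] := ip0; apply: eq_integrable ip1 => // t; rewrite inE => t0.
  by rewrite pE.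
pose k := y ^+ 2 / 2.
(* coefficients, from t^(-2) to t^2, of 1 - k (u - 1)^2 (1 + u^(-2)) at u = t/X *)
pose a := [:: - k * X ^+ 2; 2 * k * X; 1 - 2 * k; 2 * k / X; - k / X ^+ 2].
pose c (i : nat) := X - 2 + i%:R.
have c0 i : 0 < c i by rewrite ltr_wpDr.
pose q t := \sum_(i < 5) a`_i * gint (c i) t.
have ia i : cintegrable H (fun t => (a`_i)%:C * (gint (c i) t)%:C).
  apply: cintegrableZ; first exact: measurable_halfline.
  by apply: cintegrable_real; [exact: measurable_halfline|exact: integrable_gint].
have qE t : (q t)%:C = \sum_(i < 5) (a`_i)%:C * (gint (c i) t)%:C.
  rewrite /q -[LHS]/(real_complex _ _) rmorph_sum; apply: eq_bigr => i _.
  exact: real_complexM.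
have iq : mu.-integrable H (fun t => (q t)%:E).
  have [i1 _] := cintegrable_sum 5 (@measurable_halfline R) ia.
  apply: eq_integrable i1 => [|t _]; first exact: measurable_halfline.
  by rewrite -qE.
have q0 : \int[mu]_(t in H) q t = \sum_(i < 5) a`_i * rgamma (c i).
  have := cintegral_sum 5 (@measurable_halfline R) ia.
  move=> /(congr1 (@complex.Re R)) /= E; transitivity
    (Re (\sum_(i < 5) (a`_i * rgamma (c i))%:C)); last first.
    by rewrite -(rmorph_sum (real_complex R)).
  transitivity (\int[mu]_(t in H) Re (\sum_(i < 5) (a`_i)%:C * (gint (c i) t)%:C)).
    by apply: eq_Rintegral => t _; rewrite -qE.
  rewrite E; congr Re; apply: eq_bigr => i _.
  rewrite cintegralZ; [|exact: measurable_halfline|]; last first.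
    by apply: cintegrable_real; [exact: measurable_halfline|exact: integrable_gint].
  rewrite real_complexM; congr (_ * _); rewrite Gamma_euler_real.
  have : Gamma_euler (c i)%:C = (rgamma (c i))%:C.
    rewrite rgammaE -Gamma_euler_real; apply: complex_eq => //=.
    by rewrite /Rintegral integral0.
  by [].
have pq t : 0 < t -> q t <= p t.
  move=> t0; have tn0 : t != 0 by rewrite gt_eqF.
  have Xn0 : X != 0 by rewrite gt_eqF.
  pose u := t / X; have u0 : 0 < u by rewrite divr_gt0.
  have cE i : gint (c i) t = gint X t * t ^+ i / t ^+ 2.
    rewrite /gint /c (_ : X - 2 + i%:R - 1 = (X - 1) + (i%:R - 2)); last by ring.
    rewrite (@powRD _ t (X - 1)); last by rewrite tn0 implybT.
    rewrite (@powRD _ t i%:R); last by rewrite tn0 implybT.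
    rewrite powRN !powR_mulrn ?ltW//; ring.
  have -> : q t = gint X t * (1 - k * ((u - 1) ^+ 2 * (1 + u ^- 2))).
    rewrite /q !big_ord_recr big_ord0 /= !cE /u; field.
    by rewrite Xn0.
  rewrite /p ler_wpM2l ?mulr_ge0 ?powR_ge0 ?expR_ge0//.
  apply: le_trans (cos_ge _); rewrite lerB// exprMn /k mulrAC.
  by apply: ler_wpM2l; [rewrite divr_ge0 ?sqr_ge0|exact: sqr_ln_le].
have : \int[mu]_(t in H) q t <= 0.
  rewrite -p0; apply: le_Rintegral => //; exact: measurable_halfline.
apply/negP; rewrite -ltNge q0.
have g0 : 0 < rgamma (X - 2) by apply: rgamma_gt0; lra.
have gS i : rgamma (c i.+1) = c i * rgamma (c i).
  have -> : c i.+1 = c i + 1 by rewrite /c -[i.+1]addn1 natrD addrA.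
  exact: rgammaS.
rewrite !big_ord_recr big_ord0 /= !gS {6}/c addr0.
have -> : rgamma (c 0%N) = rgamma (X - 2) by rewrite /c addr0.
move: (rgamma (X - 2)) g0 => g g0; rewrite /c addr0.
set S := (X in 0 < X).
have -> : S = g * ((X - 1) * (X - 2) - k * (2 * X - 1 + 2 / X)).
  by rewrite /S; field; rewrite gt_eqF.
apply: mulr_gt0 => //; rewrite subr_gt0.
have k0 : 0 <= k by rewrite /k mulr_ge0 ?sqr_ge0 ?invr_ge0.
apply: (@le_lt_trans _ _ (k * (2 * X))).
  rewrite ler_wpM2l// -addrA gerDl.
  by rewrite addrC subr_le0 ler_pdivrMr// mul1r; lra.
have kX : 4 * k < X - 1 by rewrite /k; lra.
apply: (@le_lt_trans _ _ (4 * k * (X - 2))).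
  have := ler_wpM2l k0 X4; nra.
by rewrite ltr_pM2r.
Qed.

(** The zero-free half-plane above is spread by the functional equation. *)
Lemma Gamma_neq0 (s : R[i]) : 0 < Re s -> Gamma s != 0.
Proof.
move=> s0; pose y := Im s.
have step (n : nat) : Gamma s = 0 -> Gamma (s + n%:R) = 0.
  move=> G0; elim: n => [|n IH]; first by rewrite addr0.
  rewrite -natr1 addrA GammaS ?IH ?mulr0//.
  apply/eqP => /(congr1 (@complex.Re R)); rewrite ReD Re_nat /= => /eqP.
  by rewrite gt_eqF// ltr_wpDr.
have [n nlt] : exists n : nat, 4 + 2 * y ^+ 2 < n%:R.
  exists (Num.bound (4 + 2 * y ^+ 2)); apply: archi_boundP.
  by rewrite addr_ge0// mulr_ge0// sqr_ge0.
apply/eqP => /(step n); apply/eqP.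
have y2 := sqr_ge0 y.
have sn : s + n%:R = (Re s + n%:R) +i* y.
  by apply: complex_eq; rewrite ?ReD ?ImD ?Re_nat ?Im_nat ?addr0.
rewrite GammaE; last by rewrite sn /= ltr_wpDr.
by rewrite sn; apply: Gamma_euler_neq0_large; lra.
Qed.

End GammaNonzero.

(** * Bounds that separate variables *)

Section ProductBounds.
Context {R : realType}.

Lemma powR_le_1Dx (u a : R) : 0 < u -> 0 <= a -> a <= 1 -> (1 + u) `^ a <= 1 + u.
Proof.
move=> u0 a0 a1; rewrite -[leRHS]powRr1 ?addr_ge0 ?(ltW u0)//.
by apply: ler_powR => //; rewrite lerDl ltW.
Qed.

Lemma expRN_le_powR1D (u a : R) : 0 < u -> 0 <= a -> a <= 1 ->
  expR (- u) <= (1 + u) `^ (- a).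
Proof.
move=> u0 a0 a1; have u10 : 0 < 1 + u by rewrite addr_gt0.
rewrite expRN powRN lef_pV2 ?posrE ?expR_gt0 ?powR_gt0//.
exact: le_trans (powR_le_1Dx u0 a0 a1) (expR_ge1Dx u).
Qed.

Lemma expRN_le_powR (u a : R) : 0 < u -> 0 <= a -> a <= 1 -> expR (- u) <= u `^ (- a).
Proof.
move=> u0 a0 a1; apply: le_trans (expRN_le_powR1D u0 a0 a1) _.
have u0' := ltW u0.
rewrite !powRN lef_pV2 ?posrE ?powR_gt0 ?addr_gt0//.
by apply: ge0_ler_powR => //; rewrite ?nnegrE ?addr_ge0 ?lerDr.
Qed.

(** Decouples the two variables of e^(-vt), at the price of a small power. *)
Lemma expRNM_le (v t a : R) : 0 < v -> 0 < t -> 0 <= a -> a <= 1 ->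
  expR (- (v * t)) <= (1 + t) `^ (- a) * (1 + v `^ (- a)).
Proof.
move=> v0 t0 a0 a1; have t10 : 0 < 1 + t by rewrite addr_gt0.
have vt0 : 0 < v * t by rewrite mulr_gt0.
rewrite mulrDr mulr1; case: (leP 1 v) => v1.
  apply: (@le_trans _ _ (expR (- t))).
    by rewrite ler_expR lerN2 ler_peMl// ltW.
  apply: le_trans (expRN_le_powR1D t0 a0 a1) _.
  by rewrite lerDl mulr_ge0 ?powR_ge0.
apply: le_trans (expRN_le_powR1D vt0 a0 a1) _.
apply: (@le_trans _ _ ((1 + t) `^ (- a) * v `^ (- a))); last first.
  by rewrite lerDr powR_ge0.
rewrite -powRM ?(ltW t10) ?(ltW v0)// !powRN.
rewrite lef_pV2 ?posrE ?powR_gt0 ?addr_gt0 ?mulr_gt0//.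
apply: ge0_ler_powR => //; rewrite ?nnegrE ?(ltW (mulr_gt0 t10 v0))//.
  by rewrite addr_ge0 ?ltW.
by rewrite mulrDl mul1r [t * v]mulrC lerD2r ltW.
Qed.

Lemma ler_invD (c s : R) : 0 < c -> 0 <= s -> (c + s)^-1 <= c^-1.
Proof. by move=> c0 s0; rewrite lef_pV2 ?posrE ?lerDl// ltr_wpDr. Qed.

Lemma ler_quotM (p q e c s : R) : 0 <= p -> 0 <= q -> 0 <= e -> 0 < c -> 0 <= s ->
  p * (q * (e / (c + s))) <= p * c^-1 * (q * e).
Proof.
move=> p0 q0 e0 c0 s0; rewrite -!mulrA; apply: ler_wpM2l => //.
rewrite [leRHS]mulrCA; apply: ler_wpM2l => //; rewrite [leRHS]mulrC; apply: ler_wpM2l => //.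
exact: ler_invD.
Qed.

End ProductBounds.

(** * The Stieltjes transform of Tricomi's integral *)

Section StieltjesTransform.
Context {R : realType}.
Notation mu := (@lebesgue_measure R).
Notation T := (measurableTypeR R).
Notation H := (@halfline R).
Implicit Types (b d r : R[i]) (x : R).

Lemma Gamma_euler1 : Gamma_euler 1 = 1 :> R[i].
Proof.
have -> : Gamma_euler 1 = cintegral H (fun t => (expR (- t))%:C).
  by apply: eq_cintegral => t _; rewrite subrr cpow0 mul1r.
apply: complex_eq => /=; last by rewrite /Rintegral integral0.
have := @integral_exponential_pdf R 1 ltr01.
rewrite (_ : (\int[mu]_x _)%E = (\int[mu]_(x in H) (expR (- x))%:E)%E).
  by rewrite /Rintegral => ->.
rewrite (_ : H = `]0, +oo[%classic); last by rewrite set_itvoy.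
rewrite integral_itv_obnd_cbnd; last first.
  apply/measurable_EFinP; apply: measurable_fun_expR; exact: measurable_funN.
rewrite [RHS]integral_mkcond; apply: eq_integral => x _.
rewrite /exponential_pdf !patchE; case: ifP => _ //.
by rewrite mul1r mulN1r.
Qed.

Let m1 : measurable_fun setT (fun z : T * T => z.1 : R). Proof. exact: measurable_fst. Qed.
Let m2 : measurable_fun setT (fun z : T * T => z.2 : R). Proof. exact: measurable_snd. Qed.
Let mD (u v : T * T -> R) : measurable_fun setT u -> measurable_fun setT v ->
  measurable_fun setT (fun z => u z + v z).
Proof. exact: measurable_funD. Qed.
Let mM (u v : T * T -> R) : measurable_fun setT u -> measurable_fun setT v ->
  measurable_fun setT (fun z => u z * v z).
Proof. exact: measurable_funM. Qed.
Let mN (u : T * T -> R) : measurable_fun setT u -> measurable_fun setT (fun z => - u z).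
Proof. exact: measurable_funN. Qed.
Let mc (c : R) : measurable_fun setT (fun z : T * T => c).
Proof. exact: measurable_cst. Qed.
Let mV (u : T * T -> R) : measurable_fun setT u -> measurable_fun setT (fun z => (u z)^-1).
Proof. exact: measurable_funV. Qed.
Let mE (u : T * T -> R) : measurable_fun setT u -> measurable_fun setT (fun z => expR (u z)).
Proof. exact: measurable_fun_expR. Qed.

Let integrableC (u : R -> R) (c : R) : mu.-integrable H (fun t => (u t)%:E) ->
  mu.-integrable H (fun t => (c * u t)%:E).
Proof.
move=> iu; under eq_fun do rewrite EFinM.
by apply: integrableZl => //; exact: measurable_halfline.
Qed.

Let integrable_gammaD (a c : R) (k : R) : 0 < a -> 0 < c -> 0 < k ->
  mu.-integrable H (fun t => (t `^ (a - 1) * expR (- (k * t)) +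
    t `^ (c - 1) * expR (- (k * t)))%:E).
Proof.
move=> a0 c0 k0; under eq_fun do rewrite EFinD.
apply: integrableD; first exact: measurable_halfline.
- exact: integrable_gamma.
- exact: integrable_gamma.
Qed.

(** Writing 1/(1+t) as a Laplace transform turns its Mellin transform into a
    product of two Euler integrals. *)
Lemma cintegral_reflection r : 0 < Re r -> Re r < 1 ->
  cintegrable H (fun t => cpow t (r - 1) * ((1 + t)^-1)%:C) /\
  cintegral H (fun t => cpow t (r - 1) * ((1 + t)^-1)%:C) =
  Gamma_euler r * Gamma_euler (1 - r).
Proof.
move=> r0 r1; set b := Re r.
pose th := (1 + b) / 2.
have thb : 0 < th - b by rewrite /th /b; lra.
have th1 : 0 < 1 - th by rewrite /th /b; lra.
have th0 : 0 <= th by rewrite /th /b; lra.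
pose F (z : T * T) : R[i] := cpow z.1 (r - 1) * (expR (- (z.2 * (1 + z.1))))%:C.
have mF : cmeasurable_fun setT F.
  apply: cmeasurableM; first exact: cmeasurable_cpow.
  by apply: cmeasurable_real; exact: mE (mN (mM m2 (mD (mc 1) m1))).
have ig := integrable_beta r0 thb.
have ih := integrable_gammaD (@ltr01 R) th1 (@ltr01 R).
have [|iF EF] := cFubini_dom mF ig ih.
  move=> t v t0 v0; rewrite (normc_cpowM _ _ t0) (normc_real_ge0 (expR_ge0 _)).
  rewrite [(t, v).1]/= [(t, v).2]/=.
  rewrite ReB1 -mulrA ler_wpM2l ?powR_ge0//.
  rewrite mulrDr mulr1 opprD expRD [b + (th - b)]addrC subrK.
  have -> : v `^ (1 - 1) * expR (- (1 * v)) + v `^ (1 - th - 1) * expR (- (1 * v)) =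
      (1 + v `^ (- th)) * expR (- v).
    by rewrite subrr powRr0 !mul1r (_ : 1 - th - 1 = - th); ring.
  rewrite [leLHS]mulrC mulrA ler_wpM2r ?expR_ge0//.
  by apply: expRNM_le => //; rewrite /th; lra.
have Et t : 0 < t -> cintegral H (fun v => F (t, v)) = cpow t (r - 1) * ((1 + t)^-1)%:C.
  move=> t0; have t10 : 0 < 1 + t by rewrite addr_gt0.
  have E10 : 0 < Re (1 : R[i]) by [].
  have i1 := cintegrable_gamma E10 t10.
  transitivity (cintegral H (fun v => cpow t (r - 1) *
     (cpow v (1 - 1) * (expR (- ((1 + t) * v)))%:C))).
    by apply: eq_cintegral => v _; rewrite /F /= subrr cpow0 mul1r [v * _]mulrC.
  rewrite cintegralZ; [|exact: measurable_halfline|exact: i1].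
  by rewrite (cintegral_gamma E10 t10) Gamma_euler1 mul1r (cpowN _ 1) (cpow1 t10) real_complexV.
have Ev v : 0 < v -> cintegral H (fun t => F (t, v)) =
    Gamma_euler r * (cpow v (1 - r - 1) * (expR (- v))%:C).
  move=> v0; have i1 := cintegrable_gamma r0 v0.
  transitivity (cintegral H (fun t => (expR (- v))%:C *
     (cpow t (r - 1) * (expR (- (v * t)))%:C))).
    apply: eq_cintegral => t _; rewrite /F /= mulrDr mulr1 opprD expRD real_complexM; ring.
  rewrite cintegralZ; [|exact: measurable_halfline|exact: i1].
  rewrite (cintegral_gamma r0 v0) (_ : 1 - r - 1 = - r); last by ring.
  by move: (Gamma_euler r) (cpow _ _) => A B; ring.
split.
  by apply: eq_cintegrable iF; [exact: measurable_halfline|exact: Et].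
rewrite -(eq_cintegral Et) EF (eq_cintegral Ev).
have r'0 : 0 < Re (1 - r) by rewrite ReD ReN subr_gt0.
have i1 := cintegrable_gamma r'0 (@ltr01 R).
rewrite cintegralZ; [|exact: measurable_halfline|].
  by congr (_ * _).
apply: eq_cintegrable i1; first exact: measurable_halfline.
by move=> t _; rewrite mul1r.
Qed.

(** The integral of Tricomi's function: up to a Gamma factor,
    U(b, b + d, x) when d is written for c - b in U(b, c, x). *)
Definition tricomi b d x : R[i] :=
  cintegral H (fun t => cpow t (b - 1) * (cpow (1 + t) (d - 1) * (expR (- (x * t)))%:C)).

Lemma cintegrable_tricomi b d x : 0 < Re b -> Re d <= 1 -> 0 < x ->
  cintegrable H (fun t => cpow t (b - 1) * (cpow (1 + t) (d - 1) * (expR (- (x * t)))%:C)).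
Proof.
move=> b0 d1 x0.
apply: cintegrable_dom (integrable_gamma b0 x0) _.
- exact: measurable_halfline.
- apply: cmeasurableM; last apply: cmeasurableM.
  + by apply: cmeasurable_cpow; exact: measurable_id.
  + by apply: cmeasurable_cpow; exact: measurable_funD.
  + apply: cmeasurable_real; apply: measurable_fun_expR; apply: measurable_funN.
    exact: measurable_funM.
- move=> t t0; have t10 : 0 < 1 + t by rewrite addr_gt0.
  rewrite (normc_cpowM _ _ t0) (normc_cpowM _ _ t10) (normc_real_ge0 (expR_ge0 _)).
  rewrite !ReB1 ler_wpM2l ?powR_ge0// ler_piMl ?expR_ge0//.
  rewrite -[leRHS](powRr0 (1 + t)); apply: ler_powR; by [rewrite lerDl ltW|rewrite subr_le0].
Qed.

(** Two scalings, one under each order of integration, turn the exponential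
    weight of one Tricomi integral into that of the other and leave the constant
    Mellin transform of 1/(1+t) behind. *)
Lemma stieltjes_tricomi b d x : 0 < Re b -> 0 < Re d -> Re b + Re d = 1 -> 0 < x ->
  cintegrable H (fun y => cpow y (d - 1) * (expR (- y) / (x + y))%:C * tricomi b d y) /\
  cintegral H (fun y => cpow y (d - 1) * (expR (- y) / (x + y))%:C * tricomi b d y) =
  Gamma_euler b * Gamma_euler (1 - b) * cpow x (d - 1) * tricomi d b x.
Proof.
move=> b0 d0 bd x0.
have b1 : Re b < 1 by rewrite -bd ltrDl.
have d1 : Re d < 1 by rewrite -bd ltrDr.
pose th := Re d / 2.
have th0 : 0 < th by rewrite divr_gt0.
have dth : 0 < Re d - th by rewrite /th; lra.
pose F (z : T * T) : R[i] := cpow z.1 (d - 1) * ((expR (- z.1) / (x + z.1))%:C *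
  (cpow z.2 (b - 1) * (cpow (1 + z.2) (d - 1) * (expR (- (z.1 * z.2)))%:C))).
have mF : cmeasurable_fun setT F.
  apply: cmeasurableM; [exact: cmeasurable_cpow|apply: cmeasurableM].
    by apply: cmeasurable_real; exact: mM (mE (mN m1)) (mV (mD (mc x) m1)).
  apply: cmeasurableM; [exact: cmeasurable_cpow|apply: cmeasurableM].
    by apply: cmeasurable_cpow; exact: mD (mc 1) m2.
  by apply: cmeasurable_real; exact: mE (mN (mM m1 m2)).
have ig := integrableC x^-1 (integrable_gammaD d0 dth (@ltr01 R)).
have ih := integrable_beta b0 th0.
have [|iF EF] := cFubini_dom mF ig ih.
  move=> y t y0 t0; have t10 : 0 < 1 + t by rewrite addr_gt0.
  have xy0 : 0 < x + y by rewrite addr_gt0.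
  have e0 : 0 <= expR (- y) / (x + y) by rewrite divr_ge0 ?expR_ge0 ?(ltW xy0).
  rewrite (normc_cpowM _ _ y0) (normc_realM _ e0) (normc_cpowM _ _ t0).
  rewrite (normc_cpowM _ _ t10) (normc_real_ge0 (expR_ge0 _)) [(y, t).1]/= [(y, t).2]/=.
  rewrite !ReB1 !mul1r.
  have hE := expRNM_le y0 t0 (ltW th0) (_ : th <= 1).
  have -> : x^-1 * (y `^ (Re d - 1) * expR (- y) + y `^ (Re d - th - 1) * expR (- y)) *
      (t `^ (Re b - 1) * (1 + t) `^ (- (Re b + th))) =
      y `^ (Re d - 1) * (expR (- y) / x * (t `^ (Re b - 1) * ((1 + t) `^ (Re d - 1) *
       ((1 + t) `^ (- th) * (1 + y `^ (- th)))))).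
    have -> : Re d - th - 1 = (Re d - 1) + - th by ring.
    have -> : - (Re b + th) = (Re d - 1) + - th by rewrite -bd; ring.
    rewrite !(@powRD _ _ (Re d - 1) (- th)) ?(gt_eqF y0) ?(gt_eqF t10) ?implybT//; ring.
  rewrite ler_wpM2l ?powR_ge0//; apply: ler_pM => //.
  - by rewrite !mulr_ge0 ?powR_ge0 ?expR_ge0.
  - by rewrite ler_wpM2l ?expR_ge0// lef_pV2 ?posrE// lerDl ltW.
  - by rewrite ler_wpM2l ?powR_ge0// ler_wpM2l ?powR_ge0// hE//; rewrite /th; lra.
have Ey y : 0 < y -> cintegral H (fun t => F (y, t)) =
    cpow y (d - 1) * (expR (- y) / (x + y))%:C * tricomi b d y.
  move=> y0; have it := cintegrable_tricomi b0 (ltW d1) y0.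
  rewrite -[RHS](cintegralZ _ (@measurable_halfline R) it).
  by apply: eq_cintegral => t _; rewrite /F /= mulrA.
split; first by apply: eq_cintegrable iF; [exact: measurable_halfline|exact: Ey].
rewrite -(eq_cintegral Ey) EF.
pose F2 (z : T * T) : R[i] := cpow z.1 (b - 1) * (cpow z.2 (d - 1) *
   (expR (- (x * z.2)) / (1 + z.1 + z.2))%:C).
have mF2 : cmeasurable_fun setT F2.
  apply: cmeasurableM; [exact: cmeasurable_cpow|apply: cmeasurableM].
  - exact: cmeasurable_cpow.
  - apply: cmeasurable_real; apply: mM; first exact: mE (mN (mM (mc x) m2)).
    exact: mV (mD (mD (mc 1) m1) m2).
have b1' : 0 < 1 - Re b by rewrite subr_gt0.
have ig2 := integrable_beta b0 b1'.
have ih2 := integrable_gamma d0 x0.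
have [|iF2 EF2] := cFubini_dom mF2 ig2 ih2.
  move=> t s t0 s0; have t10 : 0 < 1 + t by rewrite addr_gt0.
  have ts0 : 0 < 1 + t + s by rewrite addr_gt0.
  have e0 : 0 <= expR (- (x * s)) / (1 + t + s) by rewrite divr_ge0 ?expR_ge0 ?(ltW ts0).
  rewrite (normc_cpowM _ _ t0) (normc_cpowM _ _ s0) (normc_real_ge0 e0).
  rewrite !ReB1 (_ : Re b + (1 - Re b) = 1); last by ring.
  rewrite (powR_inv1 (ltW t10)).
  exact: (ler_quotM (powR_ge0 _ _) (powR_ge0 _ _) (expR_ge0 _) t10 (ltW s0)).
have Et t : 0 < t -> cintegral H (fun y => F (y, t)) =
    cpow x (d - 1) * cintegral H (fun s => F2 (t, s)).
  move=> t0; clear - F F2 x0 d0 integrableC t0; have t10 : 0 < 1 + t by rewrite addr_gt0.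
  have c0 : 0 < x / (1 + t) by rewrite divr_gt0.
  pose f y := cpow y (d - 1) * (expR (- (y * (1 + t))) / (x + y))%:C.
  have if_ : cintegrable H f.
    apply: cintegrable_dom (integrableC x^-1 (integrable_gamma d0 (@ltr01 R))) _.
    - exact: measurable_halfline.
    - apply: cmeasurableM; first by apply: cmeasurable_cpow; exact: measurable_id.
      apply: cmeasurable_real; apply: measurable_funM.
        apply: measurable_fun_expR; apply: measurable_funN; exact: measurable_funM.
      by apply: measurable_funV; exact: measurable_funD.
    - move=> y y0; have xy0 : 0 < x + y by rewrite addr_gt0.
      have e0 : 0 <= expR (- (y * (1 + t))) / (x + y) by rewrite divr_ge0 ?expR_ge0 ?(ltW xy0).
      rewrite (normc_cpowM _ _ y0) (normc_real_ge0 e0) ReB1 [leRHS]mulrCA.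
      apply: (ler_wpM2l (powR_ge0 _ _)); rewrite [leRHS]mulrC.
      have i0 : 0 <= (x + y)^-1 by rewrite invr_ge0 (ltW xy0).
      apply: (ler_pM (expR_ge0 _) i0).
        by rewrite ler_expR lerN2 mulrDr mulr1 mul1r lerDl (ltW (mulr_gt0 y0 t0)).
      exact: (ler_invD x0 (ltW y0)).
  transitivity (cpow t (b - 1) * cpow (1 + t) (d - 1) * cintegral H f).
    rewrite -cintegralZ; [|exact: measurable_halfline|exact: if_].
    apply: eq_cintegral => y _; rewrite /F /f /= mulrDr mulr1 opprD expRD.
    rewrite !real_complexM; ring.
  have := cintegral_scale c0 if_; set c := x / (1 + t) in c0 *.
  have is2 : cintegrable H (fun s => cpow s (d - 1) *
      (expR (- (x * s)) / (1 + t + s))%:C).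
    apply: cintegrable_dom (integrable_gamma d0 x0) _.
    - exact: measurable_halfline.
    - apply: cmeasurableM; first by apply: cmeasurable_cpow; exact: measurable_id.
      apply: cmeasurable_real; apply: measurable_funM.
        apply: measurable_fun_expR; apply: measurable_funN; exact: measurable_funM.
      by apply: measurable_funV; exact: measurable_funD.
    - move=> s s0; have ts0 : 0 < 1 + t + s by rewrite addr_gt0.
      have e0 : 0 <= expR (- (x * s)) / (1 + t + s) by rewrite divr_ge0 ?expR_ge0 ?(ltW ts0).
      rewrite (normc_cpowM _ _ s0) (normc_real_ge0 e0) ReB1.
      apply: (ler_wpM2l (powR_ge0 _ _)); apply: (ler_piMr (expR_ge0 _)).
      by have := ler_invD ltr01 (ltW (addr_gt0 t0 s0)); rewrite addrA invr1.
  have -> : cintegral H (fun s => f (c * s)) = cpow c (d - 1) * ((1 + t) / x)%:C *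
      cintegral H (fun s => cpow s (d - 1) * (expR (- (x * s)) / (1 + t + s))%:C).
    rewrite -cintegralZ; [|exact: measurable_halfline|exact: is2].
    apply: eq_cintegral => s s0; rewrite /f cpowMl//.
    have -> : expR (- (c * s * (1 + t))) / (x + c * s) =
        (1 + t) / x * (expR (- (x * s)) / (1 + t + s)).
      rewrite (_ : c * s * (1 + t) = x * s); last first.
        by rewrite /c; field; rewrite gt_eqF.
      by rewrite /c; field; rewrite !gt_eqF// ?addr_gt0// ?mulr_gt0// ?addr_gt0.
    rewrite !real_complexM; ring.
  have -> : cintegral H (fun s => F2 (t, s)) = cpow t (b - 1) *
      cintegral H (fun s => cpow s (d - 1) * (expR (- (x * s)) / (1 + t + s))%:C).
    by rewrite -(cintegralZ _ (@measurable_halfline R) is2).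
  move: (cintegral H f) (cintegral H _) => A B E.
  have -> : A = c%:C * (cpow c (d - 1) * ((1 + t) / x)%:C * B).
    rewrite E real_complexV mulrA mulfV ?mul1r//.
    by apply/eqP => -[] /eqP; rewrite gt_eqF.
  have -> : cpow x (d - 1) = cpow c (d - 1) * cpow (1 + t) (d - 1).
    by rewrite -cpowMl// /c divfK// gt_eqF.
  have -> : c%:C * (cpow c (d - 1) * ((1 + t) / x)%:C * B) = cpow c (d - 1) * B.
    have : c%:C * ((1 + t) / x)%:C = 1.
      by rewrite -real_complexM /c mulrA divfK ?gt_eqF// divff ?gt_eqF.
    move=> h; transitivity (c%:C * ((1 + t) / x)%:C * (cpow c (d - 1) * B)); first by ring.
    by rewrite h mul1r.
  ring.
have i2 : cintegrable H (fun t => cintegral H (fun s => F2 (t, s))) := iF2.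
rewrite (eq_cintegral Et) cintegralZ; [|exact: measurable_halfline|exact: i2].
rewrite EF2.
have [ir Er] := cintegral_reflection b0 b1.
have Es s : 0 < s -> cintegral H (fun t => F2 (t, s)) =
    Gamma_euler b * Gamma_euler (1 - b) *
    (cpow s (d - 1) * (cpow (1 + s) (b - 1) * (expR (- (x * s)))%:C)).
  move=> s0; clear - F2 s0 ig2 Er ir;  have s10 : 0 < 1 + s by rewrite addr_gt0.
  pose g t := cpow t (b - 1) * ((1 + t + s)^-1)%:C.
  have igr : cintegrable H g.
    apply: cintegrable_dom ig2 _.
    - exact: measurable_halfline.
    - apply: cmeasurableM; first by apply: cmeasurable_cpow; exact: measurable_id.
      apply: cmeasurable_real; apply: measurable_funV.
      by apply: measurable_funD => //; exact: measurable_funD.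
    - move=> t t0; have t10 : 0 < 1 + t by rewrite addr_gt0.
      have ts0 : 0 < 1 + t + s by rewrite addr_gt0.
      have e0 : 0 <= (1 + t + s)^-1 by rewrite invr_ge0 ltW.
      rewrite (normc_cpowM _ _ t0) (normc_real_ge0 e0) ReB1.
      rewrite (_ : Re b + (1 - Re b) = 1); last by ring.
      rewrite (powR_inv1 (ltW t10)).
      exact: (ler_wpM2l (powR_ge0 _ _) (ler_invD t10 (ltW s0))).
  transitivity (cpow s (d - 1) * (expR (- (x * s)))%:C * cintegral H g).
    rewrite -cintegralZ; [|exact: measurable_halfline|exact: igr].
    by apply: eq_cintegral => t _; rewrite /F2 /g /= real_complexM; ring.
  have := cintegral_scale s10 igr.
  have -> : cintegral H (fun t => g ((1 + s) * t)) = cpow (1 + s) (b - 1) * ((1 + s)^-1)%:C *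
      (Gamma_euler b * Gamma_euler (1 - b)).
    rewrite -Er -cintegralZ; [|exact: measurable_halfline|exact: ir].
    apply: eq_cintegral => t t0; rewrite /g cpowMl//.
    have t10 : 0 < 1 + t by rewrite addr_gt0.
    have -> : (1 + (1 + s) * t + s)^-1 = (1 + s)^-1 * (1 + t)^-1.
      by rewrite -invfM; congr _^-1; ring.
    rewrite real_complexM; ring.
  have sn0 : ((1 + s)^-1)%:C != 0 :> R[i].
    by apply/eqP => -[] /eqP; rewrite invr_eq0 gt_eqF.
  move: (cintegral H g) (Gamma_euler b * _) => A B E.
  have -> : A = cpow (1 + s) (b - 1) * B.
    by apply: (mulfI sn0); rewrite -E; ring.
  ring.
rewrite (eq_cintegral Es) cintegralZ; last first.
- exact: cintegrable_tricomi d0 (ltW b1) x0.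
- exact: measurable_halfline.
by rewrite -/(tricomi d b x) mulrA [_ * cpow x _]mulrC.
Qed.

End StieltjesTransform.

(** * Power series for Macdonald's function *)

Section Bessel.
Context {R : realType}.
Notation mu := (@lebesgue_measure R).
Notation H := (@halfline R).
Implicit Types (nu s w : R[i]) (q r t x : R).

Lemma cmeasurable_bessel (D : set R) w (a b : R) :
  cmeasurable_fun D (fun t => cpow t w * (expR (- (a * t) - b / t))%:C).
Proof.
apply: cmeasurableM; first by apply: cmeasurable_cpow; exact: measurable_id.
apply: cmeasurable_real; apply: measurable_fun_expR; apply: measurable_funB.
  by apply: measurable_funN; exact: measurable_funM.
by apply: measurable_funM => //; exact: measurable_funV.
Qed.

Lemma cintegrable_bessel w (a b : R) : 0 < Re w + 1 -> 0 < a -> 0 < b ->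
  cintegrable H (fun t => cpow t (w - 1) * (expR (- (a * t) - b / t))%:C).
Proof.
move=> w0 a0 b0.
have ig : mu.-integrable H (fun t => (b^-1 * (t `^ (Re w + 1 - 1) * expR (- (a * t))))%:E).
  under eq_fun do rewrite EFinM.
  by apply: integrableZl => //; exact: integrable_gamma.
apply: cintegrable_dom (cmeasurable_bessel _ _ _ _) ig _ => //.
move=> t t0; have bt0 : 0 < b / t by rewrite divr_gt0.
rewrite (normc_cpowM _ _ t0) (normc_real_ge0 (expR_ge0 _)) expRD ReB1 addrK.
have h := expRN_le_powR bt0 ler01 (lexx 1).
rewrite (powR_inv1 (ltW bt0)) invf_div in h.
have -> : t `^ (Re w) = t `^ (Re w - 1) * t.
  rewrite -[X in _ * X](powRr1 (ltW t0)) -powRD ?subrK//.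
  by rewrite (gt_eqF t0) implybT.
move: (powR_ge0 t (Re w - 1)) (expR_ge0 (- (a * t))) h.
move: (t `^ _) (expR (- (a * t))) (expR (- (b / t))) => P E X P0 E0 h.
rewrite (_ : b^-1 * _ = P * (E * (t / b))); last by ring.
by apply: (ler_wpM2l P0); apply: (ler_wpM2l E0).
Qed.

(** Twice q^(-nu/2) times Macdonald's function K_nu(2 sqrt q). *)
Definition bessel nu q : R[i] :=
  cintegral H (fun t => cpow t (- nu - 1) * (expR (- (1 * t) - q / t))%:C).

(** The part beyond the fixed point of the inversion t -> 1/t. *)
Definition half_bessel s r : R[i] :=
  cintegral `]1, +oo[ (fun t => cpow t (s - 1) * (expR (- (r * t) - r / t))%:C).

(** The substitution t = r u makes the exponent invariant under u -> 1/u, and the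
    half-line folds onto the half-line beyond the fixed point 1. *)
Lemma bessel_fold nu r : Re nu = 0 -> 0 < r ->
  bessel nu (r * r) = cpow r (- nu) * (half_bessel (- nu) r + half_bessel nu r).
Proof.
move=> nu0 r0.
have rr0 : 0 < r * r by rewrite mulr_gt0.
have h1 : 0 < Re (- nu) + 1 by rewrite ReN nu0 oppr0 add0r.
have i1 := cintegrable_bessel h1 (@ltr01 R) rr0.
have i2 := cintegrable_bessel h1 r0 r0.
have h2 : 0 < Re nu + 1 by rewrite nu0 add0r.
have i3 := cintegrable_bessel h2 r0 r0.
have := cintegral_scale r0 i1; rewrite -/(bessel nu (r * r)).
set g := fun t => _ in i2.
have -> : cintegral H (fun t => cpow (r * t) (- nu - 1) *
    (expR (- (1 * (r * t)) - r * r / (r * t)))%:C) =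
    cpow r (- nu) * (r%:C)^-1 * cintegral H g.
  rewrite -(cintegralZ _ (@measurable_halfline R) i2); apply: eq_cintegral => t t0.
  rewrite (cpowMl _ r0 t0) (cpowB1 (- nu) r0) /g mul1r.
  rewrite (_ : r * r / (r * t) = r / t); last first.
    by field; rewrite (gt_eqF r0) (gt_eqF t0).
  by rewrite !mulrA.
have sub01 : [set` `]0, 1]] `<=` H := @sub_halfline_0 R.
have suby : [set` `]1, +oo[] `<=` H := @sub_halfline_y R.
have ig0 : cintegrable `]0, 1] g by apply: cintegrableS i2 => //.
have igy : cintegrable `]1, +oo[ g by apply: cintegrableS i2 => //.
have -> : cintegral H g = half_bessel nu r + half_bessel (- nu) r.
  rewrite halfline_setU cintegral_setU//; last first.
  - by rewrite -halfline_setU.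
  - exact: halfline_disj.
  have E t : 0 < t -> (t ^- 2)%:C * g t^-1 =
      cpow t (nu - 1) * (expR (- (r * t) - r / t))%:C.
    move=> t0; rewrite /g cpowVl// invrK.
    have -> : - (r / t) - r * t = - (r * t) - r / t by ring.
    rewrite mulrA; congr (_ * _).
    have -> : - (- nu - 1) = nu - 1 + 2%:R by ring.
    rewrite cpowD cpow_nat// [_ * _%:C]mulrC mulrA -real_complexM.
    by rewrite mulVf ?mul1r// expf_neq0// gt_eqF.
  congr (_ + _); rewrite cintegral_inversion//.
  - by apply: eq_cintegral => t /suby; exact: E.
  - have de (y : R) : 0 < y -> is_derive y 1 (fun t => expR (- (r * t) - r / t))
        ((- r + r * y ^- 2) * expR (- (r * y) - r / y)).
      move=> y0; have yn0 : y != 0 by rewrite gt_eqF.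
      have d0 := is_derive_id y (1 : R).
      have d1 : is_derive y 1 (fun t : R => t^-1) (- (y ^- 2)).
        have := is_deriveV yn0 d0; rewrite /GRing.scale /= mulr1; exact.
      have d2 : is_derive y 1 (fun t => - (r * t) - r / t) (- r + r * y ^- 2).
        by apply: is_derive_eq; rewrite /GRing.scale /=; ring.
      by apply: is_derive_eq; rewrite mulrC.
    exact: cderive_ccontinuous (cderiveM (@cderive_cpow R _) (cderive_real de)).
  - apply: eq_cintegrable (cintegrableS _ _ suby i3) => // t /suby t0.
    by rewrite (E _ t0).
move: (half_bessel nu r) (half_bessel (- nu) r) (bessel _ _) => A B C E.
have rn0 : (r^-1)%:C != 0 :> R[i] by apply/eqP => -[] /eqP; rewrite invr_eq0 gt_eqF.
by apply: (mulfI rn0); rewrite -E real_complexV; ring.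
Qed.

(** The factor e^(-r/t) is expanded in powers of 1/t: on t > 1 the partial sums
    stay below e^r. *)
Lemma cvg_half_bessel s r : 0 < r ->
  ccvg (fun N => \sum_(n < N) ((- r) ^+ n / n`!%:R)%:C * upper_gamma r (s - n%:R))
    (half_bessel s r).
Proof.
move=> r0; pose a n : R[i] := ((- r) ^+ n / n`!%:R)%:C.
pose h n t := a n * (cpow t (s - n%:R - 1) * (expR (- (r * t)))%:C).
have ih n : cintegrable `]1, +oo[ (h n).
  by apply: cintegrableZ => //; exact: cintegrable_upper_gamma.
have -> : (fun N => \sum_(n < N) a n * upper_gamma r (s - n%:R)) =
    fun N => cintegral `]1, +oo[ (fun t => \sum_(n < N) h n t).
  apply/funext => N; rewrite (cintegral_sum N _ ih)//; apply: eq_bigr => n _.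
  by rewrite /h cintegralZ//; exact: cintegrable_upper_gamma.
have hE t N : 0 < t -> \sum_(n < N) h n t =
    cpow t (s - 1) * (expR (- (r * t)) * expsum (- (r / t)) N)%:C.
  move=> t0; rewrite real_complexM /expsum -[(\sum_(_ < _) _)%:C]/(real_complex _ _) rmorph_sum.
  rewrite !mulr_sumr; apply: eq_bigr => n _; rewrite /h /a /=.
  rewrite addrAC (cpowD t (s - 1)) cpowN cpow_nat// -real_complexV.
  rewrite -[- (r / t)]mulNr exprMn exprVn !real_complexM; ring.
have suby : [set` `]1, +oo[] `<=` H := @sub_halfline_y R.
apply: (cdominated_convergence (h := fun t => t `^ (Re s - 1) * expR (- (r * t)) * expR r)) => //.
- move=> N; apply: (cmeasurable_sum (h := h)) => n.
  exact: cintegrable_cmeasurable (ih n).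
- exact: cmeasurable_bessel.
- have [i1 _] := cintegrable_upper_gamma (Re s)%:C r0.
  have i2 : mu.-integrable `]1, +oo[ (fun t => (t `^ (Re s - 1) * expR (- (r * t)))%:E).
    apply: eq_integrable i1 => // t; rewrite inE => /suby t0.
    by rewrite (_ : (Re s)%:C - 1 = (Re s - 1)%:C) ?cpow_real//
      -?real_complexM// real_complexD real_complexN.
  have i3 : mu.-integrable `]1, +oo[
      (fun t => ((expR r)%:E * (t `^ (Re s - 1) * expR (- (r * t)))%:E)%E).
    by apply: integrableZl.
  by apply: eq_integrable i3 => // t _; rewrite /= muleC.
- move=> N t t1; have t0 := suby _ t1.
  rewrite (hE _ _ t0) (normc_cpowM _ _ t0) normc_real ReB1 normrM (ger0_norm (expR_ge0 _)) -mulrA.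
  apply: (ler_wpM2l (powR_ge0 _ _)); apply: (ler_wpM2l (expR_ge0 _)).
  apply: le_trans (norm_expsum_le _ _) _; rewrite ler_expR normrN ger0_norm; last first.
    by rewrite divr_ge0 ?ltW.
  move: t1; rewrite /= in_itv/= andbT => t1.
  by rewrite ler_pdivrMr// ler_peMr ?ltW.
- move=> t /suby t0; under eq_fun do rewrite (hE _ _ t0).
  rewrite expRD; apply: ccvgZ; apply: ccvg_real.
  by apply: cvgM; [exact: cvg_cst|exact: cvg_expsum].
Qed.

Lemma normc_ccvg_le (u : nat -> R[i]) (l z : R[i]) (B : R) (N : nat) :
  ccvg u l -> (forall n, (N <= n)%N -> normc (u n - z) <= B) -> normc (l - z) <= B.
Proof.
move=> [u1 u2] uB.
have l1 : (fun n => `|Re l - Re (u n)| + `|Im l - Im (u n)| + B) @ \oo --> (0 + 0 + B : R).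
  have c1 (v : nat -> R) (y : R) : v @ \oo --> y -> (fun n => `|y - v n|) @ \oo --> (0 : R).
    move=> vy; rewrite -[0](@normr0 _ R) -(subrr y); apply: cvg_norm.
    by apply: cvgB => //; exact: cvg_cst.
  by apply: cvgD; [apply: cvgD; exact: c1|exact: cvg_cst].
rewrite !add0r in l1.
rewrite -(cvg_lim _ l1)//; apply: limr_ge; first by apply/cvg_ex; exists B.
near=> n; have nN : (N <= n)%N by near: n; exact: nbhs_infty_ge.
rewrite (_ : l - z = (l - u n) + (u n - z)); last by ring.
apply: le_trans (normcD_le _ _) _; apply: lerD (uB n nN).
by apply: le_trans (normc_le_ReIm _) _; rewrite ReD ReN ImD ImN.
Unshelve. all: by end_near. Qed.

Lemma lower_sum_tail s r N M (d : R) : 0 < r -> 0 < d -> (N <= M)%N ->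
  (forall j : nat, d <= normc (s + j%:R)) ->
  normc (lower_sum r s M - lower_sum r s N) <= (expR r - expsum r N) / d.
Proof.
move=> r0 d0 NM sd.
have d' j : normc (s + j%:R)^-1 <= d^-1.
  rewrite Normc.normcV lef_pV2 ?posrE//; exact: lt_le_trans (sd j).
apply: (@le_trans _ _ ((expsum r M - expsum r N) / d)); last first.
  by rewrite ler_pM2r ?invr_gt0// lerD2r expsum_le// ltW.
have -> : lower_sum r s M - lower_sum r s N =
    \sum_(N <= j < M) ((- r) ^+ j / j`!%:R)%:C / (s + j%:R).
  rewrite /lower_sum -!(big_mkord xpredT (fun j => ((- r) ^+ j / j`!%:R)%:C / (s + j%:R))).
  by rewrite (big_cat_nat (leq0n N) NM)//= addrAC subrr add0r.
have -> : expsum r M - expsum r N = \sum_(N <= j < M) (r ^+ j / j`!%:R).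
  rewrite /expsum -!(big_mkord xpredT (fun j => r ^+ j / j`!%:R)).
  by rewrite (big_cat_nat (leq0n N) NM)//= addrAC subrr add0r.
apply: le_trans (normc_sum _ _ _) _; rewrite mulr_suml; apply: ler_sum => j _.
rewrite Normc.normcM normc_real normrM normfV normrX normrN (gtr0_norm r0).
rewrite [`|_%:R|]ger0_norm//; apply: ler_wpM2l (d' j).
by rewrite divr_ge0 ?exprn_ge0 ?ltW.
Qed.

(** Off the real axis the expansion of the incomplete Gamma function converges at
    a rate that depends on the point only through its distance to the axis. *)
Lemma lower_sum_rate s r N : 0 < r -> Im s != 0 ->
  normc (Gamma s * cpow r (- s) - upper_gamma r s - lower_sum r s N) <=
  (expR r - expsum r N) / `|Im s|.
Proof.
move=> r0 s0; have d0 : 0 < `|Im s| by rewrite normr_gt0.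
have sd (j : nat) : `|Im s| <= normc (s + j%:R).
  by apply: le_trans (Im_le_normc _); rewrite ImD Im_nat addr0.
apply: (normc_ccvg_le (N := N)) (cvg_lower_sum r0 _) _ => [j|n Nn].
  by apply/eqP => sj; have := sd j; rewrite sj Normc.normc0 leNgt d0.
exact: lower_sum_tail.
Qed.

(** The recursion leftwards from - s produces the Pochhammer symbols in the
    denominators of the series. *)
Lemma Gamma_subn s (n : nat) : Im s != 0 ->
  Gamma (- s - n%:R) = (-1) ^+ n * Gamma (- s) / pochhammer (1 + s) n.
Proof.
move=> s0; elim: n => [|n IH].
  by rewrite subr0 expr0 mul1r /pochhammer big_ord0 divr1.
have n0 : - s - n.+1%:R != 0.
  apply: contraNneq s0 => /(congr1 (@complex.Im R)).
  by rewrite ImD !ImN Im_nat /= oppr0 addr0 => /eqP; rewrite oppr_eq0.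
have p0 : 1 + s + n%:R != 0.
  rewrite (_ : 1 + s + n%:R = - (- s - n.+1%:R)) ?oppr_eq0//.
  by rewrite -[n.+1]addn1 natrD; ring.
have E := GammaS n0.
rewrite (_ : - s - n.+1%:R + 1 = - s - n%:R) in E; last first.
  by rewrite -[n.+1]addn1 natrD; ring.
rewrite IH in E.
rewrite /pochhammer big_ord_recr /= -/(pochhammer _ _).
apply: (mulfI n0); rewrite -E exprS invfM.
rewrite (_ : - s - n.+1%:R = - (1 + s + n%:R)); last by rewrite -[n.+1]addn1 natrD; ring.
move: (pochhammer _ _)^-1 (Gamma _) ((-1) ^+ n) => P G e.
by field.
Qed.

Definition hyp0F1_sum s q N : R[i] :=
  \sum_(n < N) (q ^+ n / n`!%:R)%:C / pochhammer s n.

Let expc r n : R[i] := ((- r) ^+ n / n`!%:R)%:C.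

Let lower_part r w N := \sum_(n < N) expc r n * lower_sum r (w - n%:R) N.

(** The double sum over n and j has the denominators w - n + j; exchanging n and j
    turns it into its opposite at - w. *)
Let lower_part_opp r w N : lower_part r w N + lower_part r (- w) N = 0.
Proof.
rewrite /lower_part /lower_sum.
under eq_bigr do rewrite mulr_sumr.
under [X in _ + X]eq_bigr do rewrite mulr_sumr.
rewrite [X in _ + X]exchange_big -big_split big1// => n _.
rewrite -big_split big1// => j _ /=.
rewrite (_ : - w - j%:R + n%:R = - (w - n%:R + j%:R)); last by ring.
by rewrite -/(expc r n) -/(expc r j) invrN; ring.
Qed.

Let Gamma_part r w N :=
  \sum_(n < N) expc r n * (Gamma (w - n%:R) * cpow r (- (w - n%:R))).

Let Gamma_partE r w N : 0 < r -> Im w != 0 ->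
  Gamma_part r w N = cpow r (- w) * (Gamma w * hyp0F1_sum (1 - w) (r * r) N).
Proof.
move=> r0 w0; rewrite /Gamma_part /hyp0F1_sum !mulr_sumr; apply: eq_bigr => n _.
have w0' : Im (- w) != 0 by rewrite ImN oppr_eq0.
have := Gamma_subn n w0'; rewrite opprK => ->.
rewrite opprB addrC cpowD cpow_nat//.
have -> : expc r n = (-1) ^+ n * (r ^+ n / n`!%:R)%:C.
  have -> : expc r n = ((-1) ^+ n * (r ^+ n / n`!%:R))%:C.
    by rewrite /expc mulrA -exprMn mulN1r.
  by rewrite (real_complexM ((-1) ^+ n)) (real_complexX (-1)) (real_complexN 1).
have -> : (r * r) ^+ n / n`!%:R = r ^+ n / n`!%:R * r ^+ n.
  by rewrite exprMn; ring.
rewrite (real_complexM (_ / _)).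
have : (-1) ^+ n * (-1) ^+ n = 1 :> R[i] by rewrite -exprMn mulrNN mulr1 expr1n.
move: ((-1) ^+ n) (Gamma _) ((pochhammer _ _)^-1) => e G P ee.
transitivity (e * e * (cpow r (- w) * (G * ((r ^+ n / n`!%:R)%:C * (r ^+ n)%:C * P)))).
  ring.
by rewrite ee mul1r.
Qed.

(** Each incomplete Gamma function of the expansion is replaced by its own
    partial sum; the total error is a tail of the exponential series times e^r,
    divided by the distance of w to the real axis. *)
Let cvg_Gamma_part r w : 0 < r -> Im w != 0 ->
  ccvg (fun N => Gamma_part r w N - lower_part r w N) (half_bessel w r).
Proof.
move=> r0 w0; have S := cvg_half_bessel w r0.
pose U N := \sum_(n < N) expc r n * upper_gamma r (w - n%:R).
have -> : (fun N => Gamma_part r w N - lower_part r w N) =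
    fun N => U N + (Gamma_part r w N - lower_part r w N - U N).
  by apply/funext => N; rewrite [RHS]addrC subrK.
rewrite -[half_bessel w r]addr0; apply: ccvgD => //.
apply: (ccvg0_le (h := fun N => expR r * ((expR r - expsum r N) / `|Im w|))) => [N|]; last first.
  rewrite -[X in _ --> X](mulr0 (expR r)); apply: cvgM; first exact: cvg_cst.
  rewrite -[X in _ --> X](mul0r (`|Im w|^-1)); apply: cvgM; last exact: cvg_cst.
  rewrite -[X in _ --> X](subrr (expR r)).
  by apply: cvgB; [exact: cvg_cst|exact: cvg_expsum].
have tail0 : 0 <= (expR r - expsum r N) / `|Im w|.
  by rewrite divr_ge0// subr_ge0 expsum_le// ltW.
rewrite /Gamma_part /lower_part /U -!sumrB.
apply: le_trans (normc_sum _ _ _) _.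
apply: (@le_trans _ _ (expsum r N * ((expR r - expsum r N) / `|Im w|))); last first.
  by apply: (ler_wpM2r tail0); rewrite expsum_le// ltW.
rewrite {1}/expsum mulr_suml; apply: ler_sum => n _.
have wn0 : Im (w - n%:R) != 0 by rewrite ImD ImN Im_nat oppr0 addr0.
have := lower_sum_rate N r0 wn0; rewrite ImD ImN Im_nat oppr0 addr0.
move: (Gamma _ * _) (upper_gamma _ _) (lower_sum _ _ _) => A B C ABC.
rewrite (_ : _ - _ = expc r n * (A - B - C)); last by ring.
rewrite Normc.normcM /expc normc_real normrM normfV normrX normrN (gtr0_norm r0).
rewrite [`|_%:R|]ger0_norm//; apply: (ler_wpM2l _ ABC).
by rewrite divr_ge0 ?exprn_ge0 ?ltW.
Qed.

(** Macdonald's function is a combination of the two power series solutions of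
    Bessel's equation: in the sum of the expansions at nu and - nu the parts that
    do not contain a Gamma function cancel. *)
Lemma cvg_bessel nu q : Re nu = 0 -> Im nu != 0 -> 0 < q ->
  ccvg (fun N => Gamma (- nu) * hyp0F1_sum (1 + nu) q N +
                 Gamma nu * cpow q (- nu) * hyp0F1_sum (1 - nu) q N)
    (bessel nu q).
Proof.
move=> nu0 inu q0; pose r := Num.sqrt q.
have r0 : 0 < r by rewrite sqrtr_gt0.
have rr : r * r = q by rewrite -expr2 sqr_sqrtr// ltW.
have inu' : Im (- nu) != 0 by rewrite ImN oppr_eq0.
rewrite -rr (bessel_fold nu0 r0).
have -> : (fun N => Gamma (- nu) * hyp0F1_sum (1 + nu) (r * r) N +
     Gamma nu * cpow (r * r) (- nu) * hyp0F1_sum (1 - nu) (r * r) N) =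
   fun N => cpow r (- nu) * ((Gamma_part r (- nu) N - lower_part r (- nu) N) +
     (Gamma_part r nu N - lower_part r nu N)).
  apply/funext => N; rewrite !Gamma_partE// opprK cpowMl//.
  have -> : lower_part r (- nu) N = - lower_part r nu N.
    by apply/eqP; rewrite -addr_eq0 addrC lower_part_opp.
  have : cpow r (- nu) * cpow r nu = 1 by rewrite -cpowD addNr cpow0.
  move: (lower_part _ _ _) (hyp0F1_sum _ _ _) (hyp0F1_sum _ _ _) => L h1 h2 cc.
  move: (Gamma _) (Gamma _) => G1 G2.
  transitivity (cpow r (- nu) * cpow r nu * (G2 * h2) +
    cpow r (- nu) * (cpow r (- nu) * (G1 * h1))); last by ring.
  by rewrite cc mul1r; ring.
by apply: ccvgZ; apply: ccvgD; exact: cvg_Gamma_part.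
Qed.

End Bessel.

(** * Integral representation of the Whittaker function *)

Section Whittaker.
Context {R : realType}.
Notation mu := (@lebesgue_measure R).
Notation T := (measurableTypeR R).
Notation H := (@halfline R).
Implicit Types (nu beta rho s : R[i]) (q r t x p w : R).

Definition bessel_laplace beta nu x : R[i] :=
  cintegral H (fun p => cpow p (beta - 1) * (expR (- p))%:C * bessel nu (x * p)).

(** Interchanging the integrals leaves an Euler integral in p with the weight
    1 + x/w, whose power is the one of Tricomi's integrand after w = x t. *)
Lemma bessel_laplace_tricomi beta nu x : Re nu = 0 -> 0 < Re beta -> Re beta < 1 ->
  0 < x ->
  cintegrable H (fun p => cpow p (beta - 1) * (expR (- p))%:C * bessel nu (x * p)) /\
  bessel_laplace beta nu x =
  Gamma_euler beta * cpow x (- nu) * tricomi (beta - nu) (1 - beta) x.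
Proof.
move=> nu0 b0 b1 x0; pose th := Re beta / 2.
have th0 : 0 < th by rewrite divr_gt0.
have bth : 0 < Re beta - th by rewrite /th; lra.
have th1 : th <= 1 by rewrite /th; lra.
pose F (z : T * T) : R[i] := cpow z.1 (beta - 1) * ((expR (- z.1))%:C *
  (cpow z.2 (- nu - 1) * (expR (- (1 * z.2) - x * z.1 / z.2))%:C)).
have mF : cmeasurable_fun setT F.
  apply: cmeasurableM; [exact: cmeasurable_cpow|apply: cmeasurableM].
    by apply: cmeasurable_real; apply: measurable_fun_expR; exact: measurable_funN.
  apply: cmeasurableM; first exact: cmeasurable_cpow.
  apply: cmeasurable_real; apply: measurable_fun_expR; apply: measurable_funB.
    by apply: measurable_funN; exact: measurable_funM.
  apply: measurable_funM; [exact: measurable_funM|exact: measurable_funV].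
have ig : mu.-integrable H
    (fun p => (x `^ (- th) * (p `^ (Re beta - th - 1) * expR (- (1 * p))))%:E).
  under eq_fun do rewrite EFinM.
  by apply: integrableZl => //; exact: (integrable_gamma bth (@ltr01 R)).
have ih := integrable_gamma th0 (@ltr01 R).
have [|iF EF] := cFubini_dom mF ig ih.
  move=> p w p0 w0; have xpw0 : 0 < x * p / w by rewrite !mulr_gt0 ?invr_gt0.
  have h := expRN_le_powR xpw0 (ltW th0) th1.
  rewrite (normc_cpowM _ _ p0) (normc_realM _ (expR_ge0 _)) (normc_cpowM _ _ w0).
  rewrite (normc_real_ge0 (expR_ge0 _)) [(p, w).1]/= [(p, w).2]/= !mul1r !ReB1 ReN nu0 oppr0.
  have xth : (x * p / w) `^ (- th) = x `^ (- th) * (p `^ (- th) * w `^ th).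
    rewrite -mulrA powRM ?divr_ge0 ?(ltW x0) ?(ltW p0) ?(ltW w0)//.
    rewrite powRM ?invr_ge0 ?(ltW p0) ?(ltW w0)//.
    by rewrite -(powR_inv1 (ltW w0)) -powRrM mulN1r opprK.
  rewrite xth in h.
  have -> : Re beta - th - 1 = (Re beta - 1) + - th by ring.
  rewrite [th - 1]addrC sub0r.
  rewrite (@powRD _ p (Re beta - 1) (- th)) ?(gt_eqF p0) ?implybT//.
  rewrite (@powRD _ w (- 1) th) ?(gt_eqF w0) ?implybT// expRD.
  move: (powR_ge0 p (Re beta - 1)) (expR_ge0 (- p)) (powR_ge0 w (-1)) (expR_ge0 (- w)) h.
  clear; move: (p `^ (Re beta - 1)) (expR (- p)) (w `^ (-1)) (expR (- w)) => A B C D A0 B0 C0 D0 h.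
  move: (expR _) h => E; move: (x `^ _) (p `^ _) (w `^ _) => X P W h.
  rewrite (_ : X * _ * _ = A * (B * (C * (D * (X * (P * W)))))); last by ring.
  by do 4!apply: ler_wpM2l => //.
have Ep p : 0 < p -> cintegral H (fun w => F (p, w)) =
    cpow p (beta - 1) * (expR (- p))%:C * bessel nu (x * p).
  move=> p0; have ib : 0 < Re (- nu) + 1 by rewrite ReN nu0 oppr0 add0r.
  have xp0 : 0 < x * p by rewrite mulr_gt0.
  rewrite -(cintegralZ _ (@measurable_halfline R) (cintegrable_bessel ib ltr01 xp0)).
  by apply: eq_cintegral => w _; rewrite /F /= mulrA.
split; first by apply: eq_cintegrable iF; [exact: measurable_halfline|exact: Ep].
rewrite /bessel_laplace -(eq_cintegral Ep) EF.
clear - b0 b1 x0 nu0 F.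
have xV0 : 0 < x^-1 by rewrite invr_gt0.
pose G t := cpow t (beta - nu - 1) * (cpow (1 + t) (1 - beta - 1) * (expR (- (x * t)))%:C).
have iG : cintegrable H G.
  by apply: cintegrable_tricomi => //; rewrite ?ReD ?ReN ?nu0 /=; lra.
have iG' := cintegrable_scale xV0 iG.
have Ew w : 0 < w -> cintegral H (fun p => F (p, w)) =
    Gamma_euler beta * cpow x (- nu - 1) * G (x^-1 * w).
  move=> w0; pose k := 1 + x / w; have k0 : 0 < k by rewrite addr_gt0 ?divr_gt0.
  have i1 := cintegrable_gamma b0 k0.
  transitivity (cpow w (- nu - 1) * (expR (- w))%:C *
     cintegral H (fun p => cpow p (beta - 1) * (expR (- (k * p)))%:C)).
    rewrite -(cintegralZ _ (@measurable_halfline R) i1); apply: eq_cintegral => p p0.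
    have h : expR (- p) * expR (- (1 * w) - x * p / w) = expR (- w) * expR (- (k * p)).
      by rewrite -!expRD /k; congr expR; ring.
    move/(congr1 (fun y => y%:C)) : h; rewrite !real_complexM /F /= => h.
    transitivity (cpow p (beta - 1) * cpow w (- nu - 1) *
      ((expR (- p))%:C * (expR (- (1 * w) - x * p / w))%:C)); first by ring.
    by rewrite h; ring.
  rewrite (cintegral_gamma b0 k0).
  have xw0 : 0 < x^-1 * w by rewrite mulr_gt0.
  have w10 : 0 < 1 + x^-1 * w by rewrite addr_gt0.
  have kE : k = (x^-1 * w)^-1 * (1 + x^-1 * w).
    by rewrite /k; field; rewrite !gt_eqF.
  have xwV : 0 < (x^-1 * w)^-1 by rewrite invr_gt0.
  have wE : w = x * (x^-1 * w) by rewrite mulrA divff ?mul1r// gt_eqF.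
  rewrite /G -wE kE (cpowMl _ xwV w10) (cpowVl _ xw0) opprK.
  have -> : 1 - beta - 1 = - beta by ring.
  have -> : beta - nu - 1 = (- nu - 1) + beta by ring.
  rewrite [in cpow w _]wE (cpowMl _ x0 xw0) (cpowD _ (- nu - 1) beta).
  move: (Gamma_euler _) => g; ring.
rewrite (eq_cintegral Ew) (cintegralZ _ (@measurable_halfline R) iG').
rewrite (cintegral_scale xV0 iG) invrK (cpowB1 _ x0) -/(tricomi _ _ x).
have xn0 : x%:C != 0 :> R[i] by apply/eqP => -[] /eqP; rewrite gt_eqF.
move: (Gamma_euler _) (cpow x _) (tricomi _ _ _) => A B C.
by field.
Qed.
Lemma fact_le_pochhammer s n : 1 <= Re s -> n`!%:R <= normc (pochhammer s n).
Proof.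
move=> s1; elim: n => [|n IH].
  by rewrite /pochhammer big_ord0 fact0 Normc.normc1.
rewrite /pochhammer big_ord_recr /= -/(pochhammer s n) Normc.normcM factS mulnC natrM.
apply: ler_pM => //; apply: le_trans (le_trans _ (ler_norm _)) (Re_le_normc _).
by rewrite ReD Re_nat -nat1r lerD2r.
Qed.

Lemma expr_fact_le_expR x n : 0 <= x -> x ^+ n / n`!%:R <= expR x.
Proof.
move=> x0; apply: le_trans (expsum_le n.+1 x0).
rewrite /expsum big_ord_recr /= lerDr; apply: sumr_ge0 => j _.
by rewrite divr_ge0 ?exprn_ge0.
Qed.

(** The square of n! in the denominator leaves room for a bound that grows as
    slowly in p as wanted. *)
Lemma normc_hyp0F1_sum s x p N : 1 <= Re s -> 0 <= x -> 0 <= p ->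
  normc (hyp0F1_sum s (x * p) N) <= expR (2 * x) * expR (2^-1 * p).
Proof.
move=> s1 x0 p0; have p20 : 0 <= 2^-1 * p by rewrite mulr_ge0.
apply: le_trans (ler_wpM2l (expR_ge0 _) (expsum_le N p20)).
apply: le_trans (normc_sum _ _ _) _; rewrite /expsum mulr_sumr; apply: ler_sum => n _.
have f0 : 0 < n`!%:R :> R by rewrite ltr0n fact_gt0.
have xp0 : 0 <= (x * p) ^+ n / n`!%:R by rewrite divr_ge0 ?exprn_ge0 ?mulr_ge0.
rewrite (normc_realM _ xp0) Normc.normcV.
apply: (@le_trans _ _ ((x * p) ^+ n / n`!%:R * n`!%:R^-1)).
  apply: (ler_wpM2l xp0); rewrite lef_pV2 ?posrE ?fact_le_pochhammer//.
  exact: lt_le_trans (fact_le_pochhammer n s1).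
have -> : x * p = 2 * x * (2^-1 * p) by field.
have x20 : 0 <= 2 * x by rewrite mulr_ge0.
have -> : (2 * x * (2^-1 * p)) ^+ n / n`!%:R / n`!%:R =
    (2 * x) ^+ n / n`!%:R * ((2^-1 * p) ^+ n / n`!%:R).
  by rewrite (exprMn _ (2 * x)); ring.
by apply: ler_wpM2r (expr_fact_le_expR n x20); rewrite divr_ge0 ?exprn_ge0.
Qed.

Lemma Gamma_euler_addn s n : 0 < Re s ->
  Gamma_euler (s + n%:R) = Gamma_euler s * pochhammer s n.
Proof.
move=> s0; elim: n => [|n IH]; first by rewrite addr0 /pochhammer big_ord0 mulr1.
have sn0 : 0 < Re (s + n%:R) by rewrite ReD Re_nat ltr_wpDr.
rewrite -natr1 addrA (Gamma_eulerS sn0) IH /pochhammer big_ord_recr /=.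
by rewrite mulrC mulrA.
Qed.

Definition hyp1F1_sum alpha gamma x N : R[i] := \sum_(n < N)
  pochhammer alpha n / pochhammer gamma n * x%:C ^+ n / n`!%:R.

Lemma hyp0F1_laplace beta s x N : 0 < Re beta -> 0 < x ->
  cintegrable H (fun p => cpow p (beta - 1) * (expR (- p))%:C * hyp0F1_sum s (x * p) N) /\
  cintegral H (fun p => cpow p (beta - 1) * (expR (- p))%:C * hyp0F1_sum s (x * p) N) =
  Gamma_euler beta * hyp1F1_sum beta s x N.
Proof.
move=> b0 x0.
pose c n : R[i] := x%:C ^+ n / n`!%:R / pochhammer s n.
pose h n p := c n * (cpow p (beta + n%:R - 1) * (expR (- (1 * p)))%:C).
have bn (n : nat) : 0 < Re (beta + n%:R) by rewrite ReD Re_nat ltr_wpDr.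
have i1 n := cintegrable_gamma (bn n) (@ltr01 R).
have ih n : cintegrable H (h n) by apply: cintegrableZ (i1 n); exact: measurable_halfline.
have hE p : 0 < p -> \sum_(n < N) h n p =
    cpow p (beta - 1) * (expR (- p))%:C * hyp0F1_sum s (x * p) N.
  move=> p0; rewrite /hyp0F1_sum mulr_sumr; apply: eq_bigr => n _.
  rewrite /h /c mul1r addrAC (cpowD p (beta - 1)) (cpow_nat _ p0) exprMn.
  rewrite !real_complexM real_complexV real_complex_nat (real_complexX x).
  move: (pochhammer _ _)^-1 (cpow _ _) => P C; ring.
split.
  apply: eq_cintegrable (cintegrable_sum N (@measurable_halfline R) ih).
    exact: measurable_halfline.
  exact: hE.
rewrite -(eq_cintegral hE) (cintegral_sum N (@measurable_halfline R) ih) mulr_sumr.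
apply: eq_bigr => n _; rewrite /h (cintegralZ _ (@measurable_halfline R) (i1 n)).
rewrite (cintegral_gamma (bn n) (@ltr01 R)) cpow1e mulr1 (Gamma_euler_addn n b0) /c.
by move: (Gamma_euler _) => G; ring.
Qed.

(** The partial sums of the series for Macdonald's function are dominated by
    e^(p/2), so the series is integrated term by term. *)
Lemma cvg_bessel_laplace beta nu x : Re nu = 0 -> Im nu != 0 -> 0 < Re beta ->
  Re beta < 1 -> 0 < x ->
  ccvg (fun N => Gamma (- nu) * (Gamma_euler beta * hyp1F1_sum beta (1 + nu) x N) +
    Gamma nu * cpow x (- nu) *
    (Gamma_euler (beta - nu) * hyp1F1_sum (beta - nu) (1 - nu) x N))
    (bessel_laplace beta nu x).
Proof.
move=> nu0 inu b0 b1 x0.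
have Rbn : Re (beta - nu) = Re beta by rewrite ReD ReN nu0 oppr0 addr0.
have b0' : 0 < Re (beta - nu) by rewrite Rbn.
have s1 : 1 <= Re (1 + nu) by rewrite ReD nu0 addr0.
have s2 : 1 <= Re (1 - nu) by rewrite ReD ReN nu0 oppr0 addr0.
pose f1 N p := cpow p (beta - 1) * (expR (- p))%:C * hyp0F1_sum (1 + nu) (x * p) N.
pose f2 N p := cpow p (beta - nu - 1) * (expR (- p))%:C * hyp0F1_sum (1 - nu) (x * p) N.
have L1 N := hyp0F1_laplace (1 + nu) N b0 x0.
have L2 N := hyp0F1_laplace (1 - nu) N b0' x0.
have i1 N : cintegrable H (f1 N) by case: (L1 N).
have i2 N : cintegrable H (f2 N) by case: (L2 N).
pose f N p := Gamma (- nu) * f1 N p + Gamma nu * cpow x (- nu) * f2 N p.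
have j1 N := cintegrableZ (Gamma (- nu)) (@measurable_halfline R) (i1 N).
have j2 N := cintegrableZ (Gamma nu * cpow x (- nu)) (@measurable_halfline R) (i2 N).
have if_ N : cintegrable H (f N) := cintegrableD (@measurable_halfline R) (j1 N) (j2 N).
set u := (X in ccvg X _).
have -> : u = fun N => cintegral H (f N).
  apply/funext => N; rewrite /u /f (cintegralD (@measurable_halfline R) (j1 N) (j2 N)).
  rewrite (cintegralZ _ (@measurable_halfline R) (i1 N)).
  rewrite (cintegralZ _ (@measurable_halfline R) (i2 N)).
  by rewrite (L1 N).2 (L2 N).2.
have fE N p : 0 < p -> f N p = cpow p (beta - 1) * (expR (- p))%:C *
    (Gamma (- nu) * hyp0F1_sum (1 + nu) (x * p) N +
     Gamma nu * cpow (x * p) (- nu) * hyp0F1_sum (1 - nu) (x * p) N).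
  move=> p0; rewrite /f /f1 /f2 (cpowMl _ x0 p0).
  rewrite (_ : beta - nu - 1 = (beta - 1) - nu) ?(cpowD _ (beta - 1)); last by ring.
  move: (hyp0F1_sum _ _ _) (hyp0F1_sum _ _ _) (Gamma _) (Gamma _) => h1 h2 G1 G2; ring.
clear u; clearbody f; clear i1 i2 j1 j2 L1 L2 f1 f2.
pose C := (normc (Gamma (- nu)) + normc (Gamma nu)) * expR (2 * x).
have C0 : 0 <= normc (Gamma (- nu)) + normc (Gamma nu) by rewrite addr_ge0 ?normc_ge0.
have half0 : 0 < 2^-1 :> R by rewrite invr_gt0.
have ih : mu.-integrable H
    (fun p => (C * (p `^ (Re beta - 1) * expR (- (2^-1 * p))))%:E).
  under eq_fun do rewrite EFinM.
  by apply: integrableZl => //; exact: (integrable_gamma b0 half0).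
apply: (cdominated_convergence
  (h := fun p => C * (p `^ (Re beta - 1) * expR (- (2^-1 * p))))) => //.
- by move=> N; exact: cintegrable_cmeasurable (if_ N).
- by apply: cintegrable_cmeasurable; case: (bessel_laplace_tricomi nu0 b0 b1 x0).
- move=> N p p0; rewrite (fE _ _ p0) -mulrA (normc_cpowM _ _ p0) (normc_realM _ (expR_ge0 _)) ReB1.
  have B1 := normc_hyp0F1_sum N s1 (ltW x0) (ltW p0).
  have B2 := normc_hyp0F1_sum N s2 (ltW x0) (ltW p0).
  have xp0 : 0 < x * p by rewrite mulr_gt0.
  have nx : normc (cpow (x * p) (- nu)) = 1.
    by rewrite (normc_cpow _ xp0) ReN nu0 oppr0 powRr0.
  have -> : expR (- (2^-1 * p)) = expR (- p) * expR (2^-1 * p).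
    by rewrite -expRD; congr expR; field.
  move: (normc_ge0 (Gamma (- nu))) (normc_ge0 (Gamma nu)) B1 B2 nx.
  move: (powR_ge0 p (Re beta - 1)) (expR_ge0 (- p)).
  rewrite /C; clear; move: (expR (2^-1 * p)) (p `^ _) (expR (- p)) (expR (2 * x)) => E P F D.
  move: (Gamma _) (Gamma _) (hyp0F1_sum _ _ _) (hyp0F1_sum _ _ _) (cpow _ _).
  move=> G1 G2 h1 h2 c P0 F0 G10 G20 B1 B2 nx.
  rewrite (_ : _ * (P * (F * E)) = P * (F * ((normc G1 + normc G2) * (D * E)))); last by ring.
  apply: (ler_wpM2l P0); apply: (ler_wpM2l F0); apply: le_trans (normcD_le _ _) _.
  rewrite !Normc.normcM nx mulr1 mulrDl [leRHS]addrC; apply: lerD.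
    exact: ler_wpM2l.
  exact: ler_wpM2l.
- move=> p p0; under eq_fun do rewrite (fE _ _ p0); apply: ccvgZ.
  by apply: cvg_bessel => //; rewrite mulr_gt0.
Qed.

Lemma ccvg_series_dom (u : nat -> R[i]) (v : nat -> R) :
  (forall n, normc (u n) <= v n) -> cvgn (series v) ->
  exists l, ccvg (fun N => \sum_(n < N) u n) l.
Proof.
move=> uv cv.
have aux (w : nat -> R) : (forall n, `|w n| <= normc (u n)) -> cvgn (series w).
  move=> wu; apply: normed_cvg; apply: series_le_cvg cv => n //=.
    exact: le_trans (normr_ge0 _) (le_trans (wu n) (uv n)).
  exact: le_trans (wu n) (uv n).
have cR := aux (fun n => Re (u n)) (fun n => Re_le_normc (u n)).
have cI := aux (fun n => Im (u n)) (fun n => Im_le_normc (u n)).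
exists (limn (series (fun n => Re (u n))) +i* limn (series (fun n => Im (u n)))).
split => /=.
- rewrite (_ : (fun _ => _) = series (fun n => Re (u n)))//; apply/funext => N.
  by rewrite /series /= big_mkord; elim/big_ind2: _ => // a b c d <- <-; rewrite ReD.
- rewrite (_ : (fun _ => _) = series (fun n => Im (u n)))//; apply/funext => N.
  by rewrite /series /= big_mkord; elim/big_ind2: _ => // a b c d <- <-; rewrite ImD.
Qed.

(** The crude geometric growth suffices, since 1F1 has a further n! below. *)
Lemma pochhammer_le s n : normc (pochhammer s n) <= n`!%:R * (1 + normc s) ^+ n.
Proof.
elim: n => [|n IH].
  by rewrite /pochhammer big_ord0 fact0 expr0 mulr1 Normc.normc1.
rewrite /pochhammer big_ord_recr /= -/(pochhammer s n) Normc.normcM.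
rewrite factS mulnC natrM exprSr mulrACA; apply: ler_pM (normc_ge0 _) (normc_ge0 _) IH _.
apply: le_trans (normcD_le _ _) _; rewrite -real_complex_nat normc_real ger0_norm// -nat1r.
have := normc_ge0 s; have := ler0n R n; move: (normc s) => a a0 n0; nra.
Qed.

Lemma cvg_hyp1F1 alpha gamma x : 1 <= Re gamma -> 0 <= x ->
  ccvg (hyp1F1_sum alpha gamma x) (hyp1F1 alpha gamma x).
Proof.
move=> g1 x0.
pose u n := pochhammer alpha n / pochhammer gamma n * x%:C ^+ n / n`!%:R.
have [||l ul] := @ccvg_series_dom u (exp_coeff ((1 + normc alpha) * x)).
- move=> n; rewrite /u !Normc.normcM !Normc.normcV normcX normc_real (ger0_norm x0).
  rewrite -real_complex_nat normc_real ger0_norm// /exp_coeff /= exprMn.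
  have f0 : 0 < n`!%:R :> R by rewrite ltr0n fact_gt0.
  rewrite ler_pM2r ?invr_gt0//; apply: (ler_wpM2r (exprn_ge0 _ x0)).
  rewrite ler_pdivrMr; last exact: lt_le_trans (fact_le_pochhammer n g1).
  apply: le_trans (pochhammer_le alpha n) _; rewrite mulrC.
  apply: ler_wpM2l; first by rewrite exprn_ge0// addr_ge0 ?normc_ge0.
  exact: fact_le_pochhammer.
- exact: is_cvg_series_exp_coeff.
suff -> : hyp1F1 alpha gamma x = l by exact: ul.
transitivity (limn ((fun N => \sum_(n < N) u n) : nat -> R[i]^o)); last exact: ccvg_lim.
rewrite /hyp1F1; set f := series _; suff -> : f = fun N => \sum_(n < N) u n by [].
by apply/funext => N; rewrite /f /series /= big_mkord.
Qed.

(** The Laplace transform of Macdonald's function is a multiple of Tricomi's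
    integral and also a combination of two series 1F1; divided by the Gamma
    factors, the latter is the definition of the Whittaker function. *)
Lemma whittakerE (kappa : R) (m : R[i]) x :
  - 2^-1 < kappa -> kappa < 2^-1 -> Re m = 0 -> Im m != 0 -> 0 < x ->
  whittakerW kappa%:C m x = (Num.sqrt x * expR (- (x / 2)))%:C *
    (cpow x (- m) / Gamma (2%:R^-1 - kappa%:C - m) *
     tricomi (2%:R^-1 - kappa%:C - m) (1 - (2%:R^-1 - kappa%:C + m)) x).
Proof.
move=> k1 k2 Rem Imm x0; rewrite /whittakerW; congr (_ * _).
set rho := _ - m; set beta := _ + m; set nu := 2%:R * m.
have Re_half : Re (2%:R^-1 : R[i]) = 2^-1.
  by rewrite -real_complex_nat -real_complexV.
have Rnu : Re nu = 0 by rewrite /nu ReM Rem Im_nat mulr0 mul0r subr0.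
have Inu : Im nu != 0 by rewrite /nu ImM Im_nat Re_nat mul0r addr0 mulf_neq0.
have Rb : Re beta = 2^-1 - kappa by rewrite /beta !ReD ReN Re_half Rem /= addr0.
have Rr : Re rho = 2^-1 - kappa by rewrite /rho !ReD !ReN Re_half Rem /= oppr0 addr0.
have b0 : 0 < Re beta by rewrite Rb; lra.
have b1 : Re beta < 1 by rewrite Rb; lra.
have r0 : 0 < Re rho by rewrite Rr; lra.
have brn : beta - nu = rho by rewrite /beta /rho /nu; ring.
have L := cvg_bessel_laplace Rnu Inu b0 b1 x0.
have E := (bessel_laplace_tricomi Rnu b0 b1 x0).2.
have s1 : 1 <= Re (1 + nu) by rewrite ReD Rnu addr0.
have s2 : 1 <= Re (1 - nu) by rewrite ReD ReN Rnu oppr0 addr0.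
have c1 := cvg_hyp1F1 beta s1 (ltW x0).
have c2 := cvg_hyp1F1 rho s2 (ltW x0).
rewrite brn in L E.
have L' := ccvgD (ccvgZ (Gamma (- nu)) (ccvgZ (Gamma_euler beta) c1))
  (ccvgZ (Gamma nu * cpow x (- nu)) (ccvgZ (Gamma_euler rho) c2)).
have := ccvg_unique L L'; rewrite E; clear E L L' c1 c2.
have Gb : Gamma beta != 0 := Gamma_neq0 b0.
have Gr : Gamma rho != 0 := Gamma_neq0 r0.
rewrite -(GammaE b0) -(GammaE r0) [nu + 1]addrC [- nu + 1]addrC.
have -> : cpow x (- nu) = cpow x (- m) * cpow x (- m).
  by rewrite -cpowD; congr cpow; rewrite /nu; ring.
have -> : cpow x m = (cpow x (- m))^-1 by rewrite cpowN invrK.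
move: (cpow_neq0 x (- m)); move: (cpow x (- m)) (tricomi _ _ _) (hyp1F1 _ _ _) (hyp1F1 _ _ _).
move: (Gamma beta) (Gamma rho) Gb Gr (Gamma nu) (Gamma (- nu)).
move=> Gb Gr Gb0 Gr0 G1 G2 c T' F1 F2 c0 E.
clear -Gb0 Gr0 c0 E.
apply: (mulfI c0); apply: (mulfI Gb0).
transitivity ((G2 * (Gb * F2) + G1 * (c * c) * (Gr * F1)) / Gr).
  by field; rewrite Gr0 Gb0 c0.
by rewrite -E; field.
Qed.

End Whittaker.

(** * The integral operators *)

Section Kernel.
Context {R : realType}.
Notation H := (@halfline R).
Implicit Types (a s m x y : R).

Let half : R[i] := 2%:R^-1.

Lemma imaginaryE m : ('i * m%:C : R[i]) = 0 +i* m.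
Proof. by rewrite -complexiE; simpc. Qed.

(** The two parameters of Tricomi's integral are exchanged when a changes sign. *)
Lemma fbmE a m x : - 2^-1 < a -> a < 2^-1 -> 0 < m -> 0 < x ->
  let im : R[i] := 'i * m%:C in
  fbm a m x = cpow x (half - im - 1) * (expR (- (x / 2)))%:C / Gamma (half - a%:C - im) *
    tricomi (half - a%:C - im) (half + a%:C - im) x.
Proof.
move=> a1 a2 m0 x0 im; rewrite /fbm whittakerE//; last 2 first.
- by rewrite imaginaryE.
- by rewrite imaginaryE /= gt_eqF.
rewrite -/half -/im (_ : 1 - (half - a%:C + im) = half + a%:C - im); last first.
  have -> : (1 : R[i]) = half + half by rewrite /half -div1r -splitr.
  by ring.
have sE : (Num.sqrt x)%:C = cpow x half.
  rewrite -powR12_sqrt ?ltW// -cpow_real// real_complexV real_complex_nat//.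
rewrite real_complexM sE (cpowB1 _ x0) (cpowD _ half).
move: (tricomi _ _ _) (Gamma _) => A B; ring.
Qed.

(** Up to factors in x alone, the integrand is the one of the Stieltjes transform
    of Tricomi's integral, and that transform exchanges the two parameters. *)
Lemma kernel_fbm s a m : - 2^-1 < a -> a < 2^-1 -> 0 < m ->
  let im : R[i] := 'i * m%:C in
  intop_defined (kernelA s a) (fbm (- a) m) /\
  forall x, 0 < x -> intop (kernelA s a) (fbm (- a) m) x =
    (s / pi)%:C * Gamma (half - a%:C + im) * Gamma (half - a%:C - im) * fbm a m x.
Proof.
move=> a1 a2 m0 im.
have Na1 : - 2^-1 < - a by rewrite ltrN2.
have Na2 : - a < 2^-1 by rewrite ltrNl.
set b := half + a%:C - im; set d := half - a%:C - im.
have Re_half : Re half = 2^-1.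
  by rewrite /half -real_complex_nat -real_complexV.
have Rim : Re im = 0 by rewrite /im imaginaryE.
have Rb : Re b = 2^-1 + a by rewrite /b !ReD ReN Re_half Rim oppr0 addr0.
have Rd : Re d = 2^-1 - a by rewrite /d !ReD !ReN Re_half Rim oppr0 addr0.
have b0 : 0 < Re b by rewrite Rb; lra.
have d0 : 0 < Re d by rewrite Rd; lra.
have bd : Re b + Re d = 1 by rewrite Rb Rd; field.
have halfD : half + half = 1 by rewrite /half -div1r -splitr.
have b'E : 1 - b = half - a%:C + im by rewrite /b -halfD; ring.
have b'0 : 0 < Re (1 - b) by rewrite ReD ReN Rb /=; lra.
have Gb0 := Gamma_neq0 b0; have Gd0 := Gamma_neq0 d0.
pose c x : R[i] := (s / pi)%:C * cpow x a%:C * (expR (- (x / 2)))%:C / Gamma b.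
have KE x y : 0 < x -> 0 < y -> c x * (cpow y (d - 1) * (expR (- y) / (x + y))%:C *
    tricomi b d y) = (kernelA s a x y)%:C * fbm (- a) m y.
  move=> x0 y0; rewrite (fbmE Na1 Na2 m0 y0) -/im !real_complexN opprK -/b -/d.
  have yV0 : 0 < y^-1 by rewrite invr_gt0.
  have xy0 : 0 < x / y by rewrite divr_gt0.
  rewrite /kernelA !(real_complexM (_ * _)) !(real_complexM (expR _)).
  rewrite -(cpow_real _ xy0) (cpowMl _ x0 yV0) (cpowVl _ y0).
  rewrite (_ : d - 1 = (half - im - 1) - a%:C) ?(cpowD y (half - im - 1)); last first.
    by rewrite /d; ring.
  have eE : expR (- ((x + y) / 2)) * expR (- (y / 2)) = expR (- (x / 2)) * expR (- y).
    by rewrite -!expRD; congr expR; field.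
  move/(congr1 (fun t => t%:C)) : eE; rewrite !real_complexM /c.
  transitivity ((s / pi)%:C * cpow x a%:C * cpow y (half - im - 1) * cpow y (- a%:C) *
      ((x + y)^-1)%:C / Gamma b * tricomi b d y * ((expR (- (x / 2)))%:C * (expR (- y))%:C)).
    by move: (Gamma b) (tricomi _ _ _) => G T; ring.
  by rewrite -eE; move: (Gamma b) (tricomi _ _ _) => G T; ring.
have main x (x0 : 0 < x) := stieltjes_tricomi b0 d0 bd x0.
split=> x x0.
  have [i1 _] := main _ x0.
  apply: eq_cintegrable (cintegrableZ (c x) (@measurable_halfline R) i1).
    exact: measurable_halfline.
  by move=> y y0; exact: KE.
have [i1 E1] := main _ x0.
transitivity (cintegral H (fun y => c x * (cpow y (d - 1) * (expR (- y) / (x + y))%:C *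
    tricomi b d y))).
  by apply: eq_cintegral => y y0; rewrite -(KE _ _ x0 y0).
rewrite (cintegralZ _ (@measurable_halfline R) i1) E1 (fbmE a1 a2 m0 x0) -/im -/b -/d.
rewrite -b'E (GammaE b'0) -(GammaE b0) /c.
have -> : cpow x (half - im - 1) = cpow x a%:C * cpow x (d - 1).
  by rewrite -cpowD; congr cpow; rewrite /d; ring.
move: (Gamma b) (Gamma d) (Gamma_euler _) (tricomi _ _ _) Gb0 Gd0 => G1 G2 G3 T G10 G20.
by move: (s / pi)%:C (expR _)%:C => u v; field; rewrite G10 G20.
Qed.

End Kernel.

Theorem theorem3p2 (R : realType) (z z' : R[i]) (hzz' : admissible z z')
    (ha : `|param_a z z'| < 2%:R^-1) (m : R) (hm : 0 < m) :
  let a := param_a z z' in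
  let s := sigma z z' in
  let A := kernelA s a in
  let B := kernelB s a in
  let half : R[i] := 2%:R^-1 in
  let im : R[i] := 'i * m%:C in
  [/\ intop_defined A (fbm (- a) m),
      forall x : R, 0 < x ->
        intop A (fbm (- a) m) x =
        (s / pi)%:C * Gamma (half - a%:C + im) * Gamma (half - a%:C - im) *
        fbm a m x,
      intop_defined B (fbm a m) &
      forall x : R, 0 < x ->
        intop B (fbm a m) x =
        (s / pi)%:C * Gamma (half + a%:C + im) * Gamma (half + a%:C - im) *
        fbm (- a) m x].
Proof.
move=> a s A B half im.
have [a1 a2] : - 2^-1 < a /\ a < 2^-1 by move: ha; rewrite ltr_norml => /andP.
have Na1 : - 2^-1 < - a by rewrite ltrN2.
have Na2 : - a < 2^-1 by rewrite ltrNl.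
have [A1 A2] := kernel_fbm s a1 a2 hm.
have [B1 B2] := kernel_fbm s Na1 Na2 hm.
rewrite opprK in B1 B2.
have BE (x y : R) : 0 < x -> 0 < y -> B x y = kernelA s (- a) x y.
  by move=> x0 y0; rewrite /B kernelBE.
split; [exact: A1|exact: A2| |].
- move=> x x0; apply: eq_cintegrable (B1 x x0); first exact: measurable_halfline.
  by move=> y y0; rewrite BE.
- move=> x x0; have := B2 x x0; rewrite real_complexN opprK => <-.
  by apply: eq_cintegral => y y0; rewrite BE.
Qed.
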